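(* Let $A\subset\mathbb R^n$ be such that the class $\mathcal E^+(A)$ is closed in the strong topology on $\mathcal E^+$, and let $f=\psi+U^\vartheta+U^\omega$ be an external field on $\overline A$ satisfying $\psi\in\Phi(\overline A)$, $\vartheta\in\mathcal E$, $\omega\in\mathfrak M$ bounded with $\inf_{x\in S(\omega),\,y\in A}|x-y|>0$, and $c_*(\{x\in A:\psi(x)<\infty\})>0$. If $c_*(A)<\infty$, then there exists a (unique) measure $\lambda_{A,f}\in\breve{\mathcal E}^+_f(A)$ with $I_f(\lambda_{A,f})=w_f(A)$.
   Context: Fix $n\ge 2$ and $0<\alpha<n$. $\mathfrak M$ is the space of real-valued (signed) Radon measures $\mu$ on $\mathbb R^n$, always assumed to satisfy $\int_{|y|>1}|y|^{\alpha-n}\,d|\mu|(y)<\infty$, with the vague topology (pointwise convergence on continuous functions of compact support); $\mathfrak M^+$ is the cone of positive ones; $\mu$ is bounded if $|\mu|(\mathbb R^n)<\infty$; $S(\mu)$ is the support. $U^\mu(x)=\int|x-y|^{\alpha-n}\,d\mu(y)$ is the $\alpha$-Riesz potential, $I(\mu,\nu)=\iint|x-y|^{\alpha-n}\,d\mu(x)\,d\nu(y)$, $I(\mu)=I(\mu,\mu)$. $\mathcal E$ is the pre-Hilbert space of all $\mu\in\mathfrak M$ of finite energy, with inner product $I(\mu,\nu)$ and norm $\|\mu\|=\sqrt{I(\mu)}$; the norm topology is called strong; $\mathcal E^+=\mathcal E\cap\mathfrak M^+$. For $A\subset\mathbb R^n$: $\mathfrak M^+(A)$ is the set of $\mu\in\mathfrak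 M^+$ concentrated on $A$ (i.e. $\mathbb R^n\setminus A$ is $\mu$-negligible); $\mathcal E^+(A)=\mathcal E\cap\mathfrak M^+(A)$; $\breve{\mathcal E}^+(A)=\{\mu\in\mathcal E^+(A):\mu(\mathbb R^n)=1\}$. Inner capacity: $c_*(A)=1/\inf\{I(\mu):\mu\in\breve{\mathcal E}^+(A)\}$ (with $\inf\varnothing=+\infty$, $1/(+\infty)=0$). For closed $F$, $\Phi(F)$ is the class of lower semicontinuous functions $g:F\to(-\infty,\infty]$ that are $\ge0$ unless $F$ is compact. For $\omega=0$ the distance from $S(\omega)=\varnothing$ to $A$ is $+\infty$. The field $f$ is well defined on $\overline A$ outside a set of zero outer capacity. $\mathcal E^+_f(A)$ is the set of $\mu\in\mathcal E^+(A)$ for which $f$ is $\mu$-integrable, $\breve{\mathcal E}^+_f(A)=\mathcal E^+_f(A)\cap\breve{\mathcal E}^+(A)$, $I_f(\mu)=I(\mu)+2\int f\,d\mu$, and $w_f(A)=\inf_{\mu\in\breve{\mathcal E}^+_f(A)}I_f(\mu)$. *)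

(* Defs.v *)
From HB Require Import structures.
From mathcomp Require Import all_boot all_order all_algebra.
From mathcomp Require Import all_classical all_reals all_analysis.
Set Implicit Arguments.
Unset Strict Implicit.
Unset Printing Implicit Defensive.
Import Order.TTheory GRing.Theory Num.Theory.
Import numFieldNormedType.Exports.
Local Open Scope classical_set_scope.
Local Open Scope ring_scope.

Notation borelRn R n := (g_sigma_algebraType (@open 'rV[R]_n)).

(* The library norm on ['rV[R]_n] is the sup norm; it induces the same topology
   as [enorm], but the Riesz kernel needs the Euclidean one. *)
Definition enorm (R : realType) (n : nat) (x : 'rV[R]_n) : R :=
  Num.sqrt (\sum_(i < n) x ord0 i ^+ 2).

(* The diagonal is separate because [powR] sets [0 `^ p = 0] for [p != 0]. *)
Definition riesz_kernel (R : realType) (n : nat) (alpha : R)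
    (x y : 'rV[R]_n) : \bar R :=
  if x == y then +oo%E else (enorm (x - y) `^ (alpha - n%:R))%:E.

(* The cone M^+. A Borel measure on R^n that is finite on compact sets is
   automatically regular, hence Radon. *)
Definition pos_radon (R : realType) (n : nat) (alpha : R)
    (mu : {measure set borelRn R n -> \bar R}) : Prop :=
  (forall K : set 'rV[R]_n, compact K -> (mu K < +oo)%E) /\
  (\int[mu]_(y in [set y : 'rV[R]_n | (1 < enorm y)%R])
     (enorm (y : 'rV[R]_n) `^ (alpha - n%:R))%:E < +oo)%E.

(* The space M. A signed Radon measure need not have a value on every Borel set
   (oo - oo), so it is given by its Jordan decomposition. *)
Record signed_radon (R : realType) (n : nat) (alpha : R) := SignedRadon {
  pos_part : {measure set borelRn R n -> \bar R} ;
  neg_part : {measure set borelRn R n -> \bar R} ;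
  pos_part_radon : pos_radon alpha pos_part ;
  neg_part_radon : pos_radon alpha neg_part ;
  pos_neg_singular : exists2 P : set (borelRn R n), measurable P &
    pos_part (~` P) = 0%E /\ neg_part P = 0%E }.

Section potential.
Variables (R : realType) (n : nat) (alpha : R).
Local Notation Rn := 'rV[R]_n.
Local Notation posmeas := {measure set borelRn R n -> \bar R}.
Local Notation sradon := (signed_radon n alpha).
Implicit Types (mu nu : posmeas) (s t : sradon) (A F : set Rn).

Definition abs_signed s (B : set Rn) : \bar R :=
  (pos_part s B + neg_part s B)%E.

Definition bounded_signed s : Prop := (abs_signed s setT < +oo)%E.

Definition support_signed s : set Rn :=
  [set x | forall V : set Rn, open V -> V x -> (0 < abs_signed s V)%E].

Definition potential mu (x : Rn) : \bar R :=
  (\int[mu]_y riesz_kernel alpha x y)%E.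

Definition spotential s (x : Rn) : \bar R :=
  (potential (pos_part s) x - potential (neg_part s) x)%E.

Definition energy mu nu : \bar R :=
  (\int[mu]_x \int[nu]_y riesz_kernel alpha x y)%E.

Definition senergy_pos s t : \bar R :=
  (energy (pos_part s) (pos_part t) + energy (neg_part s) (neg_part t))%E.

Definition senergy_neg s t : \bar R :=
  (energy (pos_part s) (neg_part t) + energy (neg_part s) (pos_part t))%E.

Definition senergy_defined s t : Prop :=
  (senergy_pos s t < +oo)%E \/ (senergy_neg s t < +oo)%E.

Definition senergy s t : \bar R := (senergy_pos s t - senergy_neg s t)%E.

Definition finite_energy s : Prop :=
  senergy_defined s s /\ senergy s s \is a fin_num.

Definition energy_norm s : R := Num.sqrt (fine (senergy s s)).

(* [s] is the signed measure [mu - nu] (stated without subtracting infinite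
   values); for positive Radon [mu], [nu] such an [s] exists and its two parts
   are determined on all Borel sets. *)
Definition is_difference s mu nu : Prop :=
  forall B : set (borelRn R n), measurable B ->
    (pos_part s B + nu B = mu B + neg_part s B)%E.

Definition Eplus : set posmeas :=
  [set mu | pos_radon alpha mu /\ (energy mu mu < +oo)%E].

(* [A] is an arbitrary set: [mu.-negligible] asks that its complement be
   contained in a Borel [mu]-null set. *)
Definition Eplus_on A : set posmeas :=
  [set mu | Eplus mu /\ mu.-negligible (~` A)].

Definition Eplus1_on A : set posmeas :=
  [set mu | Eplus_on A mu /\ mu setT = 1%E].

(* The strong topology is the metric topology of [energy_norm]. *)
Definition strongly_adherent (C : set posmeas) mu : Prop :=
  forall e : R, 0 < e ->
    exists nu s, [/\ C nu, is_difference s mu nu & energy_norm s < e].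

Definition Eplus_strongly_closed A : Prop :=
  forall mu, Eplus mu -> strongly_adherent (Eplus_on A) mu -> Eplus_on A mu.

(* In [\bar R], [+oo^-1 = 0] and [0^-1 = +oo]. *)
Definition inner_capacity A : \bar R :=
  ((ereal_inf [set energy mu mu | mu in Eplus1_on A])^-1)%E.

(* The class Phi(F); only the values of [psi] on [F] matter, since points
   outside [F] are isolated in [subspace F]. *)
Definition lsc_class F (psi : Rn -> \bar R) : Prop :=
  [/\ lower_semicontinuous (psi : subspace F -> \bar R),
      (forall x, F x -> (-oo < psi x)%E) &
      ~ compact F -> forall x, F x -> (0 <= psi x)%E].

(* The infimum over the empty set is [+oo]. *)
Definition set_dist F A : \bar R :=
  ereal_inf [set (enorm (x - y))%:E | x in F & y in A].

(* [f = psi + U^theta + U^omega]. At points where this sum is [oo - oo] the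
   value is the library's convention; when [theta] has finite energy these
   points form a null set for every measure in [Eplus]. *)
Definition external_field (psi : Rn -> \bar R) (theta omega : sradon)
    (x : Rn) : \bar R :=
  (psi x + spotential theta x + spotential omega x)%E.

(* A measure concentrated on [A] is carried by the closed, hence Borel, set
   [closure A], on which [f] is given. *)
Definition Eplus_field A (f : Rn -> \bar R) : set posmeas :=
  [set mu | Eplus_on A mu /\ mu.-integrable (closure A) f].

Definition Eplus1_field A (f : Rn -> \bar R) : set posmeas :=
  Eplus_field A f `&` Eplus1_on A.

Definition gauss_functional A (f : Rn -> \bar R) mu : \bar R :=
  (energy mu mu + 2%:E * \int[mu]_(x in closure A) f x)%E.

Definition gauss_inf A (f : Rn -> \bar R) : \bar R :=
  ereal_inf [set gauss_functional A f mu | mu in Eplus1_field A f].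

(* Elements of the measure type may differ on non-measurable sets, where their
   values are meaningless. *)
Definition same_measure mu nu : Prop :=
  forall B : set (borelRn R n), measurable B -> mu B = nu B.

End potential.

(* Main.v *)
From HB Require Import structures.
Require Import Defs.
From mathcomp Require Import all_boot all_order all_algebra.
From mathcomp Require Import all_classical all_reals all_analysis.
From mathcomp Require Import measurable_realfun.
From mathcomp Require Import ring lra.
Set Implicit Arguments.
Unset Strict Implicit.
Unset Printing Implicit Defensive.
Import Order.TTheory GRing.Theory Num.Theory.
Import numFieldNormedType.Exports.
Local Open Scope classical_set_scope.
Local Open Scope ring_scope.

(* With b = (n - alpha) / 2, the kernel |x - y|^(alpha - n) is proportional to
   the integral over s of e^(b s) exp(- e^s |x - y|^2), and every Gaussian is a
   self-convolution of Gaussians.  Hence the kernel is the integral over z of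
   H(x, z) H(y, z) for some H >= 0 which is bounded and continuous in x: the
   mutual energy is the L^2 product of the transforms of the two measures, and
   equality of the transforms forces equality of probability measures, since
   narrow Gaussians determine a measure.
   By the parallelogram identity a minimizing sequence is Cauchy.  It is tight:
   the infimum of the energy over the probability measures carried by A outside
   a ball tends to +oo with the radius, for otherwise almost minimizing measures
   carried by sets far from each other would be both almost equal (parallelogram
   identity) and almost orthogonal, against c_*(A) < +oo.  A weak limit of mass
   one then exists; its transform is the limit of the transforms, so it is also
   the strong limit and is carried by A.  The potential of theta is strongly
   continuous, psi + U^omega is lower semicontinuous on the closure of A, and so
   the limit is a minimizer; uniqueness is again the parallelogram identity. *)

(** * Weak limits of tight sequences *)

(** The kernel is unbounded, so weak convergence makes the energy only lower semicontinuous. But the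
    field contains a difference of two potentials, in general semicontinuous in neither sense, and
    [A] is arbitrary, so that a weak limit may leave it. Strong convergence repairs both, and the
    factorization links the two modes: for fixed z, H(., z) is bounded and continuous, hence a test
    function for weak convergence, while the energy norm is an L^2 norm in z. Subtraction of
    infinite quantities is avoided: the squared distance is defined from the transforms of two
    positive measures, identities are stated with all terms added, and a signed difference of
    measures is formed only to apply the hypothesis on the strong topology. Likewise no square
    roots: Young's inequality with a free parameter e replaces Cauchy-Schwarz, and e is later tuned
    to the rate of convergence. The energy of a single measure controls nothing at infinity when [A]
    is unbounded; keeping the mass of a minimizing sequence in a compact set is the one step that
    rests on the finite capacity. *)

Section borel_sets.
Variables (R : realType) (n : nat).
Local Notation Rn := 'rV[R]_n.
Local Notation X := (borelRn R n).

Lemma open_borel (G : set Rn) : open G -> measurable (G : set X).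
Proof. by move=> oG; apply: sub_sigma_algebra. Qed.

Lemma closed_borel (F : set Rn) : closed F -> measurable (F : set X).
Proof.
move=> cF; rewrite -[F]setCK; apply: measurableC; apply: open_borel.
by rewrite openC.
Qed.

Lemma hausdorff_rV : hausdorff_space Rn.
Proof. exact: norm_hausdorff. Qed.

Lemma compact_borel (K : set Rn) : compact K -> measurable (K : set X).
Proof. by move=> cK; apply: closed_borel; exact: (compact_closed hausdorff_rV). Qed.

Lemma compact_setD_open (K G : set Rn) : compact K -> open G -> compact (K `\` G).
Proof.
move=> cK oG; apply: (subclosed_compact _ cK); last exact: subIsetl.
rewrite setDE; apply: closedI; last by rewrite closedC.
exact: (compact_closed hausdorff_rV).
Qed.

(** The disjoint compact sets [K \ G2] and [K \ G1] have disjoint open neighbourhoods U and V by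
    normality, and removing V from K leaves a part of [G1]. This splitting yields subadditivity of a
    content on open sets. *)
Lemma compact_split_openU (K G1 G2 : set Rn) : compact K -> open G1 -> open G2 ->
  K `<=` G1 `|` G2 -> exists K1 K2, [/\ compact K1, compact K2, K1 `<=` G1,
    K2 `<=` G2 & K = K1 `|` K2].
Proof.
move=> cK oG1 oG2 KG.
have cK1 : compact (K `\` G2) by exact: compact_setD_open.
have cK2 : compact (K `\` G1) by exact: compact_setD_open.
have [|U [V [oU oV UK VK UV]]] := (@normal_openP R Rn).1 (@pseudometric_normal R Rn) _ _
  (compact_closed hausdorff_rV cK1) (compact_closed hausdorff_rV cK2).
  rewrite -subset0 => x [[Kx n2] [_ n1]].
  by case: (KG _ Kx).
exists (K `\` V), (K `\` U); split.
- exact: compact_setD_open.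
- exact: compact_setD_open.
- move=> x [Kx Vx]; apply: contrapT => n1; apply: Vx; exact: VK.
- move=> x [Kx Ux]; apply: contrapT => n1; apply: Ux; exact: UK.
- rewrite -setDIr setIC UV setD0 //.
Qed.

End borel_sets.

(** * The limit along an ultrafilter as a Borel measure *)

Section ultralimit_measure.
Variables (R : realType) (n : nat).
Local Notation Rn := 'rV[R]_n.
Local Notation X := (borelRn R n).
Variable mu_ : nat -> {measure set X -> \bar R}.
Hypothesis mu1 : forall k, mu_ k setT = 1%E.
Variable U : set_system nat.
Hypothesis UU : UltraFilter U.
Hypothesis Uoo : forall N, U [set k | (N <= k)%N].


Lemma mass1_bounds k A : measurable A -> (0 <= mu_ k A <= 1)%E.
Proof. by move=> mA; rewrite measure_ge0/= -(mu1 k) le_measure ?inE. Qed.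

Lemma mass1_fin k A : measurable A -> mu_ k A \is a fin_num.
Proof.
move=> mA; have /andP[h0 h1] := mass1_bounds k mA.
by rewrite ge0_fin_numE// (le_lt_trans h1)// ltry.
Qed.

Definition ulim (A : set X) : R := lim (fine (mu_ k A) @[k --> U]).

(** The image of an ultrafilter is an ultrafilter, and on the compact interval [0, 1] every
    ultrafilter converges; so all sets are treated at once and no subsequence is extracted. *)
Lemma ulim_cvg A : measurable A -> fine (mu_ k A) @[k --> U] --> ulim A.
Proof.
move=> mA; apply/cvg_ex.
have := @segment_compact R 0 1; rewrite compact_ultra /=.
pose u k := fine (mu_ k A).
move=> /(_ (u @ U)) [].
- split; first exact: fmap_proper_filter.
  move=> F' FF' sub; apply/seteqP; split; last exact: sub.
  move=> B F'B; have [//|UnB] := in_ultra_setVsetC (u @^-1` B) UU.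
  have : F' (B `&` ~` B) by apply: filterI => //; exact: sub.
  by rewrite setICr => /filter_ex[].
- rewrite /nbhs/=; apply: filterS (Uoo 0) => k _ /=; rewrite /u in_itv/=.
  have := mass1_bounds k mA; rewrite -(fineK (mass1_fin k mA)) !lee_fin /=.
  by [].
- by move=> l [_ ul]; exists l.
Qed.

Lemma ulim_le A a N : measurable A -> (forall k, (N <= k)%N -> (mu_ k A <= a%:E)%E) ->
  ulim A <= a.
Proof.
move=> mA h; apply: (closed_cvg (fun x => x <= a)) (ulim_cvg mA).
  exact: closed_le.
apply: filterS (Uoo N) => k /= Nk.
by rewrite -lee_fin fineK ?mass1_fin// h.
Qed.

Lemma ulim_ge A a N : measurable A -> (forall k, (N <= k)%N -> (a%:E <= mu_ k A)%E) ->
  a <= ulim A.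
Proof.
move=> mA h; apply: (closed_cvg (fun x => a <= x)) (ulim_cvg mA).
  exact: closed_ge.
apply: filterS (Uoo N) => k /= Nk.
by rewrite -lee_fin fineK ?mass1_fin// h.
Qed.

Lemma ulim_ge0 A : measurable A -> 0 <= ulim A.
Proof. by move=> mA; apply: (@ulim_ge _ _ 0) => // k _; exact: measure_ge0. Qed.

Lemma ulim_le1 A : measurable A -> ulim A <= 1.
Proof. by move=> mA; apply: (@ulim_le _ _ 0) => // k _; have /andP[] := mass1_bounds k mA. Qed.

Lemma ulim_sum_cvg (I : Type) (s : seq I) (A : I -> set X) :
  (forall i, measurable (A i)) ->
  (\sum_(i <- s) fine (mu_ k (A i))) @[k --> U] --> \sum_(i <- s) ulim (A i).
Proof.
move=> mA; apply: cvg_big => [|i _]; first exact: add_continuous.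
exact: ulim_cvg.
Qed.

Lemma le_ulim A B : measurable A -> measurable B -> A `<=` B -> ulim A <= ulim B.
Proof.
move=> mA mB AB; apply: ler_cvg_to (ulim_cvg mA) (ulim_cvg mB) _.
apply: filterS (Uoo 0) => k _.
by rewrite fine_le ?mass1_fin// le_measure ?inE.
Qed.

Lemma ulimU A B : measurable A -> measurable B -> A `&` B = set0 ->
  ulim (A `|` B) = ulim A + ulim B.
Proof.
move=> mA mB AB.
have mAB : measurable (A `|` B) by exact: measurableU.
apply: cvg_unique (ulim_cvg mAB) _ => //.
have -> : (fun k => fine (mu_ k (A `|` B))) = (fun k => fine (mu_ k A) + fine (mu_ k B)).
  by apply/funext => k; rewrite measureU// fineD// mass1_fin.
by apply: cvgD; exact: ulim_cvg.
Qed.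

Lemma ulimU_le A B : measurable A -> measurable B ->
  ulim (A `|` B) <= ulim A + ulim B.
Proof.
move=> mA mB; have -> : A `|` B = A `|` (B `\` A).
  apply/seteqP; split=> x; last by case=> [|[]]; [left|right].
  by case=> [|Bx]; [left|have [|nA] := pselect (A x); [left|right]].
rewrite ulimU ?setDIK//; last exact: measurableD.
by rewrite lerD2l; apply: le_ulim; [exact: measurableD|by []|move=> x []].
Qed.

(* Along an ultrafilter every sequence of probability measures converges
   setwise, but only to a finitely additive limit; regularizing its values on
   compact sets restores countable additivity. *)
Definition inner_content (G : set Rn) : \bar R :=
  ereal_sup [set (ulim K)%:E | K in [set K : set Rn | compact K /\ K `<=` G]].

Lemma le_inner_content G H : G `<=` H -> (inner_content G <= inner_content H)%E.
Proof.
move=> GH; apply: ge_ereal_sup => _ [K [cK KG] <-].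
by apply: ereal_sup_ubound; exists K => //; split => //; exact: subset_trans GH.
Qed.

Lemma inner_content_ub (K G : set Rn) : compact K -> K `<=` G ->
  ((ulim K)%:E <= inner_content G)%E.
Proof. by move=> cK KG; apply: ereal_sup_ubound; exists K. Qed.

Lemma inner_content_ge0 G : (0 <= inner_content G)%E.
Proof.
apply: (@le_trans _ _ (ulim set0)%:E).
  by rewrite lee_fin; apply: ulim_ge0.
by apply: inner_content_ub => //; exact: compact0.
Qed.

Lemma inner_content_le_ulim G : measurable (G : set X) ->
  (inner_content G <= (ulim G)%:E)%E.
Proof.
move=> mG; apply: ge_ereal_sup => _ [K [cK KG] <-].
by rewrite lee_fin le_ulim//; exact: compact_borel.
Qed.

Lemma inner_contentU G H : open G -> open H ->
  (inner_content (G `|` H) <= inner_content G + inner_content H)%E.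
Proof.
move=> oG oH; apply: ge_ereal_sup => _ [K [cK KG] <-].
have [K1 [K2 [cK1 cK2 KG1 KG2 ->]]] := compact_split_openU cK oG oH KG.
apply: (@le_trans _ _ (ulim K1 + ulim K2)%:E).
  by rewrite lee_fin ulimU_le//; exact: compact_borel.
by rewrite EFinD leeD// inner_content_ub.
Qed.

Lemma inner_content0 : inner_content set0 = 0%E.
Proof.
apply/eqP; rewrite eq_le inner_content_ge0 andbT.
apply: (le_trans (inner_content_le_ulim _)) => //.
rewrite lee_fin; apply: (@ulim_le _ _ 0) => // k _.
by rewrite measure0.
Qed.

Lemma inner_content_bigU (G : nat -> set Rn) N : (forall i, open (G i)) ->
  (inner_content (\big[setU/set0]_(i < N) G i) <= \sum_(i < N) inner_content (G i))%E.
Proof.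
move=> oG; elim: N => [|N ih]; first by rewrite !big_ord0 inner_content0.
rewrite !big_ord_recr/=; apply: le_trans (leeD2r _ ih).
apply: inner_contentU => //.
by elim/big_ind : _ => // *; exact: openU.
Qed.

Lemma compact_bigcup_finite (K : set Rn) (G : nat -> set Rn) :
  compact K -> (forall i, open (G i)) -> K `<=` \bigcup_i G i ->
  exists N, K `<=` \big[setU/set0]_(i < N) G i.
Proof.
rewrite compact_cover => cK oG KG.
have [|D _ KD] := cK nat setT G (fun i _ => oG i); first by [].
exists (\max_(i <- finmap.enum_fset D) i).+1 => x /KD [i /= iD Gx].
rewrite -bigcup_mkord; exists i => //=.
rewrite ltnS; exact: leq_bigmax_seq.
Qed.

(** A compact subset of the union already lies in finitely many of the sets, so finite subadditivity
    suffices: here compactness turns the finitely additive [ulim] into something countably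
    subadditive. *)
Lemma inner_content_bigcup (G : nat -> set Rn) : (forall i, open (G i)) ->
  (inner_content (\bigcup_i G i) <= \sum_(i <oo) inner_content (G i))%E.
Proof.
move=> oG; apply: ge_ereal_sup => _ [K [cK KG] <-].
have [N KN] := compact_bigcup_finite cK oG KG.
apply: (le_trans (inner_content_ub cK KN)).
apply: (le_trans (inner_content_bigU N oG)).
rewrite -(big_mkord xpredT (fun i => inner_content (G i))).
by apply: nneseries_lim_ge => *; exact: inner_content_ge0.
Qed.

Definition outer_content (E : set Rn) : \bar R :=
  ereal_inf [set inner_content G | G in [set G : set Rn | open G /\ E `<=` G]].

Lemma outer_content_open G : open G -> outer_content G = inner_content G.
Proof.
move=> oG; apply/eqP; rewrite eq_le; apply/andP; split.
  by apply: ereal_inf_lbound; exists G => //; split.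
by apply: le_ereal_inf_tmp => _ [H [oH GH] <-]; exact: le_inner_content.
Qed.

Let outer0 : outer_content set0 = 0%E.
Proof. by rewrite outer_content_open ?inner_content0//; exact: open0. Qed.

Let outer_ge0 E : (0 <= outer_content E)%E.
Proof. by apply: le_ereal_inf_tmp => _ [H [oH GH] <-]; exact: inner_content_ge0. Qed.

Let outer_mono : {homo outer_content : A B / A `<=` B >-> (A <= B)%E}.
Proof.
move=> A B AB; apply: le_ereal_inf_tmp => _ [H [oH BH] <-].
by apply: ereal_inf_lbound; exists H => //; split => //; exact: subset_trans BH.
Qed.

Let outer_fin E : outer_content E \is a fin_num.
Proof.
rewrite ge0_fin_numE// (@le_lt_trans _ _ (outer_content setT))//.
  exact: outer_mono.
rewrite outer_content_open; last exact: openT.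
by apply: (le_lt_trans (inner_content_le_ulim _)) => //; exact: ltry.
Qed.

Let outer_sigma : sigma_subadditive outer_content.
Proof.
move=> F; apply/lee_addgt0Pr => e e0.
have H i : exists G : set Rn, [/\ open G, F i `<=` G &
    (inner_content G <= outer_content (F i) + (e / (2 ^ i.+1)%:R)%:E)%E].
  have e' : (0 < e / (2 ^ i.+1)%:R :> R) by rewrite divr_gt0.
  have := lb_ereal_inf_adherent e' (outer_fin (F i)).
  by move=> [_ [G [oG FG] <-] /ltW h]; exists G.
have [G hG] := choice H.
apply: (@le_trans _ _ (inner_content (\bigcup_i G i))).
  apply: ereal_inf_lbound; exists (\bigcup_i G i) => //; split.
    by apply: bigcup_open => i _; have [] := hG i.
  by apply: subset_bigcup => i _; have [] := hG i.
apply: (le_trans (inner_content_bigcup _)); first by move=> i; have [] := hG i.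
apply: (@le_trans _ _ (\sum_(i <oo) (outer_content (F i) + (e / (2 ^ i.+1)%:R)%:E))%E).
  apply: lee_nneseries => [i _ _|i _]; first exact: inner_content_ge0.
  by have [] := hG i.
by apply: epsilon_trick => //; exact: ltW.
Qed.

HB.instance Definition _ := isOuterMeasure.Build R Rn outer_content
  outer0 outer_ge0 outer_mono outer_sigma.

(** It is enough to test open V containing the given set. If K is compact in [V & G] and L is
    compact in [V \ K], then K and L are disjoint compact subsets of V, so their limit masses add up
    to at most the content of V; and [V \ G] is contained in [V \ K]. *)
Lemma open_caratheodory G : open G -> outer_content.-caratheodory G.
Proof.
move=> oG; apply: le_caratheodory_measurable => E.
apply: le_ereal_inf_tmp => _ [V [oV EV] <-].
apply: (@le_trans _ _ (inner_content (V `&` G) + outer_content (V `\` G))%E).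
  apply: leeD; last by apply: outer_mono; exact: setSD.
  rewrite -outer_content_open; last exact: openI.
  by apply: outer_mono; exact: setSI.
rewrite -leeBrDr ?outer_fin//.
apply: ge_ereal_sup => _ [K [cK KVG] <-].
rewrite leeBrDr ?outer_fin//.
have oVK : open (V `\` K).
  by rewrite setDE; apply: openI => //; rewrite openC; exact: (compact_closed (@hausdorff_rV R n)).
apply: (@le_trans _ _ ((ulim K)%:E + inner_content (V `\` K))%E).
  rewrite leeD2l// -outer_content_open//; apply: outer_mono.
  by move=> x [Vx nGx]; split => // /KVG[].
rewrite addeC -leeBrDr//; apply: ge_ereal_sup => _ [L [cL LVK] <-].
rewrite leeBrDr// -EFinD -ulimU.
- apply: inner_content_ub; first exact: compactU.
  by move=> x [/LVK[]|/KVG[]].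
- exact: compact_borel.
- exact: compact_borel.
- by apply/seteqP; split => // x [/LVK[_ nK] /nK].
Qed.

Lemma borel_caratheodory (B : set X) : measurable B -> outer_content.-cara.-measurable B.
Proof.
apply: smallest_sub; first exact: sigma_algebra_measurable.
exact: open_caratheodory.
Qed.

Definition ulim_measure (B : set X) : \bar R := outer_content B.

Let um0 : ulim_measure set0 = 0%E. Proof. exact: outer0. Qed.
Let um_ge0 B : (0 <= ulim_measure B)%E. Proof. exact: outer_ge0. Qed.
Let um_sigma : semi_sigma_additive ulim_measure.
Proof.
move=> F mF tF mUF; apply: (@caratheodory_measure_sigma_additive R Rn outer_content).
- by move=> i; exact: borel_caratheodory.
- by [].
- exact: borel_caratheodory.
Qed.

HB.instance Definition _ := isMeasure.Build _ _ _ ulim_measure um0 um_ge0 um_sigma.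

(** The portmanteau inequality for open sets: with total mass one, it is all that integrals of lower
    semicontinuous functions require. *)
Lemma ulim_measure_open_le G : open G -> (ulim_measure G <= (ulim G)%:E)%E.
Proof.
move=> oG; rewrite /ulim_measure outer_content_open//.
by apply: inner_content_le_ulim; exact: open_borel.
Qed.

(** Tightness is what prevents loss of mass, since the measure only sees the values of [ulim] on
    compact sets. *)
Lemma ulim_measure_setT :
  (forall e : R, 0 < e -> exists2 K : set Rn, compact K &
     forall k, (mu_ k (~` K) <= e%:E)%E) -> ulim_measure setT = 1%E.
Proof.
move=> tight; apply/eqP; rewrite eq_le; apply/andP; split.
  apply: (le_trans (ulim_measure_open_le openT)).
  by rewrite lee_fin; exact: ulim_le1.
rewrite /ulim_measure outer_content_open; last exact: openT.
apply/lee_addgt0Pr => e /tight [K cK h].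
apply: (@le_trans _ _ ((ulim K)%:E + e%:E)%E); last first.
  by rewrite leeD2r// inner_content_ub.
rewrite -EFinD lee_fin -lerBlDr.
have mK := compact_borel cK.
apply: (@ulim_ge _ _ 0) => // k _.
rewrite EFinB leeBlDr// -(mu1 k) -(setUv K) measureU ?setICr//; last exact: measurableC.
exact: (leeD2l _ (h k)).
Qed.

Lemma ulim_measureP :
  exists mu : {measure set X -> \bar R}, forall B, mu B = ulim_measure B.
Proof. by exists ulim_measure. Qed.

End ultralimit_measure.

(** * Integer layer-cake sums *)

Section levels.
Variable R : realType.
Implicit Types (y : \bar R) (J j : nat).
Local Open Scope ereal_scope.

(* For [0 <= y], summing [level y j] over all [j] rounds [y] up to an integer. *)
Definition level y j : \bar R := if j%:R%:E < y then 1 else 0.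

Lemma level_ge0 y j : 0 <= level y j.
Proof. by rewrite /level; case: ifP. Qed.

Lemma min_le_sum_level y J : 0 <= y -> mine y J%:R%:E <= \sum_(j < J) level y j.
Proof.
move=> y0; elim: J => [|J ih]; first by rewrite big_ord0 ge_min lexx orbT.
rewrite big_ord_recr/= /level; case: ltP => yJ.
  rewrite -natr1 EFinD ge_min; apply/orP; right; rewrite leeD2r//.
  by apply: le_trans ih; rewrite le_min lexx andbT ltW.
rewrite adde0; apply: le_trans ih; rewrite le_min ge_min lexx/=.
by rewrite ge_min yJ.
Qed.

Lemma sum_level_le y J : 0 <= y -> \sum_(j < J) level y j <= y + 1.
Proof.
move=> y0; suff /andP[] : (\sum_(j < J) level y j <= y + 1) &&
  (\sum_(j < J) level y j <= J%:R%:E) by [].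
elim: J => [|J /andP[ih1 ih2]]; first by rewrite big_ord0 lexx adde_ge0.
rewrite big_ord_recr/= /level; case: ltP => yJ; last first.
  by rewrite adde0 ih1/= (le_trans ih2)// lee_fin ler_nat.
rewrite -natr1 EFinD; apply/andP; split; rewrite leeD2r//.
by rewrite (le_trans ih2)// ltW.
Qed.

Lemma le_nneseries_level y : 0 <= y -> y <= \sum_(j <oo) level y j.
Proof.
move=> y0.
have h J : mine y J%:R%:E <= \sum_(j <oo) level y j.
  apply: (le_trans (min_le_sum_level J y0)).
  rewrite -(big_mkord xpredT (level y)).
  by apply: nneseries_lim_ge => *; exact: level_ge0.
have s0 : 0 <= \sum_(j <oo) level y j by apply: nneseries_ge0 => *; exact: level_ge0.
case: (\sum_(j <oo) level y j) h s0 => [s| |]// h s0; last by rewrite leey.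
have := h (Num.truncn s).+1; rewrite ge_min => /orP[//|].
rewrite lee_fin => /(lt_le_trans (truncnS_gt s)); by rewrite ltxx.
Qed.

End levels.

(** * Lower semicontinuity of integrals under tight limits *)

Section tight_limit.
Variables (R : realType) (n : nat).
Local Notation Rn := 'rV[R]_n.
Local Notation X := (borelRn R n).

Definition lsc (g : Rn -> \bar R) := forall a : R, open [set x | (a%:E < g x)%E].

Lemma lsc_measurable (g : X -> \bar R) : lsc g -> measurable_fun setT g.
Proof.
move=> lg; apply: (measurability _ (ErealGenOInfty.measurableE R)).
move=> _ [_ [r ->] <-]; apply: measurableI => //.
by rewrite preimage_itvoy; apply: open_borel; exact: lg.
Qed.

(** Layer cake with integer levels: [g] is at most the number of integers j with j < g. For lower
    semicontinuous [g] the superlevel sets are open, so a bound on open sets becomes a bound on the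
    integral. *)
Lemma integral_le_sum_level (mu : {measure set X -> \bar R}) (g : X -> \bar R) (c : \bar R) :
  (forall x, 0 <= g x)%E -> measurable_fun setT g ->
  (forall J, \sum_(j < J) mu [set x | (j%:R%:E < g x)%E] <= c)%E ->
  (\int[mu]_x g x <= c)%E.
Proof.
move=> g0 mg h.
have mE j : measurable [set x | (j%:R%:E < g x)%E].
  by rewrite -[X in measurable X]setTI; exact: emeasurable_fun_o_infty.
have lE j x : level (g x) j = (\1_[set x | (j%:R%:E < g x)%E] x)%:E.
  rewrite /level indicE; case: ifPn => hj; first by rewrite mem_set.
  by rewrite memNset//; exact/negP.
apply: (@le_trans _ _ (\int[mu]_x \sum_(j <oo) level (g x) j)%E).
  apply: ge0_le_integral => //.
  - apply: ge0_emeasurable_sum => [j x _ _|j _]; first exact: level_ge0.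
    under eq_fun do rewrite lE.
    by apply/measurable_EFinP; exact: measurable_indic.
  - by move=> x _; exact: le_nneseries_level.
rewrite integral_nneseries//; last 2 first.
- move=> j; under eq_fun do rewrite lE.
  by apply/measurable_EFinP; exact: measurable_indic.
- by move=> j x _; exact: level_ge0.
apply: lime_le.
  by apply: is_cvg_nneseries => j _ _; apply: integral_ge0 => x _; exact: level_ge0.
apply: nearW => J; rewrite big_mkord; apply: le_trans (h J).
apply: lee_sum => j _.
under eq_integral do rewrite lE.
by rewrite integral_indic// setIT.
Qed.

Lemma sum_level_le_integral (mu : {measure set X -> \bar R}) (g : X -> \bar R) J :
  mu setT = 1%E -> (forall x, 0 <= g x)%E -> measurable_fun setT g ->
  (\sum_(j < J) mu [set x | (j%:R%:E < g x)%E] <= \int[mu]_x g x + 1)%E.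
Proof.
move=> mu1 g0 mg.
have mE j : measurable [set x | (j%:R%:E < g x)%E].
  by rewrite -[X in measurable X]setTI; exact: emeasurable_fun_o_infty.
have lE j x : level (g x) j = (\1_[set x | (j%:R%:E < g x)%E] x)%:E.
  rewrite /level indicE; case: ifPn => hj; first by rewrite mem_set.
  by rewrite memNset//; exact/negP.
have -> : (\sum_(j < J) mu [set x | (j%:R%:E < g x)%E] = 
    \int[mu]_x \sum_(j < J) level (g x) j)%E.
  rewrite ge0_integral_sum//; last 2 first.
  - move=> j; under eq_fun do rewrite lE.
    by apply/measurable_EFinP; exact: measurable_indic.
  - by move=> j x _; exact: level_ge0.
  apply: eq_bigr => j _; under eq_integral do rewrite lE.
  by rewrite integral_indic// setIT.
have -> : (\int[mu]_x g x + 1 = \int[mu]_x (g x + 1))%E.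
  by rewrite ge0_integralD// integral_cst// mu1 mule1.
apply: ge0_le_integral => //.
- by move=> x _; apply: sume_ge0 => j _; exact: level_ge0.
- apply: emeasurable_sum => j; under eq_fun do rewrite lE.
  by apply/measurable_EFinP; exact: measurable_indic.
- exact: emeasurable_funD.
- by move=> x _; exact: sum_level_le.
Qed.

(** The last clause is lower semicontinuity of the integral of [g], phrased with an eventual bound
    so that the ultrafilter does not appear in the statement: a set of large indices belongs to
    every ultrafilter containing the tails. *)
Theorem tight_seq_limit (mu_ : nat -> {measure set X -> \bar R}) :
  (forall k, mu_ k setT = 1%E) ->
  (forall e : R, 0 < e -> exists2 K : set Rn, compact K &
     forall k, (mu_ k (~` K) <= e%:E)%E) ->
  exists2 mu : {measure set X -> \bar R}, mu setT = 1%E &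
    forall g : Rn -> \bar R, (forall x, 0 <= g x)%E -> lsc g ->
    forall c N, (forall k, (N <= k)%N -> (\int[mu_ k]_x g x <= c)%E) ->
      (\int[mu]_x g x <= c)%E.
Proof.
move=> mu1 tight.
have [U [UU Usub]] := ultraFilterLemma eventually_filter.
have Uoo N : U [set k | (N <= k)%N] by apply: Usub; exists N.
have [mu muE] := ulim_measureP mu1 UU Uoo.
exists mu; first by rewrite muE; exact: ulim_measure_setT.
move=> g g0 lg c N.
case: c => [c| |] h; last 2 first.
- by rewrite leey.
- have := h N (leqnn N); rewrite leeNy_eq => /eqP E.
  have : (0 <= \int[mu_ N]_x g x)%E by exact: integral_ge0.
  by rewrite E.
have mg : measurable_fun setT (g : X -> _) by exact: lsc_measurable.
(* Rounding up to an integer costs at most the total mass 1. Applied to [(m + 1) g] and divided by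
   [m + 1], the cost tends to 0. *)
have key (m : nat) : ((m.+1%:R)%:E * \int[mu]_x g x <= (m.+1%:R)%:E * c%:E + 1)%E.
  have m0 : (0 <= (m.+1%:R : R)%:E)%E by rewrite lee_fin.
  have oE j : open [set x | (j%:R%:E < (m.+1%:R)%:E * g x)%E].
    rewrite (_ : [set x | _] = [set x | ((j%:R / m.+1%:R)%:E < g x)%E]); first exact: lg.
    by apply/seteqP; split=> x /=; rewrite EFinM lte_pdivrMr// muleC.
  rewrite -ge0_integralZl//.
  apply: integral_le_sum_level => [x|| J]; first by rewrite mule_ge0.
    exact: measurable_funeM.
  apply: (@le_trans _ _ (\sum_(j < J) ulim mu_ U [set x | (j%:R%:E < (m.+1%:R)%:E * g x)%E])%:E).
    rewrite -sumEFin; apply: lee_sum => j _; rewrite muE; exact: ulim_measure_open_le.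
  rewrite -EFinM -EFinD lee_fin.
  have := @ulim_sum_cvg R n mu_ mu1 U UU Uoo _ (index_enum 'I_J) (fun j => [set x | (j%:R%:E < (m.+1%:R)%:E * g x)%E])
    (fun j => open_borel (oE j)).
  move=> h2; suff : forall b, b = m.+1%:R * c + 1 -> \sum_(j < J) ulim mu_ U [set x | (j%:R%:E < (m.+1%:R)%:E * g x)%E] <= b by apply.
  move=> b bE; apply: (closed_cvg (fun x => x <= b)) h2; first exact: closed_le.
  rewrite bE {b bE}.
  apply: filterS (Uoo N) => k /= Nk.
  rewrite -lee_fin -sumEFin.
  rewrite (eq_bigr (fun j : 'I_J => mu_ k [set x | (j%:R%:E < (m.+1%:R)%:E * g x)%E])); last first.
    by move=> j _; rewrite fineK// mass1_fin//; apply: open_borel.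
  apply: (le_trans (sum_level_le_integral _ _ _ _)) => //.
  - by move=> x; rewrite mule_ge0.
  - exact: measurable_funeM.
  - by rewrite EFinD leeD2r// ge0_integralZl// EFinM lee_pmul2l// h.
apply/lee_addgt0Pr => e e0.
pose m := Num.truncn e^-1.
have := key m; rewrite -lee_pdivlMl//.
move=> /le_trans; apply.
rewrite (_ : (_ * (_ + 1))%E = (m.+1%:R^-1 * (m.+1%:R * c + 1))%:E)// -EFinD lee_fin mulrDr mulKf// mulr1 lerD2l.
by rewrite invf_ple ?posrE// ltW// truncnS_gt.
Qed.

End tight_limit.

(** * Factorization of the Riesz kernel *)

Section sigma_finite_packing.
Local Open Scope ereal_scope.

Section pack.
Context d (T : measurableType d) (R : realType).
Variable mu : {measure set T -> \bar R}.
Hypothesis smu : sigma_finite setT mu.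

Let mu' : set T -> \bar R := mu.
HB.instance Definition _ := Measure.on mu'.
HB.instance Definition _ := Measure_isSigmaFinite.Build _ _ _ mu' smu.

(** Turns a proof of sigma-finiteness into the bundled structure that Tonelli's theorem takes, with
    an equality of set functions to rewrite along in both directions. *)
Lemma sigma_finite_packing :
  exists nu : {sigma_finite_measure set T -> \bar R}, (nu : set T -> \bar R) = mu.
Proof. by exists mu'. Qed.

End pack.

Context d1 d2 (T1 : measurableType d1) (T2 : measurableType d2) (R : realType).
Variables (m1 : {sigma_finite_measure set T1 -> \bar R}).
Variables (m2 : {sigma_finite_measure set T2 -> \bar R}).

Lemma sigma_finite_product : sigma_finite setT (m1 \x m2).
Proof.
have /sigma_finiteP[F [TF ndF Foo]] := sigma_finiteT m1.
have /sigma_finiteP[G [TG ndG Goo]] := sigma_finiteT m2.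
exists (fun i => F i `*` G i) => [|i].
  apply/esym/seteqP; split=> // -[x y] _.
  have [j _ Fx] : (\bigcup_i F i) x by rewrite -TF.
  have [k _ Gy] : (\bigcup_i G i) y by rewrite -TG.
  exists (maxn j k) => //; split=> /=.
    by apply: subsetPset Fx; apply: ndF; exact: leq_maxl.
  by apply: subsetPset Gy; apply: ndG; exact: leq_maxr.
have [mF Fi] := Foo i; have [mG Gi] := Goo i.
split; first exact: measurableX.
by rewrite product_measure1E// lte_mul_pinfty// ge0_fin_numE.
Qed.

End sigma_finite_packing.

(** * Gaussians as self-convolutions *)

Section gauss_factor.
Variable R : realType.
Implicit Types a b r : R.

(* With variance 1/8, the product of the factors at [a] and [b] is
   [exp (- (a - b)^2)] times a normal density in [r]. *)
Definition gauss_sd : R := Num.sqrt (8%:R)^-1.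
Definition gauss_factor a r : R :=
  Num.sqrt (normal_peak gauss_sd) * expR (- (2 * (a - r) ^+ 2)).

Lemma gauss_sd_neq0 : gauss_sd != 0.
Proof. by rewrite gt_eqF// sqrtr_gt0 invr_gt0. Qed.

(** By 2(a - r)^2 + 2(b - r)^2 = (a - b)^2 + 4(r - (a + b)/2)^2, where 4 = 1/(2 sigma^2) for the
    variance sigma^2 = 1/8. *)
Lemma gauss_factorM a b r : gauss_factor a r * gauss_factor b r =
  expR (- (a - b) ^+ 2) * normal_pdf ((a + b) / 2) gauss_sd r.
Proof.
rewrite normal_pdfE ?gauss_sd_neq0//= /normal_fun /gauss_factor mulrACA -expr2.
rewrite sqr_sqrtr ?normal_peak_ge0//.
rewrite -expRD [RHS]mulrCA -expRD; congr (_ * expR _).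
rewrite /gauss_sd sqr_sqrtr ?invr_ge0//.
by field.
Qed.

Lemma gauss_factor_ge0 a r : 0 <= gauss_factor a r.
Proof. by rewrite mulr_ge0// ?sqrtr_ge0// expR_ge0. Qed.

Lemma gauss_factor_ub a r : gauss_factor a r <= Num.sqrt (normal_peak gauss_sd).
Proof.
rewrite ler_piMr ?sqrtr_ge0// -expR0 ler_expR oppr_le0.
by rewrite mulr_ge0// sqr_ge0.
Qed.

Lemma integral_gauss_factorM a b :
  (\int[lebesgue_measure]_r (gauss_factor a r * gauss_factor b r)%:E)%E =
  (expR (- (a - b) ^+ 2))%:E.
Proof.
under eq_integral do rewrite gauss_factorM EFinM.
rewrite ge0_integralZl//.
- by rewrite integral_normal_pdf mule1.
- by apply/measurable_EFinP; exact: measurable_normal_pdf.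
- by move=> r _; exact: normal_pdf_ge0.
Qed.

Lemma continuous_gauss_factor r : continuous (gauss_factor^~ r).
Proof.
move=> a; apply: cvgM; first exact: cvg_cst.
apply: (cvg_comp _ expR); last exact: continuous_expR.
apply: cvgN; apply: cvgM; first exact: cvg_cst.
by rewrite expr2; apply: cvgM; apply: cvgB; (exact: cvg_id || exact: cvg_cst).
Qed.

Lemma measurable_gauss_factor d (T : measurableType d) (f g : T -> R) :
  measurable_fun setT f -> measurable_fun setT g ->
  measurable_fun setT (fun t => gauss_factor (f t) (g t)).
Proof.
move=> mf mg; apply: measurable_funM => //.
apply: measurableT_comp => //; apply: measurableT_comp => //.
apply: measurable_funM => //; apply: measurable_funX.
exact: measurable_funB.
Qed.

End gauss_factor.

Section gauss_features.
Variables (R : realType) (n : nat).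
Local Notation Rn := 'rV[R]_n.
Local Notation X := (borelRn R n).

Lemma continuous_borel_measurable (f : Rn -> R) :
  continuous f -> measurable_fun setT (f : X -> R).
Proof.
move=> cf; apply: (measurability _ (RGenOInfty.measurableE R)).
move=> _ [_ [a ->] <-]; rewrite setTI; apply: open_borel.
by apply: open_comp; [move=> x _; exact: cf | exact: interval_open].
Qed.

Lemma measurable_coord i : measurable_fun setT (fun x : X => (x : Rn) ord0 i).
Proof.
apply: continuous_borel_measurable; exact: coord_continuous.
Qed.

Lemma gauss_features (s : seq 'I_n) :
  exists d (W : measurableType d) (m : {sigma_finite_measure set W -> \bar R})
    (h : R -> Rn -> W -> R) (C : R),
  [/\ (forall t w, continuous (fun x => h t x w)),
      measurable_fun setT (fun p : R * X * W => h p.1.1 p.1.2 p.2),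
      (forall t x w, 0 <= h t x w <= C) &
      (forall t x y, \int[m]_w (h t x w * h t y w)%:E =
         (expR (- (t ^+ 2 * \sum_(i <- s) (x ord0 i - y ord0 i) ^+ 2)))%:E)%E].
Proof.
elim: s => [|i s [d [W [m [h [C [ch mh hC hE]]]]]]].
  exists _, unit, (@dirac _ unit tt R : {sigma_finite_measure set unit -> \bar R}), (fun _ _ _ => 1), 1; split.
  - by move=> t w; exact: cst_continuous.
  - exact: measurable_cst.
  - by move=> *; rewrite ler01 lexx.
  - move=> t x y; rewrite big_nil mulr0 oppr0 expR0.
    by under eq_integral do rewrite mulr1; rewrite integral_cst//= mul1e diracT.
pose h' t (x : Rn) (p : measurableTypeR R * W) := gauss_factor (t * x ord0 i) p.1 * h t x p.2.
pose leb : {sigma_finite_measure set (measurableTypeR R) -> \bar R} := (@lebesgue_measure R).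
have [m' m'E] := sigma_finite_packing (sigma_finite_product leb m).
exists _, (measurableTypeR R * W)%type, m', h', (Num.sqrt (normal_peak (gauss_sd R)) * C).
split.
- move=> t [r0 w] x; pose r : R := r0.
  have cg : {for x, continuous ((fun a : R => gauss_factor a r) \o (fun z : Rn => t * z ord0 i))}.
    apply: continuous_comp.
      exact: (cvgM (cvg_cst t) (@coord_continuous R 1 n ord0 i x)).
    exact: continuous_gauss_factor.
  exact: (cvgM cg (ch t w x)).
- apply: measurable_funM.
    apply: measurable_gauss_factor.
      apply: measurable_funM.
        by apply: measurableT_comp => //; exact: measurableT_comp.
      apply: (measurableT_comp (measurable_coord i)).
      exact: measurableT_comp.
    exact: measurableT_comp.
  have mf : measurable_fun setT (fun p : R * X * (measurableTypeR R * W) => (p.1, p.2.2)).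
    by apply: measurable_fun_pair => //; exact: measurableT_comp.
  exact: (measurableT_comp mh mf).
- move=> t x [r w]; rewrite /h'/=; have /andP[h0 hCC] := hC t x w.
  rewrite mulr_ge0 ?gauss_factor_ge0//=.
  by rewrite ler_pM ?gauss_factor_ge0 ?gauss_factor_ub.
- move=> t x y.
  have mhx z : measurable_fun setT (fun w => h t z w).
    have mf : measurable_fun setT (fun w : W => ((t, z : X), w)).
      by apply: measurable_fun_pair; [exact: measurable_cst|exact: measurable_id].
    exact: (measurableT_comp mh mf).
  have mhx' z : measurable_fun setT (fun p => h' t z p).
    apply: measurable_funM; first by apply: measurable_gauss_factor.
    exact: measurableT_comp.
  rewrite m'E (@fubini_tonelli1 _ _ _ _ R leb m)//; last 2 first.
  + by apply/measurable_EFinP; exact: measurable_funM.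
  + by move=> [r w]; rewrite lee_fin mulr_ge0// mulr_ge0// ?gauss_factor_ge0//;
      have /andP[] := hC t x w; have /andP[] := hC t y w.
  rewrite /fubini_F.
  transitivity (\int[leb]_r ((gauss_factor (t * x ord0 i) r * gauss_factor (t * y ord0 i) r)%:E *
      (expR (- (t ^+ 2 * \sum_(j <- s) (x ord0 j - y ord0 j) ^+ 2)))%:E))%E.
    apply: eq_integral => r _; rewrite -hE -ge0_integralZl//; last 3 first.
    - by apply/measurable_EFinP; exact: measurable_funM.
    - by move=> w _; rewrite lee_fin mulr_ge0//; have /andP[] := hC t x w; have /andP[] := hC t y w.
    - by rewrite lee_fin mulr_ge0// gauss_factor_ge0.
    by apply: eq_integral => w _; rewrite /h'/= mulrACA EFinM.
  rewrite ge0_integralZr//; last 2 first.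
  + apply/measurable_EFinP; apply: measurable_funM; exact: measurable_gauss_factor.
  + by move=> r _; rewrite lee_fin mulr_ge0// gauss_factor_ge0.
  rewrite integral_gauss_factorM -EFinM -expRD big_cons; congr (expR _)%:E.
  by rewrite -mulrBr exprMn mulrDr opprD.
Qed.

End gauss_features.

(** * The radial Gamma integral *)

Section radial_integral.
Variable R : realType.
Local Notation leb := (@lebesgue_measure R).
Implicit Types (b q s : R).

(** With u = e^s this is the Gamma integrand u^(b-1) e^(-q u) du, whose integral is Gamma(b)
    q^(-b). *)
Definition radial b q s : R := expR (b * s - expR s * q).

Lemma radial_ge0 b q s : 0 <= radial b q s.
Proof. exact: expR_ge0. Qed.

Lemma continuous_radial b q : continuous (radial b q).
Proof.
move=> s; apply: (@continuous_comp R R R (fun s => b * s - expR s * q) expR); last exact: continuous_expR.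
apply: cvgB; first by apply: cvgM; [exact: cvg_cst|exact: cvg_id].
by apply: cvgM; [exact: continuous_expR|exact: cvg_cst].
Qed.

Lemma measurable_radial b q : measurable_fun setT (fun s => (radial b q s)%:E).
Proof. by apply/measurable_EFinP; apply: continuous_measurable_fun; exact: continuous_radial. Qed.

(** In the logarithmic variable, scaling by q is the translation by [ln q]. The remaining integral
    at q = 1 is never computed, only shown to be positive and finite. *)
Lemma integral_radial_scale b q : 0 < q ->
  (\int[leb]_s (radial b q s)%:E = (q `^ (- b))%:E * \int[leb]_s (radial b 1 s)%:E)%E.
Proof.
move=> q0; pose F s : R := s + ln q.
have F' : F^`()%classic = cst 1.
  apply/funext => s; rewrite derive1E /F deriveD// derive_id derive_cst addr0//.
rewrite [in RHS](@increasing_ge0_integration_by_substitutionT R F (radial b 1)).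
- rewrite -ge0_integralZl//; last 3 first.
  + apply/measurable_EFinP; apply: continuous_measurable_fun.
    rewrite F' => s; apply: cvgM; last exact: cvg_cst.
    apply: (@continuous_comp R R R F (radial b 1)); last exact: continuous_radial.
    by apply: cvgD; [exact: cvg_id|exact: cvg_cst].
  + by move=> s _; rewrite F' lee_fin/= mulr1 radial_ge0.
  + by rewrite lee_fin powR_ge0.
  apply: eq_integral => s _; rewrite F' /= -EFinM /= mulr1; congr EFin.
  rewrite /radial/= /F /powR gt_eqF// -expRD; congr expR.
  by rewrite mulr1 expRD lnK ?posrE// mulrDr; ring.
- by move=> x y xy; rewrite /F ltrD2r.
- by rewrite F' => s; exact: cvg_cst.
- by rewrite F'; exact: is_cvg_cst.
- by rewrite F'; exact: is_cvg_cst.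
- by move=> s; apply: derivableD.
- exact: cvg_addrr_Ny.
- exact: cvg_addrr.
- exact: continuous_radial.
- by move=> s; exact: radial_ge0.
Qed.

Lemma integral_expR_abs_lty (g : R) : 0 < g ->
  (\int[leb]_s (expR (- (g * `|s|)))%:E < +oo)%E.
Proof.
move=> g0.
have cf : continuous (fun s : R => expR (- (g * `|s|))).
  move=> s; apply: (@continuous_comp R R R (fun s => - (g * `|s|)) expR); last exact: continuous_expR.
  by apply: cvgN; apply: cvgM; [exact: cvg_cst|exact: norm_continuous].
rewrite ge0_symfun_integralT//; last first.
  by move=> s /=; rewrite normrN.
apply: lte_mul_pinfty => //.
apply: (@le_lt_trans _ _ (\int[leb]_s ((g^-1)%:E * (exponential_pdf g s)%:E))%E); last first.
  rewrite ge0_integralZl//.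
  - by rewrite integral_exponential_pdf// mule1 ltry.
  - by apply/measurable_EFinP; exact: measurable_exponential_pdf.
  - by move=> s _; rewrite lee_fin exponential_pdf_ge0// ltW.
  - by rewrite lee_fin invr_ge0 ltW.
rewrite [leLHS]integral_mkcond; apply: ge0_le_integral => //.
- by move=> s _; rewrite patchE; case: ifP => // _; rewrite lee_fin expR_ge0.
- apply/(measurable_restrictT _ _).1 => //; first by rewrite -set_itvcy.
  by apply/measurable_EFinP; apply: measurable_funTS; exact: continuous_measurable_fun.
- by apply: measurable_funeM; apply/measurable_EFinP; exact: measurable_exponential_pdf.
move=> s _; rewrite patchE; case: ifPn => [|_].
  rewrite inE/= => s0; rewrite exponential_pdfE// -EFinM lee_fin /=.
  by rewrite mulKf ?gt_eqF// ger0_norm// mulNr.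
by rewrite -EFinM lee_fin mulr_ge0 ?invr_ge0 ?exponential_pdf_ge0 1?ltW.
Qed.

(** For s >= 0, e^s >= 1 + s^2/2 gives (b + 1) s - e^s <= (b + 1)^2, a generous constant; for s < 0
    the factor e^(bs) decays by itself. The rate [Num.min b 1] serves both sides. *)
Lemma radial_le b s : 0 < b ->
  radial b 1 s <= expR ((b + 1) ^+ 2) * expR (- (Num.min b 1 * `|s|)).
Proof.
move=> b0; rewrite -expRD ler_expR mulr1.
have [s0|s0] := leP 0 s.
  have h : 1 + s ^+ 2 / 2 <= expR s by exact: (expR_ge1Dxn 1 s0).
  rewrite ger0_norm//.
  have : Num.min b 1 * s <= s by rewrite ler_piMl// ge_min lexx orbT.
  nra.
rewrite ltr0_norm//.
have : Num.min b 1 * - s <= b * - s by rewrite ler_wpM2r ?ge_min ?lexx// oppr_ge0 ltW.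
have := expR_ge0 s; nra.
Qed.

Lemma integral_radial_lty b : 0 < b -> (\int[leb]_s (radial b 1 s)%:E < +oo)%E.
Proof.
move=> b0.
have cf : continuous (fun s : R => expR (- (Num.min b 1 * `|s|))).
  move=> s; apply: (@continuous_comp R R R (fun s => - (Num.min b 1 * `|s|)) expR); last exact: continuous_expR.
  by apply: cvgN; apply: cvgM; [exact: cvg_cst|exact: norm_continuous].
apply: (@le_lt_trans _ _ (\int[leb]_s ((expR ((b + 1) ^+ 2))%:E * (expR (- (Num.min b 1 * `|s|)))%:E))%E).
  apply: ge0_le_integral => //.
  - by move=> s _; rewrite lee_fin radial_ge0.
  - exact: measurable_radial.
  - by apply: measurable_funeM; apply/measurable_EFinP; exact: continuous_measurable_fun.
  - by move=> s _; rewrite -EFinM lee_fin; exact: radial_le.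
rewrite ge0_integralZl//.
- apply: lte_mul_pinfty => //.
  by apply: integral_expR_abs_lty; rewrite lt_min b0/=.
- by apply/measurable_EFinP; exact: continuous_measurable_fun.
Qed.

Lemma integral_radial_gt0 b : 0 < b -> (0 < \int[leb]_s (radial b 1 s)%:E)%E.
Proof.
move=> b0.
have e0 : (0 < (expR (- expR 1) : R)%:E)%E by rewrite lte_fin expR_gt0.
apply: (lt_le_trans e0).
have -> : ((expR (- expR 1) : R)%:E = \int[leb]_(s in `[0%R, 1%R]%classic) (cst (expR (- expR 1))%:E) s)%E.
  by rewrite integral_cst//= lebesgue_measure_itv/= lte01 oppr0 adde0 mule1.
apply: (@le_trans _ _ (\int[leb]_(s in `[0%R, 1%R]%classic) (radial b 1 s)%:E)%E).
  apply: ge0_le_integral => //.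
  - by move=> s _; rewrite lee_fin expR_ge0.
  - by apply: measurable_funTS; exact: measurable_radial.
  - move=> s /=; rewrite in_itv/= => /andP[s0 s1].
    rewrite lee_fin ler_expR mulr1.
    have : expR s <= expR 1 by rewrite ler_expR.
    have : 0 <= b * s by rewrite mulr_ge0// ltW.
    lra.
by apply: ge0_subset_integral => //; [exact: measurable_radial|move=> s _; rewrite lee_fin radial_ge0].
Qed.

(** The case q = 0 makes the factorization take the value [+oo] of the kernel on the diagonal. *)
Lemma integral_radial0 b : 0 < b -> (\int[leb]_s (radial b 0 s)%:E = +oo)%E.
Proof.
move=> b0; apply/eqP; rewrite -leye_eq.
have -> : +oo%E = (\int[leb]_(s in `[0%R, +oo[%classic) (cst 1) s)%E.
  by rewrite integral_cst//= mul1e lebesgue_measure_itv/= ltry.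
apply: (@le_trans _ _ (\int[leb]_(s in `[0%R, +oo[%classic) (radial b 0 s)%:E)%E).
  apply: ge0_le_integral => //.
  - by apply: measurable_funTS; exact: measurable_radial.
  - move=> s /=; rewrite in_itv/= andbT => s0.
    by rewrite lee_fin /radial mulr0 subr0 -expR0 ler_expR mulr_ge0// ltW.
by apply: ge0_subset_integral => //; [exact: measurable_radial|move=> s _; rewrite lee_fin radial_ge0].
Qed.

End radial_integral.

(** * Features of the Riesz kernel *)

Section riesz_features.
Variables (R : realType) (n : nat) (alpha : R).
Hypothesis (alpha_lt_n : alpha < n%:R).
Local Notation Rn := 'rV[R]_n.
Local Notation X := (borelRn R n).
Local Notation leb := (@lebesgue_measure R : {sigma_finite_measure set (measurableTypeR R) -> \bar R}).

Definition sqdist (x y : Rn) : R := \sum_(i < n) (x ord0 i - y ord0 i) ^+ 2.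

Lemma sqdist_ge0 x y : 0 <= sqdist x y.
Proof. by apply: sumr_ge0 => i _; exact: sqr_ge0. Qed.

Lemma sqdist_eq0 x y : (sqdist x y == 0) = (x == y).
Proof.
apply/eqP/eqP => [|->]; last by apply: big1 => i _; rewrite subrr expr0n.
move=> /eqP; rewrite psumr_eq0; last by move=> i _; exact: sqr_ge0.
move=> /allP h; apply/rowP => i; apply/eqP; rewrite -subr_eq0 -sqrf_eq0.
by apply: (implyP (h i _)) => //; rewrite mem_index_enum.
Qed.

Lemma enorm_sqdist x y : enorm (x - y) = Num.sqrt (sqdist x y).
Proof. by congr Num.sqrt; apply: eq_bigr => i _; rewrite !mxE. Qed.

Let b : R := (n%:R - alpha) / 2.
Let b_gt0 : 0 < b. Proof. by rewrite divr_gt0// subr_gt0. Qed.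

Lemma riesz_kernelE x y : riesz_kernel alpha x y =
  if sqdist x y == 0 then +oo%E else (sqdist x y `^ (- b))%:E.
Proof.
rewrite /riesz_kernel sqdist_eq0; case: ifP => // _; congr EFin.
rewrite enorm_sqdist -powR12_sqrt ?sqdist_ge0// -powRrM; congr (_ `^ _).
by rewrite /b; field.
Qed.

Let c : R := fine (\int[leb]_s (radial b 1 s)%:E)%E.
Let cE : (c%:E = \int[leb]_s (radial b 1 s)%:E)%E.
Proof.
rewrite /c fineK// ge0_fin_numE; first exact: integral_radial_lty.
by apply: integral_ge0 => s _; rewrite lee_fin radial_ge0.
Qed.
Let c_gt0 : 0 < c.
Proof. by rewrite -lte_fin cE integral_radial_gt0. Qed.

Context d (W : measurableType d) (m : {sigma_finite_measure set W -> \bar R}).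
Variables (h : R -> Rn -> W -> R) (C : R).
Hypotheses
  (ch : forall t w, continuous (fun x => h t x w))
  (mh : measurable_fun setT (fun p : R * X * W => h p.1.1 p.1.2 p.2))
  (hC : forall t x w, 0 <= h t x w <= C)
  (hE : forall t x y, (\int[m]_w (h t x w * h t y w)%:E =
         (expR (- (t ^+ 2 * \sum_(i < n) (x ord0 i - y ord0 i) ^+ 2)))%:E)%E).

Local Notation Z := (measurableTypeR R * W)%type.

(* [c^-1] times the integral over [s] of [exp (b s - e^s q)] is [q^(-b)], which
   is the Riesz kernel at [q = |x - y|^2]. *)
Definition weight (s : R) : R := Num.sqrt c^-1 * expR (b * s / 2).

(** The scale handed to [h] is e^(s/2) because [h] produces a Gaussian in t^2 times the squared
    distance, and t^2 has to be e^s. *)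
Definition feature (x : Rn) (z : Z) : R :=
  weight z.1 * h (expR ((z.1 : R) / 2)) x z.2.

Lemma weight_gt0 s : 0 < weight s.
Proof. by rewrite mulr_gt0 ?expR_gt0// sqrtr_gt0 invr_gt0. Qed.

Lemma weight_sqr s : weight s * weight s = c^-1 * expR (b * s).
Proof.
rewrite mulrACA -expr2 sqr_sqrtr ?invr_ge0 1?ltW// -expRD.
by congr (_ * expR _); field.
Qed.

Lemma measurable_weight : measurable_fun setT (weight : measurableTypeR R -> R).
Proof.
apply: measurable_funM => //; apply: measurableT_comp => //.
by apply: measurable_funM => //; exact: measurable_funM.
Qed.

Lemma feature_ge0 x z : 0 <= feature x z.
Proof. by rewrite mulr_ge0 ?(ltW (weight_gt0 _))//; have /andP[] := hC (expR ((z.1:R) / 2)) x z.2. Qed.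

Lemma feature_ub x z : feature x z <= weight z.1 * C.
Proof.
by rewrite ler_wpM2l ?(ltW (weight_gt0 _))//; have /andP[] := hC (expR ((z.1:R) / 2)) x z.2.
Qed.

Lemma continuous_feature z : continuous (feature^~ z).
Proof.
move=> x; apply: (@cvgM _ _ (nbhs x) _ (fun=> weight z.1) (fun x => h (expR ((z.1 : R) / 2)) x z.2)).
  exact: cvg_cst.
exact: ch.
Qed.

Lemma measurable_feature : measurable_fun setT (fun p : X * Z => feature p.1 p.2).
Proof.
apply: measurable_funM.
  apply: (measurableT_comp measurable_weight); exact: measurableT_comp.
have mf : measurable_fun setT (fun p : X * Z => ((expR ((p.2.1 : R) / 2), p.1), p.2.2)).
  apply: measurable_fun_pair; last exact: measurableT_comp.
  apply: measurable_fun_pair => //.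
  apply: measurableT_comp => //; apply: measurable_funM => //.
  exact: measurableT_comp.
exact: (measurableT_comp mh mf).
Qed.

Lemma measurable_h t x : measurable_fun setT (h t x).
Proof.
have mf : measurable_fun setT (fun w : W => ((t, x : X), w)).
  by apply: measurable_fun_pair; [exact: measurable_cst|exact: measurable_id].
exact: (measurableT_comp mh mf).
Qed.

Lemma measurable_feature2 x : measurable_fun setT (feature x).
Proof.
have mf : measurable_fun setT (fun z : Z => (x : X, z)).
  by apply: measurable_fun_pair; [exact: measurable_cst|exact: measurable_id].
exact: (measurableT_comp measurable_feature mf).
Qed.

Lemma integral_featureM x y :
  (\int[leb \x m]_z (feature x z * feature y z)%:E = riesz_kernel alpha x y)%E.
Proof.
rewrite (@fubini_tonelli1 _ _ _ _ R leb m)//; last 2 first.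
- by apply/measurable_EFinP; apply: measurable_funM; exact: measurable_feature2.
- by move=> z; rewrite lee_fin mulr_ge0// feature_ge0.
transitivity (\int[leb]_s ((c^-1)%:E * (radial b (sqdist x y) s)%:E))%E.
  apply: eq_integral => s _.
  transitivity (\int[m]_w ((c^-1 * expR (b * s))%:E * (h (expR (s / 2)) x w * h (expR (s / 2)) y w)%:E))%E.
    apply: eq_integral => w _.
    by rewrite /feature/= -EFinM mulrACA weight_sqr.
  rewrite ge0_integralZl//; last 3 first.
  - by apply/measurable_EFinP; apply: measurable_funM; exact: measurable_h.
  - move=> w _; have /andP[h1 _] := hC (expR (s / 2)) x w; have /andP[h2 _] := hC (expR (s / 2)) y w.
    by rewrite lee_fin mulr_ge0.
  - by rewrite lee_fin mulr_ge0 ?expR_ge0// invr_ge0 ltW.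
  rewrite hE -!EFinM -mulrA -expRD; congr ((_ * expR _)%:E).
  by rewrite expr2 -expRD -splitr.
rewrite ge0_integralZl//; last 3 first.
- exact: measurable_radial.
- by move=> s _; rewrite lee_fin radial_ge0.
- by rewrite lee_fin invr_ge0 ltW.
rewrite riesz_kernelE; case: ifPn => [/eqP ->|q0].
  by rewrite integral_radial0// mulry gtr0_sg ?invr_gt0// mul1e.
rewrite integral_radial_scale; last by rewrite lt_neqAle eq_sym q0 sqdist_ge0.
by rewrite -cE -!EFinM mulrCA mulVf ?mulr1// gt_eqF.
Qed.

End riesz_features.

(** * Separation of measures by Gaussians *)

Section open_boxes.
Variables (R : realType) (n : nat).
Local Notation Rn := 'rV[R]_n.
Local Notation X := (borelRn R n).

Definition open_box (a b : 'I_n -> R) : set Rn :=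
  [set x | forall i, a i < x ord0 i < b i].

Lemma ball_rV (x y : Rn) (e : R) : 0 < e ->
  (forall i, `|x ord0 i - y ord0 i| < e) -> ball x e y.
Proof. by move=> e0 h; split => // i j; rewrite ord1; exact: h. Qed.

Lemma open_open_box a b : open (open_box a b).
Proof.
rewrite openE => x hx.
have H i : nbhs x [set y : Rn | a i < y ord0 i < b i].
  have oi : open [set y : Rn | a i < y ord0 i < b i].
    have -> : [set y : Rn | a i < y ord0 i < b i] = (fun y : Rn => y ord0 i) @^-1` `]a i, b i[%classic.
      by apply/seteqP; split=> y /=; rewrite in_itv.
    by apply: open_comp; [move=> y _; exact: coord_continuous|exact: interval_open].
  exact: (open_nbhs_nbhs (conj oi (hx i))).
exact: (@filter_forall Rn 'I_n (fun i => [set y : Rn | a i < y ord0 i < b i]) (nbhs x) _ H).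
Qed.

Lemma setI_closed_open_box :
  setI_closed [set B | exists a b, B = open_box a b].
Proof.
move=> _ _ [a1 [b1 ->]] [a2 [b2 ->]].
exists (fun i => Num.max (a1 i) (a2 i)), (fun i => Num.min (b1 i) (b2 i)).
apply/seteqP; split=> x /=.
  move=> [h1 h2] i; rewrite gt_max lt_min.
  by move: (h1 i) (h2 i) => /andP[p1 p2] /andP[p3 p4]; apply/andP; split; apply/andP; split.
by move=> h; split=> i; have := h i; rewrite gt_max lt_min;
  move=> /andP[/andP[p1 p2] /andP[p3 p4]]; apply/andP; split.
Qed.

Definition rational_box (p : 'rV[rat]_n * 'rV[rat]_n) : set Rn :=
  open_box (fun i => ratr (p.1 ord0 i)) (fun i => ratr (p.2 ord0 i)).

Lemma open_rational_box (O : set Rn) x : open O -> O x ->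
  exists p, rational_box p x /\ rational_box p `<=` O.
Proof.
move=> oO Ox.
have /nbhs_ballP[e /= e0 eO] : nbhs x O by exact: open_nbhs_nbhs.
have ha i : exists q : rat, ratr q \in `]x ord0 i - e, x ord0 i[.
  by apply: rat_in_itvoo; rewrite ltrBlDr ltrDl.
have hb i : exists q : rat, ratr q \in `]x ord0 i, x ord0 i + e[.
  by apply: rat_in_itvoo; rewrite ltrDl.
have [a ha'] := choice ha; have [b hb'] := choice hb.
exists (\row_i a i, \row_i b i); split=> [i|y /= hy]; last first.
  apply: eO; apply: ball_rV => // i.
  have := hy i; rewrite !mxE => /andP[h1 h2].
  have := ha' i; have := hb' i; rewrite !in_itv/= => /andP[h3 h4] /andP[h5 h6].
  by rewrite ltr_norml; apply/andP; split; lra.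
have := ha' i; have := hb' i; rewrite !mxE !in_itv/=.
by move=> /andP[-> _] /andP[_ ->].
Qed.

(** An open set is the union of the boxes with rational corners contained in it, and there are
    countably many of these. *)
Lemma g_sigma_open_box :
  (@measurable _ X) = <<s [set B : set X | exists a b, B = open_box a b] >>.
Proof.
apply/seteqP; split; last first.
  apply: smallest_sub; first exact: sigma_algebra_measurable.
  by move=> _ [a [b ->]]; apply: open_borel; exact: open_open_box.
apply: smallest_sub; first exact: smallest_sigma_algebra.
move=> O oO.
have -> : O = \bigcup_p (if pselect (rational_box p `<=` O) then rational_box p else set0).
  apply/seteqP; split=> [x Ox|x [p _]]; last by case: pselect => // h /h.
  by have [p [px pO]] := open_rational_box oO Ox; exists p => //; case: pselect.
apply: (@countable_bigcupT_measurable _ (g_sigma_algebraType [set B : set X | exists a b, B = open_box a b])) => //.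
move=> p; case: (pselect (rational_box p `<=` O)) => ?; last exact: measurable0.
by apply: sub_sigma_algebra; eexists; eexists.
Qed.

Lemma eq_measure_open_box (mu nu : {measure set X -> \bar R}) :
  (mu setT < +oo)%E ->
  (forall a b, mu (open_box a b) = nu (open_box a b)) ->
  forall B, measurable B -> mu B = nu B.
Proof.
move=> mufin h B mB.
pose g k := open_box (fun=> - k%:R) (fun=> k%:R).
apply: (measure_unique [set B : set X | exists a b, B = open_box a b] g) => //.
- exact: g_sigma_open_box.
- exact: setI_closed_open_box.
- by move=> k; eexists; eexists.
- apply/seteqP; split=> // x _.
  exists (Num.truncn `|x : Rn|).+1 => // i.
  rewrite -ltr_norml; apply: le_lt_trans (truncnS_gt _).
  by rewrite [leRHS]/Num.norm/= mx_normrE; apply/bigmax_geP; right; exists (ord0, i).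
- by move=> _ [a [b ->]].
- move=> k; apply: le_lt_trans mufin; apply: le_measure; rewrite ?inE//.
  by apply: open_borel; exact: open_open_box.
Qed.

End open_boxes.

Section tonelli_sigma_finite.
Local Open Scope ereal_scope.
Context d1 d2 (T1 : measurableType d1) (T2 : measurableType d2) (R : realType).
Variables (m1 : {measure set T1 -> \bar R}) (m2 : {measure set T2 -> \bar R}).
Hypotheses (s1 : sigma_finite setT m1) (s2 : sigma_finite setT m2).
Variable f : T1 * T2 -> \bar R.
Hypotheses (mf : measurable_fun setT f) (f0 : forall p, 0 <= f p).

Lemma tonelli_sigma_finite :
  \int[m1]_x \int[m2]_y f (x, y) = \int[m2]_y \int[m1]_x f (x, y).
Proof.
have [n1 E1] := sigma_finite_packing s1; have [n2 E2] := sigma_finite_packing s2.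
rewrite -E1 -E2; exact: fubini_tonelli.
Qed.

Lemma measurable_integral2 : measurable_fun setT (fun x => \int[m2]_y f (x, y)).
Proof.
have [n2 E2] := sigma_finite_packing s2.
rewrite -E2; exact: (measurable_fun_fubini_tonelli_F f).
Qed.

Lemma measurable_integral1 : measurable_fun setT (fun y => \int[m1]_x f (x, y)).
Proof.
have [n1 E1] := sigma_finite_packing s1.
rewrite -E1; exact: (measurable_fun_fubini_tonelli_G f).
Qed.

End tonelli_sigma_finite.

Lemma sigma_finite_lebesgue (R : realType) :
  sigma_finite setT (@lebesgue_measure R).
Proof.
exact: (@sigma_finiteT _ _ _ (@lebesgue_measure R : {sigma_finite_measure set (measurableTypeR R) -> \bar R})).
Qed.

Lemma sigma_finite_mass1 d (T : measurableType d) (R : realType)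
  (mu : {measure set T -> \bar R}) : mu setT = 1%E -> sigma_finite setT mu.
Proof.
move=> mu1; exists (fun=> setT) => [|i]; last by rewrite mu1 ltry.
by apply/seteqP; split => // x _; exists 0%N.
Qed.

(** * Normal distributions and smoothed indicators *)

Section normal_pdf_facts.
Variable R : realType.
Local Notation leb := (@lebesgue_measure R).
Implicit Types (a b u v s : R).

Lemma normal_pdf_expR u s v : s != 0 ->
  normal_pdf u s v = normal_peak s * expR (- (v - u) ^+ 2 / (s ^+ 2 *+ 2)).
Proof. by move=> s0; rewrite normal_pdfE. Qed.

Lemma normal_pdfC u v s : normal_pdf v s u = normal_pdf u s v \/ s = 0.
Proof.
have [->|s0] := eqVneq s 0; first by right.
left; rewrite (normal_pdf_expR _ _ s0) (normal_pdf_expR _ _ s0).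
by rewrite -(sqrrN (v - u)) opprB.
Qed.

Lemma measurable_normal_pdf2 d (T : measurableType d) (f g : T -> R) s : s != 0 ->
  measurable_fun setT f -> measurable_fun setT g ->
  measurable_fun setT (fun t => normal_pdf (f t) s (g t)).
Proof.
move=> s0 mf mg.
have -> : (fun t => normal_pdf (f t) s (g t)) =
    (fun t => normal_peak s * expR (- (g t - f t) ^+ 2 / (s ^+ 2 *+ 2))).
  by apply/funext => t; rewrite normal_pdf_expR.
apply: measurable_funM => //; apply: measurableT_comp => //.
apply: measurable_funM => //; apply: measurableT_comp => //.
by apply: measurable_funX; exact: measurable_funB.
Qed.

(** As a function of the mean [u], this is the indicator of [a, b] convolved with a Gaussian of
    deviation [s]. *)
Definition normal_itv s a b u : R := fine (normal_prob u s `[a, b]%classic).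

Lemma normal_itv_bounds s a b u : 0 <= normal_itv s a b u <= 1.
Proof.
have h0 : (0 <= normal_prob u s `[a, b]%classic)%E by exact: measure_ge0.
have h1 : (normal_prob u s `[a, b]%classic <= 1)%E by exact: probability_le1.
rewrite /normal_itv; case: (normal_prob u s `[a, b]%classic) h0 h1 => [r| |]//=.
by rewrite !lee_fin => -> ->.
Qed.

Lemma normal_itvE s a b u :
  (normal_itv s a b u)%:E = normal_prob u s `[a, b]%classic.
Proof. by rewrite /normal_itv fineK// fin_num_measure. Qed.

(** The density is symmetric in mean and point, so the smoothed indicator is a superposition of
    Gaussian densities with centres in [a, b]. This carries equality of Gaussian averages over to
    boxes. *)
Lemma normal_itv_integral s a b u : s != 0 ->
  (normal_itv s a b u)%:E =
    (\int[leb]_v (\1_(`[a, b]%classic) v * normal_pdf v s u)%:E)%E.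
Proof.
move=> s0; rewrite normal_itvE /normal_prob integral_mkcond.
apply: eq_integral => v _; rewrite patchE indicE.
have [//|] := normal_pdfC u v s; last by move=> E; rewrite E eqxx in s0.
by move=> ->; case: ifP => _; rewrite ?mul1r ?mul0r.
Qed.

Lemma measurable_normal_itv s a b : s != 0 -> measurable_fun setT (normal_itv s a b).
Proof.
move=> s0; apply/measurable_EFinP.
have -> : EFin \o normal_itv s a b =
   (fun u => \int[leb]_v (\1_(`[a, b]%classic) v * normal_pdf v s u)%:E)%E.
  by apply/funext => u /=; rewrite normal_itv_integral.
apply: (@measurable_integral2 _ _ R (measurableTypeR R) R leb _
   (fun p : R * R => (\1_(`[a, b]%classic) p.2 * normal_pdf p.2 s p.1)%:E)).
- exact: sigma_finite_lebesgue.
- have m1 : measurable_fun setT (\1_(`[a, b]%classic) : measurableTypeR R -> R).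
    exact: measurable_indic.
  apply/measurable_EFinP; apply: measurable_funM.
    exact: (measurableT_comp m1 measurable_snd).
  exact: (measurable_normal_pdf2 s0 measurable_snd measurable_fst).
- by move=> p; rewrite lee_fin mulr_ge0// normal_pdf_ge0.
Qed.

(** A Chebyshev-type bound by comparison of densities: with x = (v - u)^2/(4 s^2), the density of
    deviation s is sqrt 2 times exp(-x) times that of deviation sqrt 2 s, and exp(-x) <= 1/x <= 4
    s^2/e^2. The 8 absorbs sqrt 2 <= 2. *)
Lemma normal_prob_tail s u e (D : set R) : 0 < s -> 0 < e -> measurable D ->
  (forall v, D v -> e <= `|v - u|) ->
  (normal_prob u s D <= (8 * s ^+ 2 / e ^+ 2)%:E)%E.
Proof.
move=> s0 e0 mD he.
have s20 : Num.sqrt 2 * s != 0 by rewrite gt_eqF// mulr_gt0// sqrtr_gt0.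
have step v : D v -> normal_pdf u s v <= 8 * s ^+ 2 / e ^+ 2 * normal_pdf u (Num.sqrt 2 * s) v.
  move=> /he hv.
  rewrite (normal_pdf_expR _ _ s20) normal_pdf_expR ?gt_eqF// /normal_peak.
  rewrite exprMn sqr_sqrtr//.
  have -> : 2 * s ^+ 2 * pi *+ 2 = 2 * (s ^+ 2 * pi *+ 2).
    by rewrite mulrnAr mulrA.
  rewrite sqrtrM// (invfM (Num.sqrt 2)).
  set p := (Num.sqrt (s ^+ 2 * pi *+ 2))^-1.
  have p0 : 0 <= p by rewrite invr_ge0 sqrtr_ge0.
  set x := (v - u) ^+ 2 / (2 * s ^+ 2 *+ 2).
  have -> : - (v - u) ^+ 2 / (s ^+ 2 *+ 2) = - x + - x.
    by rewrite /x; field; rewrite gt_eqF.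
  have -> : - (v - u) ^+ 2 / (2 * s ^+ 2 *+ 2) = - x by rewrite /x mulNr.
  rewrite expRD.
  have e2 : e ^+ 2 <= (v - u) ^+ 2 by rewrite -[leRHS]real_normK ?num_real// lerXn2r// nnegrE ltW.
  have vu0 : 0 < (v - u) ^+ 2 by exact: lt_le_trans (exprn_gt0 2 e0) e2.
  have x0 : 0 < x.
    rewrite /x divr_gt0//.
    by rewrite pmulrn_rgt0// mulr_gt0// exprn_gt0.
  have ex : expR (- x) <= 4 * s ^+ 2 / e ^+ 2.
    rewrite expRN (@le_trans _ _ x^-1)//.
      rewrite lef_pV2 ?posrE ?expR_gt0// (le_trans _ (expR_ge1Dx x))//.
      by rewrite lerDr.
    rewrite /x invf_div ler_pM//.
    - by apply: mulrn_wge0; apply: mulr_ge0; [|exact: sqr_ge0].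
    - by rewrite invr_ge0 sqr_ge0.
    - by rewrite -mulr_natr; lra.
    - by rewrite lef_pV2 ?posrE ?vu0 ?exprn_gt0.
  have s2 : 1 <= 2 * (Num.sqrt 2)^-1 :> R.
    rewrite ler_pdivlMr ?sqrtr_gt0// mul1r.
    rewrite -[leRHS](@ger0_norm _ (2 : R))// -sqrtr_sqr ler_sqrt ?exprn_gt0//.
    by rewrite expr2; lra.
  have -> : 8 * s ^+ 2 / e ^+ 2 * ((Num.sqrt 2)^-1 * p * expR (- x)) =
      p * (expR (- x) * (4 * s ^+ 2 / e ^+ 2)) * (2 * (Num.sqrt 2)^-1) by ring.
  apply: (@le_trans _ _ (p * (expR (- x) * (4 * s ^+ 2 / e ^+ 2)))).
    by rewrite ler_wpM2l// ler_wpM2l// expR_ge0.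
  rewrite ler_peMr// !mulr_ge0// ?expR_ge0 ?invr_ge0 ?sqr_ge0//.
  exact: ltW.  exact: ltW.
have m2 : measurable_fun setT (fun v => (8 * s ^+ 2 / e ^+ 2 * normal_pdf u (Num.sqrt 2 * s) v)%:E).
  by apply/measurable_EFinP; apply: measurable_funM => //; exact: measurable_normal_pdf.
have K0 : 0 <= 8 * s ^+ 2 / e ^+ 2 by rewrite divr_ge0 ?sqr_ge0// mulr_ge0 ?sqr_ge0.
rewrite /normal_prob.
apply: (@le_trans _ _ (\int[leb]_(v in D) (8 * s ^+ 2 / e ^+ 2 * normal_pdf u (Num.sqrt 2 * s) v)%:E)%E).
  apply: ge0_le_integral => //.
  - by move=> v _; rewrite lee_fin normal_pdf_ge0.
  - by apply/measurable_EFinP; apply: measurable_funTS; exact: measurable_normal_pdf.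
  - exact: measurable_funTS.
apply: (@le_trans _ _ (\int[leb]_v (8 * s ^+ 2 / e ^+ 2 * normal_pdf u (Num.sqrt 2 * s) v)%:E)%E).
  by apply: ge0_subset_integral => // v _; rewrite lee_fin mulr_ge0// normal_pdf_ge0.
under eq_integral do rewrite EFinM.
rewrite ge0_integralZl//.
- by rewrite integral_normal_pdf mule1.
- by apply/measurable_EFinP; exact: measurable_normal_pdf.
- by move=> v _; exact: normal_pdf_ge0.
Qed.

End normal_pdf_facts.

(** * Gaussian averages determine a probability measure *)

Section gauss_separation.
Variables (R : realType) (n : nat).
Local Notation leb := (@lebesgue_measure R).
Local Notation Rn := 'rV[R]_n.
Local Notation X := (borelRn R n).

(** Shrinking the interval by sqrt s at both ends, a length much larger than the deviation s, makes
    the smoothed indicator tend to the indicator of the open interval at every point; unshrunk, it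
    would tend to 1/2 at the endpoints. The error is the tail bound 8 s^2/(sqrt s)^2. *)
Lemma normal_itv_near (a b u : R) : exists2 eta : R, 0 < eta &
  forall s, 0 < s < eta ->
    `|normal_itv s (a + Num.sqrt s) (b - Num.sqrt s) u - (a < u < b)%R%:R| <= 8 * s.
Proof.
have tail s (D : set R) : 0 < s -> measurable D ->
    (forall v, D v -> Num.sqrt s <= `|v - u|) -> (normal_prob u s D <= (8 * s)%:E)%E.
  move=> s0 mD hD.
  have e0 : 0 < Num.sqrt s by rewrite sqrtr_gt0.
  have := normal_prob_tail s0 e0 mD hD.
  by rewrite (sqr_sqrtr (ltW s0)) expr2 mulrA mulfK// gt_eqF.
have [/andP[au ub]|nu] := boolP (a < u < b); last first.
  exists 1 => // s /andP[s0 _]; rewrite subr0.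
  have /andP[h0 _] := normal_itv_bounds s (a + Num.sqrt s) (b - Num.sqrt s) u.
  rewrite ger0_norm// -lee_fin normal_itvE; apply: tail => // v /=.
  rewrite in_itv/= => /andP[h1 h2].
  move: nu; rewrite negb_and -!leNgt => /orP[ua|bu].
    by rewrite ger0_norm; have := sqrtr_ge0 s; lra.
  by rewrite ler0_norm; have := sqrtr_ge0 s; lra.
pose m := Num.min (u - a) (b - u).
have m0 : 0 < m by rewrite lt_min !subr_gt0 au.
(* Then [Num.sqrt s < m / 2], so [u] lies more than [Num.sqrt s] inside the shrunk interval. *)
exists ((m / 2) ^+ 2); first by rewrite exprn_gt0// divr_gt0.
move=> s /andP[s0 sm].
have sqm : Num.sqrt s < m / 2.
  rewrite -[ltRHS](@ger0_norm _ (m / 2)); last by rewrite divr_ge0// ltW.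
  by rewrite -sqrtr_sqr ltr_sqrt// (lt_trans s0).
have mua : m <= u - a by rewrite ge_min lexx.
have mbu : m <= b - u by rewrite ge_min lexx orbT.
have /andP[_ h1] := normal_itv_bounds s (a + Num.sqrt s) (b - Num.sqrt s) u.
rewrite distrC ger0_norm ?subr_ge0// lerBlDr -lerBlDl -lee_fin normal_itvE.
set D := `[_, _]%classic.
have mD : measurable (D : set (measurableTypeR R)) by exact: measurable_itv.
have : (normal_prob u s (~` D) <= (8 * s)%:E)%E.
  apply: tail => //; first exact: measurableC.
  move=> v /negP; rewrite in_itv/= negb_and -!ltNge => /orP[va|vb].
    by rewrite ler0_norm; lra.
  by rewrite ger0_norm; lra.
have -> : (normal_prob u s (~` D) = 1 - normal_prob u s D)%E.
  exact: (@probability_setC _ _ _ (normal_prob u s)).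
have : normal_prob u s D \is a fin_num by rewrite fin_num_measure.
case: (normal_prob u s D) => [r| |]// _.
have -> : (1 - r%:E = (1 - r)%:E)%E by [].
by rewrite !lee_fin /=; lra.
Qed.

Variables (mu nu : {measure set X -> \bar R}).
Hypotheses (mu1 : mu setT = 1%E) (nu1 : nu setT = 1%E).

Definition same_gauss (s : R) := forall y : 'I_n -> R,
  (\int[mu]_x (\prod_i normal_pdf (y i) s ((x : Rn) ord0 i))%:E =
   \int[nu]_x (\prod_i normal_pdf (y i) s ((x : Rn) ord0 i))%:E)%E.

Lemma measurable_prod_coord d (T : measurableType d) (P : pred 'I_n) (phi : 'I_n -> R -> R)
    (g : T -> X) : measurable_fun setT g ->
  (forall i, measurable_fun setT (phi i)) ->
  measurable_fun setT (fun t => \prod_(i | P i) phi i ((g t : Rn) ord0 i)).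
Proof.
move=> mg mphi.
under eq_fun do rewrite -big_filter.
apply: measurable_prod => i _; apply: (measurableT_comp (mphi i)).
exact: (measurableT_comp (measurable_coord i) mg).
Qed.

(** Densities are replaced by smoothed indicators one coordinate at a time, [k] bounding the
    coordinates already replaced. Tonelli moves the integral over the centre [v] of the last
    replaced coordinate outside the measure. *)
Lemma same_gauss_itv (s : R) (a b : 'I_n -> R) : 0 < s -> same_gauss s ->
  (\int[mu]_x (\prod_i normal_itv s (a i) (b i) ((x : Rn) ord0 i))%:E =
   \int[nu]_x (\prod_i normal_itv s (a i) (b i) ((x : Rn) ord0 i))%:E)%E.
Proof.
move=> s0 sg.
have s0' : s != 0 by rewrite gt_eqF.
suff H k : forall phi : 'I_n -> R -> R,
    (forall i : 'I_n, if (i < k)%N then phi i = normal_itv s (a i) (b i)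
       else exists y, phi i = normal_pdf y s) ->
   (\int[mu]_x (\prod_i phi i ((x : Rn) ord0 i))%:E =
    \int[nu]_x (\prod_i phi i ((x : Rn) ord0 i))%:E)%E.
  by apply: (H n (fun i => normal_itv s (a i) (b i))) => i; rewrite ltn_ord.
elim: k => [|k ih] phi hphi.
  have [y hy] := choice hphi.
  under eq_integral do under eq_bigr do rewrite hy.
  rewrite sg; apply: eq_integral => x _; congr EFin.
  by apply: eq_bigr => i _; rewrite hy.
have [nk|kn] := leqP n k.
  apply: ih => i; have := hphi i.
  by rewrite (leq_trans (ltn_ord i) nk) (leq_trans (ltn_ord i) (leqW nk)).
pose i0 : 'I_n := Ordinal kn.
have hi0 : phi i0 = normal_itv s (a i0) (b i0) by have := hphi i0; rewrite /= ltnSn.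
have mphi i : measurable_fun setT (phi i).
  have := hphi i; case: ifP => _ [].
    by move=> ->; exact: measurable_normal_itv.
  by move=> y ->; exact: measurable_normal_pdf.
have phi_ge0 i u : 0 <= phi i u.
  have := hphi i; case: ifP => _ [].
    by move=> ->; have /andP[] := normal_itv_bounds s (a i) (b i) u.
  by move=> y ->; exact: normal_pdf_ge0.
pose rest (x : X) := \prod_(i | i != i0) phi i ((x : Rn) ord0 i).
have rest_ge0 x : 0 <= rest x by apply: prodr_ge0.
have mrest : measurable_fun setT rest.
  by apply: (@measurable_prod_coord _ X _ phi id) => //; exact: measurable_id.
pose f (p : X * measurableTypeR R) :=
  (\1_(`[a i0, b i0]%classic) (p.2 : R) * normal_pdf (p.2 : R) s ((p.1 : Rn) ord0 i0) * rest p.1)%:E.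
have f0 p : (0 <= f p)%E.
  by rewrite lee_fin mulr_ge0// mulr_ge0// normal_pdf_ge0.
have mf : measurable_fun setT f.
  apply/measurable_EFinP; apply: measurable_funM; last exact: (measurableT_comp mrest measurable_fst).
  apply: measurable_funM.
    have m1 : measurable_fun setT (\1_(`[a i0, b i0]%classic) : measurableTypeR R -> R).
      exact: measurable_indic.
    exact: (measurableT_comp m1 measurable_snd).
  apply: (measurable_normal_pdf2 s0'); first exact: measurable_snd.
  exact: (measurableT_comp (measurable_coord i0) measurable_fst).
have E (la : {measure set X -> \bar R}) : la setT = 1%E ->
    (\int[la]_x (\prod_i phi i ((x : Rn) ord0 i))%:E =
     \int[leb]_v \int[la]_x f (x, v))%E.
  move=> la1; rewrite -(@tonelli_sigma_finite _ _ X (measurableTypeR R) R la leb _ _ f)//.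
  - apply: eq_integral => x _.
    rewrite (bigD1 i0)//= hi0 EFinM normal_itv_integral// -ge0_integralZr//.
    + apply/measurable_EFinP; apply: measurable_funM; first exact: measurable_indic.
      exact: (measurable_normal_pdf2 s0' (@measurable_id _ _ setT) (@measurable_cst _ _ (measurableTypeR R) R setT _)).
    + by move=> v _; rewrite lee_fin mulr_ge0// normal_pdf_ge0.
    + by rewrite lee_fin; exact: rest_ge0.
  - exact: sigma_finite_mass1.
  - exact: sigma_finite_lebesgue.
rewrite (E mu mu1) (E nu nu1); apply: eq_integral => v _.
(* For a fixed centre [v] coordinate [i0] carries a density again, so the induction hypothesis
   applies. *)
pose phiv i := if i == i0 then normal_pdf v s else phi i.
have fE x : f (x, v) = ((\1_(`[a i0, b i0]%classic) (v : R))%:E * (\prod_i phiv i ((x : Rn) ord0 i))%:E)%E.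
  rewrite /f/= -EFinM -mulrA (bigD1 i0)//= /phiv eqxx; congr ((_ * (_ * _))%:E).
  by apply: eq_bigr => i /negPf ->.
have mphiv i : measurable_fun setT (phiv i).
  by rewrite /phiv; case: eqP => // _; exact: measurable_normal_pdf.
have phiv_ge0 i u : 0 <= phiv i u.
  by rewrite /phiv; case: eqP => // _; exact: normal_pdf_ge0.
have m' : measurable_fun setT (fun x : X => (\prod_i phiv i ((x : Rn) ord0 i))%:E).
  by apply/measurable_EFinP; apply: (@measurable_prod_coord _ X _ phiv id) => //; exact: measurable_id.
under eq_integral do rewrite fE.
under [RHS]eq_integral do rewrite fE.
rewrite !ge0_integralZl//; last 2 first.
- by move=> x _; rewrite lee_fin prodr_ge0.
- by move=> x _; rewrite lee_fin prodr_ge0.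
congr (_ * _)%E; apply: ih => i; rewrite /phiv; case: eqP => [->|/eqP ii0].
  by rewrite ltnn; exists v.
have := hphi i; rewrite ltnS leq_eqVlt.
by rewrite (_ : (i == k :> nat) = false)//; apply/negP => /eqP ik; move/eqP: ii0; apply; exact: val_inj.
Qed.

(** Arbitrarily small scales are enough, which matters because equality of Gaussian averages will be
    known only for almost every scale. The products of smoothed indicators converge to the indicator
    of a box, dominated by 1. *)
Theorem same_gauss_eq :
  (forall e : R, 0 < e -> exists2 s, 0 < s < e & same_gauss s) ->
  forall B, measurable B -> mu B = nu B.
Proof.
move=> H.
have Hk (k : nat) : exists s : R, 0 < s < k.+1%:R^-1 /\ same_gauss s.
  by have [//|s h1 h2] := H k.+1%:R^-1; exists s.
have [s hs] := choice Hk.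
have s0 k : 0 < s k by have [/andP[]] := hs k.
have scvg : s @ \oo --> (0 : R).
  apply: (@squeeze_cvgr _ _ _ _ (fun=> 0) (fun k => k.+1%:R^-1)).
  - by apply: nearW => k; have [/andP[/ltW -> /ltW ->]] := hs k.
  - exact: cvg_cst.
  - exact: cvg_harmonic.
apply: eq_measure_open_box; first by rewrite mu1 ltry.
move=> a b.
pose g k (x : X) := \prod_i normal_itv (s k) (a i + Num.sqrt (s k)) (b i - Num.sqrt (s k)) ((x : Rn) ord0 i).
have mg k : measurable_fun setT (g k).
  apply: (@measurable_prod_coord _ X _ (fun i => normal_itv (s k) (a i + Num.sqrt (s k)) (b i - Num.sqrt (s k))) id) => [|i]; first exact: measurable_id.
  by apply: measurable_normal_itv; rewrite gt_eqF.
have gb k x : 0 <= g k x <= 1.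
  have h i := normal_itv_bounds (s k) (a i + Num.sqrt (s k)) (b i - Num.sqrt (s k)) ((x : Rn) ord0 i).
  apply/andP; split; first by apply: prodr_ge0 => i _; have /andP[] := h i.
  by apply: prodr_ile1 => i _; exact: h.
have gcvg x : g ^~ x @ \oo --> (\1_(open_box a b) x : R).
  have -> : \1_(open_box a b) x = \prod_i ((a i < (x : Rn) ord0 i < b i)%R%:R : R).
    rewrite indicE; have [h|h] := boolP (x \in open_box a b).
      by rewrite big1// => i _; move: h; rewrite inE => /(_ i) ->.
    apply/esym/eqP/prodf_eq0; apply: contrapT => h2.
    move: h; rewrite notin_setE; apply => i; apply: contrapT => /negP/negPf h3.
    by apply: h2; exists i => //; rewrite h3.
  apply: cvg_big => [|i _]; first exact: mul_continuous.
  have [eta eta0 heta] := normal_itv_near (a i) (b i) ((x : Rn) ord0 i).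
  apply/cvgrPdist_le => e e0.
  have : \forall k \near \oo, s k < Num.min eta (e / 8).
    by apply: (cvgr_lt 0) => //; rewrite lt_min eta0/= divr_gt0.
  apply: filterS => k; rewrite lt_min => /andP[h1 h2].
  rewrite distrC (le_trans (heta _ _)) ?s0//.
  by rewrite mulrC -ler_pdivlMr// ltW.
have L (la : {measure set X -> \bar R}) : la setT = 1%E ->
    (\int[la]_x (g k x)%:E @[k --> \oo] --> la (open_box a b))%E.
  move=> la1.
  have mB : measurable (open_box a b : set X) by apply: open_borel; exact: open_open_box.
  have -> : la (open_box a b) = (\int[la]_x (\1_(open_box a b) x)%:E)%E.
    by rewrite integral_indic// setIT.
  have [] := @dominated_convergence _ X R la setT measurableT (fun k x => (g k x)%:E) (fun x => (\1_(open_box a b) x)%:E) (cst 1%E).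
  - by move=> k; apply/measurable_EFinP.
  - by apply/measurable_EFinP; exact: measurable_indic.
  - by apply: aeW => x _; apply: cvg_EFin; [exact: nearW|exact: gcvg].
  - apply/integrableP; split; first exact: measurable_cst.
    by rewrite /= normr1 integral_cst// la1 mul1e ltry.
  - by apply: aeW => x k _ /=; have /andP[h0 h1] := gb k x; rewrite lee_fin ger0_norm.
  by [].
have := L mu mu1.
have -> : (fun k => \int[mu]_x (g k x)%:E)%E = (fun k => \int[nu]_x (g k x)%:E)%E.
  apply/funext => k; apply: same_gauss_itv => //; by have [] := hs k.
by move=> h; exact: (cvg_unique _ h (L nu nu1)).
Qed.

End gauss_separation.

(** A half-line has infinite measure, so no null set contains it. *)
Lemma ae_witness (R : realType) (P : R -> Prop) (S : R) :
  {ae @lebesgue_measure R, forall s, P s} -> exists2 s, S <= s & P s.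
Proof.
move=> [N [mN N0 PN]]; apply: contrapT => nP.
have : (@lebesgue_measure R `[S, +oo[%classic <= @lebesgue_measure R N)%E.
  apply: le_measure; [by rewrite inE; exact: measurable_itv|by rewrite inE|].
  move=> s /=; rewrite in_itv/= andbT => Ss; apply: PN => /= Ps.
  by apply: nP; exists s.
by rewrite N0 lebesgue_measure_itv/= ltry leye_eq.
Qed.

(** * Injectivity of the transform *)

Section feature_separates.
Variables (R : realType) (n : nat) (alpha : R).
Hypothesis (alpha_lt_n : alpha < n%:R).
Local Notation Rn := 'rV[R]_n.
Local Notation X := (borelRn R n).
Local Notation leb := (@lebesgue_measure R : {sigma_finite_measure set (measurableTypeR R) -> \bar R}).
Context d (W : measurableType d) (m : {sigma_finite_measure set W -> \bar R}).
Variables (h : R -> Rn -> W -> R) (C : R).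
Hypotheses
  (ch : forall t w, continuous (fun x => h t x w))
  (mh : measurable_fun setT (fun p : R * X * W => h p.1.1 p.1.2 p.2))
  (hC : forall t x w, 0 <= h t x w <= C)
  (hE : forall t x y, (\int[m]_w (h t x w * h t y w)%:E =
         (expR (- (t ^+ 2 * \sum_(i < n) (x ord0 i - y ord0 i) ^+ 2)))%:E)%E).
Local Notation Z := (measurableTypeR R * W)%type.
Local Notation feature := (feature alpha h).
Local Notation weight := (weight n alpha).

Let T (la : {measure set X -> \bar R}) (z : Z) := (\int[la]_x (feature x z)%:E)%E.

Let mfeature : measurable_fun setT (fun p : X * Z => (feature p.1 p.2)%:E).
Proof. by apply/measurable_EFinP; exact: (measurable_feature alpha mh). Qed.

Let feature0 x z : 0 <= feature x z.
Proof. exact: (feature_ge0 alpha_lt_n hC). Qed.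

Let T_fin (la : {measure set X -> \bar R}) z : la setT = 1%E -> T la z \is a fin_num.
Proof.
move=> la1; rewrite ge0_fin_numE; last by apply: integral_ge0 => x _; rewrite lee_fin.
apply: (@le_lt_trans _ _ (\int[la]_x (cst (weight z.1 * C)%:E) x)%E).
  apply: ge0_le_integral => //.
  - by move=> x _; rewrite lee_fin.
  - have mf : measurable_fun setT (fun x : X => (x, z)).
      by apply: measurable_fun_pair; [exact: measurable_id|exact: measurable_cst].
    exact: (measurableT_comp mfeature mf).
  - by move=> x _; rewrite lee_fin; exact: (feature_ub alpha_lt_n hC).
by rewrite integral_cst// la1 mule1 ltry.
Qed.

Let mT (la : {measure set X -> \bar R}) : la setT = 1%E -> measurable_fun setT (T la).
Proof.
move=> la1; apply: (@measurable_integral1 _ _ X Z R la _ (fun p => (feature p.1 p.2)%:E)) => //.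
- exact: sigma_finite_mass1.
- by move=> p; rewrite lee_fin.
Qed.

Let mslice (s : R) : measurable_fun setT (fun w : W => (s : measurableTypeR R, w)).
Proof. by apply: measurable_fun_pair; [exact: measurable_cst|exact: measurable_id]. Qed.

Let slice_integral (la : {measure set X -> \bar R}) s (y : Rn) : la setT = 1%E ->
  (\int[m]_w (T la (s, w) * (feature y (s, w))%:E) =
   \int[la]_x (weight s * weight s * expR (- (expR s * sqdist x y)))%:E)%E.
Proof.
move=> la1.
transitivity (\int[m]_w \int[la]_x (feature x (s, w) * feature y (s, w))%:E)%E.
  apply: eq_integral => w _; rewrite /T -ge0_integralZr//.
  - have mf : measurable_fun setT (fun x : X => (x, (s, w) : Z)).
      by apply: measurable_fun_pair; [exact: measurable_id|exact: measurable_cst].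
    exact: (measurableT_comp mfeature mf).
  - by move=> x _; rewrite lee_fin.
  - by rewrite lee_fin.
rewrite -(@tonelli_sigma_finite _ _ X W R la m _ _ (fun p => (feature p.1 (s, p.2) * feature y (s, p.2))%:E))//.
- apply: eq_integral => x _.
  transitivity (\int[m]_w ((weight s * weight s)%:E * (h (expR (s / 2)) x w * h (expR (s / 2)) y w)%:E))%E.
    by apply: eq_integral => w _; rewrite -EFinM /feature mulrACA.
  rewrite ge0_integralZl//.
  + by rewrite hE -EFinM expr2 -expRD -splitr.
  + by apply/measurable_EFinP; apply: measurable_funM; exact: (measurable_h mh).
  + move=> w _; have /andP[h1 _] := hC (expR (s / 2)) x w; have /andP[h2 _] := hC (expR (s / 2)) y w.
    by rewrite lee_fin mulr_ge0.
  + by rewrite lee_fin -expr2 sqr_ge0.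
- exact: sigma_finite_mass1.
- exact: (@sigma_finiteT _ _ _ m).
- apply/measurable_EFinP; apply: measurable_funM.
    have mf : measurable_fun setT (fun p : X * W => (p.1, (s : measurableTypeR R, p.2))).
      apply: measurable_fun_pair => //.
      by apply: measurable_fun_pair => //; exact: measurable_cst.
    exact: (measurableT_comp (measurable_feature alpha mh) mf).
  have mf : measurable_fun setT (fun p : X * W => (s : measurableTypeR R, p.2)).
    by apply: measurable_fun_pair => //; exact: measurable_cst.
  exact: (measurableT_comp (measurable_feature2 alpha mh y) mf).
- by move=> p; rewrite lee_fin mulr_ge0.
Qed.

(** The deviation of the normal law whose density is proportional to the Gaussian at scale s. *)
Let sd (s : R) : R := expR (- (s / 2)) * (Num.sqrt 2)^-1.

Let sd_gt0 s : 0 < sd s.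
Proof. by rewrite mulr_gt0 ?expR_gt0// invr_gt0 sqrtr_gt0. Qed.

Let sdE s : (sd s) ^+ 2 *+ 2 = expR (- s).
Proof.
rewrite exprMn exprVn sqr_sqrtr// expr2 -expRD -mulr_natr -mulrA mulVf// mulr1.
by rewrite -opprD -splitr.
Qed.

Let prod_normal_pdf s (x : Rn) (y : 'I_n -> R) :
  \prod_i normal_pdf (y i) (sd s) (x ord0 i) =
  normal_peak (sd s) ^+ n * expR (- (expR s * sqdist x (\row_i y i))).
Proof.
rewrite (eq_bigr (fun i => normal_peak (sd s) * expR (- (expR s * (x ord0 i - y i) ^+ 2)))).
  rewrite big_split/= prodr_const card_ord; congr (_ * _).
  rewrite -expR_sum sumrN -mulr_sumr; congr (expR (- (_ * _))).
  by apply: eq_bigr => i _; rewrite mxE.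
move=> i _; rewrite normal_pdf_expR ?gt_eqF// sdE expRN invrK; congr (_ * expR _).
by rewrite mulNr mulrC.
Qed.

(* For almost every scale [s] the transforms agree almost everywhere; integrating
   them against a feature centred at [y] gives equal Gaussian averages at [y]. *)
Lemma feature_separates (mu nu : {measure set X -> \bar R}) :
  mu setT = 1%E -> nu setT = 1%E ->
  (\int[leb \x m]_z ((fine (\int[mu]_x (feature x z)%:E) -
     fine (\int[nu]_x (feature x z)%:E)) ^+ 2)%:E = 0)%E ->
  forall B, measurable B -> mu B = nu B.
Proof.
move=> mu1 nu1.
pose g (z : Z) := ((fine (T mu z) - fine (T nu z)) ^+ 2)%:E.
have g0 z : (0 <= g z)%E by rewrite lee_fin sqr_ge0.
have mg : measurable_fun setT g.
  apply/measurable_EFinP; apply: measurable_funX; apply: measurable_funB;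
    by apply: measurableT_comp => //; exact: mT.
rewrite (@fubini_tonelli1 _ _ _ _ R leb m _ mg g0) => int0.
have mF : measurable_fun setT (fubini_F m g) by exact: measurable_fun_fubini_tonelli_F.
have F0 s : (0 <= fubini_F m g s)%E by apply: integral_ge0.
have aeF : ae_eq leb setT (fubini_F m g) (cst 0%E).
  apply/ae_eq_integral_abs => //.
  by rewrite -[RHS]int0; apply: eq_integral => s _; rewrite gee0_abs.
apply: same_gauss_eq => // e e0.
(* The bound [s >= - (2 * ln e)] makes [expR (- (s / 2)) <= e], hence [sd s < e]. *)
have [s Ss Fs] := @ae_witness R (fun s => setT s -> fubini_F m g s = cst 0%E s) (- (2 * ln e)) aeF.
have {}Fs : (\int[m]_w g (s, w) = 0)%E by exact: Fs.
exists (sd s).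
  rewrite sd_gt0/= /sd ltr_pdivrMr ?sqrtr_gt0//.
  have h1 : expR (- (s / 2)) <= e by rewrite -[leRHS]lnK ?posrE// ler_expR; lra.
  apply: (le_lt_trans h1); rewrite ltr_pMr//.
  by rewrite -[ltLHS]sqrtr1 ltr_sqrt// ltr1n.
have mgs : measurable_fun setT (fun w => g (s, w)) by exact: (measurableT_comp mg (mslice s)).
have aew : ae_eq m setT (fun w => g (s, w)) (cst 0%E).
  apply/ae_eq_integral_abs => //.
  by rewrite -[RHS]Fs; apply: eq_integral => w _; rewrite gee0_abs.
move=> y.
have key : (\int[mu]_x (weight s * weight s * expR (- (expR s * sqdist x (\row_i y i))))%:E =
    \int[nu]_x (weight s * weight s * expR (- (expR s * sqdist x (\row_i y i))))%:E)%E.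
  rewrite -!slice_integral//.
  apply: ge0_ae_eq_integral => //.
  - apply: emeasurable_funM; first exact: (measurableT_comp (mT mu1) (mslice s)).
    by apply/measurable_EFinP; exact: (measurableT_comp (measurable_feature2 alpha mh _) (mslice s)).
  - apply: emeasurable_funM; first exact: (measurableT_comp (mT nu1) (mslice s)).
    by apply/measurable_EFinP; exact: (measurableT_comp (measurable_feature2 alpha mh _) (mslice s)).
  - by move=> w _; rewrite mule_ge0 ?lee_fin// integral_ge0// => x _; rewrite lee_fin.
  - by move=> w _; rewrite mule_ge0 ?lee_fin// integral_ge0// => x _; rewrite lee_fin.
  apply: filterS aew => w /(_ I) /=.
  move=> /eqP; rewrite eqe sqrf_eq0 subr_eq0 => /eqP E _.
  by rewrite -(fineK (T_fin (s, w) mu1)) E fineK// T_fin.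
have w0 : 0 < weight s * weight s by rewrite mulr_gt0// weight_gt0.
have mex (la : {measure set X -> \bar R}) : la setT = 1%E -> 
   (\int[la]_x (\prod_i normal_pdf (y i) (sd s) ((x : Rn) ord0 i))%:E =
    (normal_peak (sd s) ^+ n / (weight s * weight s))%:E * 
    \int[la]_x (weight s * weight s * expR (- (expR s * sqdist (x : Rn) (\row_i y i))))%:E)%E.
  move=> la1; rewrite -ge0_integralZl//.
  - by apply: eq_integral => x _; rewrite prod_normal_pdf -EFinM; congr EFin;
      rewrite mulrA divfK// gt_eqF.
  - apply/measurable_EFinP; apply: measurable_funM => //; apply: measurableT_comp => //.
    apply: measurableT_comp => //; apply: measurable_funM => //.
    apply: measurable_sum => i; apply: measurable_funX.
    by apply: measurable_funB => //; exact: measurable_coord.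
  - by move=> x _; rewrite lee_fin mulr_ge0 ?expR_ge0// ltW.
  - by rewrite lee_fin divr_ge0 ?exprn_ge0 ?normal_peak_ge0// ltW.
by rewrite !mex// key.
Qed.

End feature_separates.

(** The interface to the rest of the proof: from here on the Gaussian construction is hidden. The
    bound on H(., z) depends on z, since the weight of a scale is unbounded. *)
Theorem riesz_features (R : realType) (n : nat) (alpha : R) :
  alpha < n%:R ->
  exists d (Z : measurableType d) (M : {sigma_finite_measure set Z -> \bar R})
    (H : 'rV[R]_n -> Z -> R),
  [/\ forall z, continuous (H^~ z),
      measurable_fun setT (fun p : borelRn R n * Z => H p.1 p.2),
      (forall z, exists C, forall x, 0 <= H x z <= C),
      (forall x y, \int[M]_z (H x z * H y z)%:E = riesz_kernel alpha x y)%E &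
      forall mu nu : {measure set borelRn R n -> \bar R},
        mu setT = 1%E -> nu setT = 1%E ->
        (\int[M]_z ((fine (\int[mu]_x (H x z)%:E) -
           fine (\int[nu]_x (H x z)%:E)) ^+ 2)%:E = 0)%E ->
        forall B, measurable B -> mu B = nu B].
Proof.
move=> an.
have [d [W [m [h [C [ch mh hC hE]]]]]] := @gauss_features R n (index_enum 'I_n).
have [M ME] := sigma_finite_packing (sigma_finite_product (@lebesgue_measure R : {sigma_finite_measure set (measurableTypeR R) -> \bar R}) m).
exists _, (measurableTypeR R * W)%type, M, (feature alpha h); split.
- by move=> z; exact: continuous_feature.
- exact: measurable_feature.
- move=> z; exists (weight n alpha z.1 * C) => x.
  by rewrite (feature_ge0 an hC) (feature_ub an hC).
- by move=> x y; rewrite ME (integral_featureM an mh hC).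
- by move=> mu nu mu1 nu1; rewrite ME => /(feature_separates an mh hC hE mu1 nu1).
Qed.

(** * Energy as an L^2 product *)

Section energy_calculus.
Variables (R : realType) (n : nat) (alpha : R).
Local Notation Rn := 'rV[R]_n.
Local Notation X := (borelRn R n).
Local Notation posmeas := {measure set X -> \bar R}.
Context d (Z : measurableType d) (M : {sigma_finite_measure set Z -> \bar R}).
Variable H : Rn -> Z -> R.
Hypotheses
  (mH : measurable_fun setT (fun p : X * Z => H p.1 p.2))
  (H0 : forall x z, 0 <= H x z)
  (HE : forall x y, (\int[M]_z (H x z * H y z)%:E = riesz_kernel alpha x y)%E).
Implicit Types mu nu th : posmeas.
Local Notation energy := (energy alpha).
Local Open Scope ereal_scope.

Definition transform mu (z : Z) : \bar R := \int[mu]_x (H x z)%:E.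

Lemma transform_ge0 mu z : 0 <= transform mu z.
Proof. by apply: integral_ge0 => x _; rewrite lee_fin. Qed.

Let mHE : measurable_fun setT (fun p : X * Z => (H p.1 p.2)%:E).
Proof. exact/measurable_EFinP. Qed.

Lemma measurable_H1 z : measurable_fun setT (fun x : X => (H x z)%:E).
Proof.
have mf : measurable_fun setT (fun x : X => (x, z)).
  by apply: measurable_fun_pair; [exact: measurable_id|exact: measurable_cst].
exact: (measurableT_comp mHE mf).
Qed.

Lemma measurable_H2 x : measurable_fun setT (fun z => (H x z)%:E).
Proof.
have mf : measurable_fun setT (fun z : Z => (x : X, z)).
  by apply: measurable_fun_pair; [exact: measurable_cst|exact: measurable_id].
exact: (measurableT_comp mHE mf).
Qed.

Lemma measurable_transform mu : sigma_finite setT mu -> measurable_fun setT (transform mu).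
Proof.
move=> smu; apply: (@measurable_integral1 _ _ X Z R mu smu (fun p => (H p.1 p.2)%:E)) => //.
by move=> p; rewrite lee_fin.
Qed.

Lemma potential_transform nu x : sigma_finite setT nu ->
  potential alpha nu x = \int[M]_z ((H x z)%:E * transform nu z).
Proof.
move=> snu.
transitivity (\int[nu]_y \int[M]_z ((H x z)%:E * (H y z)%:E)).
  by apply: eq_integral => y _; rewrite -HE; apply: eq_integral => z _; rewrite EFinM.
have mf : measurable_fun setT (fun p : X * Z => (H x p.2)%:E * (H p.1 p.2)%:E).
  apply: emeasurable_funM; last exact: mHE.
  exact: (measurableT_comp (measurable_H2 x) measurable_snd).
rewrite (@tonelli_sigma_finite _ _ X Z R nu M snu _ (fun p => (H x p.2)%:E * (H p.1 p.2)%:E))//.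
- apply: eq_integral => z _ /=; rewrite ge0_integralZl//.
  + exact: measurable_H1.
  + by move=> y _; rewrite lee_fin.
  + by rewrite lee_fin.
- exact: (@sigma_finiteT _ _ _ M).
- by move=> p; rewrite mule_ge0 ?lee_fin.
Qed.

Lemma measurable_potential nu : sigma_finite setT nu ->
  measurable_fun setT (potential alpha nu : X -> \bar R).
Proof.
move=> snu.
have -> : (potential alpha nu : X -> \bar R) = fun x => \int[M]_z ((H x z)%:E * transform nu z).
  by apply/funext => x; exact: potential_transform.
apply: (@measurable_integral2 _ _ X Z R M _ (fun p => (H p.1 p.2)%:E * transform nu p.2)).
- exact: (@sigma_finiteT _ _ _ M).
- apply: emeasurable_funM => //.
  exact: (measurableT_comp (measurable_transform snu) measurable_snd).
- by move=> p; rewrite mule_ge0 ?lee_fin// transform_ge0.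
Qed.

Lemma riesz_kernel_ge0 (x y : Rn) : 0 <= riesz_kernel alpha x y.
Proof. by rewrite /riesz_kernel; case: ifP => // _; rewrite lee_fin powR_ge0. Qed.

Lemma potential_ge0 nu x : 0 <= potential alpha nu x.
Proof. by apply: integral_ge0 => y _; exact: riesz_kernel_ge0. Qed.

Lemma energy_ge0 mu nu : 0 <= energy mu nu.
Proof. by apply: integral_ge0 => x _; exact: potential_ge0. Qed.

Lemma energyE mu nu : sigma_finite setT mu -> sigma_finite setT nu ->
  energy mu nu = \int[M]_z (transform mu z * transform nu z).
Proof.
move=> smu snu.
transitivity (\int[mu]_x \int[M]_z ((H x z)%:E * transform nu z)).
  by apply: eq_integral => x _; exact: potential_transform.
rewrite (@tonelli_sigma_finite _ _ X Z R mu M smu _ (fun p => (H p.1 p.2)%:E * transform nu p.2))//.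
- apply: eq_integral => z _ /=; rewrite ge0_integralZr//.
  + exact: measurable_H1.
  + by move=> y _; rewrite lee_fin.
  + exact: transform_ge0.
- exact: (@sigma_finiteT _ _ _ M).
- apply: emeasurable_funM => //.
  exact: (measurableT_comp (measurable_transform snu) measurable_snd).
- by move=> p; rewrite mule_ge0 ?lee_fin// transform_ge0.
Qed.

Lemma energyC mu nu : sigma_finite setT mu -> sigma_finite setT nu ->
  energy mu nu = energy nu mu.
Proof.
move=> smu snu; rewrite (energyE smu snu) (energyE snu smu).
by apply: eq_integral => z _; rewrite muleC.
Qed.

Definition finite_self_energy mu := sigma_finite setT mu /\ energy mu mu < +oo.

Lemma transform_ae_fin mu : finite_self_energy mu ->
  {ae M, forall z, transform mu z \is a fin_num}.
Proof.
move=> [smu emu].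
have : M.-integrable setT (fun z => transform mu z * transform mu z).
  apply/integrableP; split.
    by apply: emeasurable_funM; exact: measurable_transform.
  rewrite (eq_integral (fun z => transform mu z * transform mu z)) -?energyE//.
  by move=> z _; rewrite gee0_abs// mule_ge0// transform_ge0.
move=> /(integrable_ae measurableT); apply: filterS => z /(_ I).
have := transform_ge0 mu z; case: (transform mu z) => //.
Qed.

(* The squared energy norm of [mu - nu].  At an infinite transform [fine] gives 0,
   but for finite self-energy such [z] form a null set. *)
Definition sqdiff mu nu : \bar R :=
  \int[M]_z ((fine (transform mu z) - fine (transform nu z)) ^+ 2)%R%:E.

Lemma measurable_sqdiff_integrand mu nu : sigma_finite setT mu -> sigma_finite setT nu ->
  measurable_fun setT (fun z => ((fine (transform mu z) - fine (transform nu z)) ^+ 2)%R%:E).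
Proof.
move=> smu snu; apply/measurable_EFinP; apply: measurable_funX; apply: measurable_funB;
  by apply: measurableT_comp => //; exact: measurable_transform.
Qed.

Lemma sqdiff_ge0 mu nu : 0 <= sqdiff mu nu.
Proof. by apply: integral_ge0 => z _; rewrite lee_fin sqr_ge0. Qed.

Lemma sqdiffC mu nu : sqdiff mu nu = sqdiff nu mu.
Proof. by apply: eq_integral => z _; rewrite -sqrrN opprB. Qed.

Lemma measurable_transformM mu nu : sigma_finite setT mu -> sigma_finite setT nu ->
  measurable_fun setT (fun z => transform mu z * transform nu z).
Proof. by move=> smu snu; apply: emeasurable_funM; exact: measurable_transform. Qed.

Lemma transformM_ge0 mu nu z : 0 <= transform mu z * transform nu z.
Proof. by rewrite mule_ge0// transform_ge0. Qed.

(** The polarization identity, with the mutual energy moved to the other side so that no extended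
    reals are subtracted. *)
Lemma energy_sqdiff mu nu : finite_self_energy mu -> finite_self_energy nu ->
  energy mu mu + energy nu nu = sqdiff mu nu + 2%:E * energy mu nu.
Proof.
move=> fmu fnu; have [smu emu] := fmu; have [snu enu] := fnu.
rewrite !energyE// /sqdiff -ge0_integralZl//; last 2 first.
- exact: measurable_transformM.
- by move=> z _; exact: transformM_ge0.
rewrite -!ge0_integralD//.
- apply: ge0_ae_eq_integral => //.
  + by apply: emeasurable_funD; exact: measurable_transformM.
  + apply: emeasurable_funD; first exact: measurable_sqdiff_integrand.
    by apply: measurable_funeM; exact: measurable_transformM.
  + by move=> z _; rewrite adde_ge0// transformM_ge0.
  + by move=> z _; rewrite adde_ge0 ?lee_fin ?sqr_ge0// mule_ge0// transformM_ge0.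
  have := transform_ae_fin fmu; have := transform_ae_fin fnu.
  apply: filterS2 => z fn fm _.
  rewrite -(fineK fm) -(fineK fn) /= -!EFinM -!EFinD; congr EFin; ring.
- by move=> z _; rewrite lee_fin sqr_ge0.
- exact: measurable_sqdiff_integrand.
- by move=> z _; rewrite mule_ge0// transformM_ge0.
- by apply: measurable_funeM; exact: measurable_transformM.
- by move=> z _; exact: transformM_ge0.
- exact: measurable_transformM.
- by move=> z _; exact: transformM_ge0.
- exact: measurable_transformM.
Qed.

(** Pointwise 2ab <= e a^2 + b^2/e under the integral. It allows infinite values, and thereby serves
    to prove that mutual energies are finite. *)
Lemma energy_young mu nu (e : R) : (0 < e)%R -> sigma_finite setT mu -> sigma_finite setT nu ->
  2%:E * energy mu nu <= e%:E * energy mu mu + (e^-1)%R%:E * energy nu nu.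
Proof.
move=> e0 smu snu; rewrite !energyE//.
have e1 : (0 <= e^-1)%R by rewrite invr_ge0 ltW.
rewrite -!ge0_integralZl ?lee_fin ?(ltW e0)//; do ?[exact: measurable_transformM
  | by move=> z _; exact: transformM_ge0].
rewrite -ge0_integralD//; last 4 first.
- by move=> z _; rewrite mule_ge0 ?lee_fin ?(ltW e0)// transformM_ge0.
- by apply: measurable_funeM; exact: measurable_transformM.
- by move=> z _; rewrite mule_ge0 ?lee_fin// transformM_ge0.
- by apply: measurable_funeM; exact: measurable_transformM.
apply: ge0_le_integral => //.
- by move=> z _; rewrite mule_ge0// transformM_ge0.
- by apply: measurable_funeM; exact: measurable_transformM.
- by apply: emeasurable_funD; apply: measurable_funeM; exact: measurable_transformM.
move=> z _; have := transform_ge0 mu z; have := transform_ge0 nu z.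
case: (transform mu z) => [a| |]//; case: (transform nu z) => [b| |]// b0 a0.
- rewrite -!EFinM -EFinD lee_fin.
  have -> : (e * (a * a) + e^-1 * (b * b) = 2 * (a * b) + e^-1 * (e * a - b) ^+ 2)%R.
    by field; rewrite gt_eqF.
  by rewrite lerDl mulr_ge0// sqr_ge0.
- rewrite [X in _ <= _ + X](_ : _ = +oo) ?addey ?leey// mulyy.
  by rewrite gt0_muley// lte_fin invr_gt0.
- rewrite [X in _ <= X + _](_ : _ = +oo); last by rewrite mulyy gt0_muley.
  by rewrite addye ?leey// -EFinM.
- rewrite [X in _ <= X + _](_ : _ = +oo); last by rewrite mulyy gt0_muley.
  by rewrite addye ?leey// mulyy gt0_muley// lte_fin invr_gt0.
Qed.

Lemma energy_lty mu nu : finite_self_energy mu -> finite_self_energy nu ->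
  energy mu nu < +oo.
Proof.
move=> [smu emu] [snu enu].
have := energy_young ltr01 smu snu; rewrite invr1 !mul1e.
have : energy mu mu + energy nu nu < +oo by rewrite lte_add_pinfty.
move=> /[swap] /le_lt_trans /[apply].
have := energy_ge0 mu nu; case: (energy mu nu) => [r| |]//; first by move=> _ _; rewrite ltry.
by move=> _; rewrite gt0_muley ?ltxx// lte_fin.
Qed.

Lemma energy_fin_num mu nu : finite_self_energy mu -> finite_self_energy nu ->
  energy mu nu \is a fin_num.
Proof. by move=> fmu fnu; rewrite ge0_fin_numE ?energy_ge0// energy_lty. Qed.

(** Strong continuity of the mutual energy with a fixed measure, from (a - b) c <= e c^2 + (a -
    b)^2/e; taking e of the order of the distance gives an error of that order. *)
Lemma energy_diff mu nu th (e : R) : (0 < e)%R ->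
  finite_self_energy mu -> finite_self_energy nu -> finite_self_energy th ->
  energy mu th <= energy nu th + (e%:E * energy th th + (e^-1)%R%:E * sqdiff mu nu).
Proof.
move=> e0 fmu fnu fth; have [smu emu] := fmu; have [snu enu] := fnu; have [sth eth] := fth.
have e1 : (0 <= e^-1)%R by rewrite invr_ge0 ltW.
rewrite !energyE// /sqdiff.
have ge1 z : 0 <= ((fine (transform mu z) - fine (transform nu z)) ^+ 2)%R%:E by rewrite lee_fin sqr_ge0.
rewrite -!ge0_integralZl ?lee_fin ?(ltW e0)//; do ?[exact: measurable_transformM
  | exact: measurable_sqdiff_integrand | by move=> z _; exact: transformM_ge0].
have m1 : measurable_fun setT (fun z => e%:E * (transform th z * transform th z)).
  by apply: measurable_funeM; exact: measurable_transformM.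
have m2 : measurable_fun setT (fun z => (e^-1)%:E * ((fine (transform mu z) - fine (transform nu z)) ^+ 2)%R%:E).
  by apply: measurable_funeM; exact: measurable_sqdiff_integrand.
have g1 z : 0 <= e%:E * (transform th z * transform th z).
  by rewrite mule_ge0 ?lee_fin ?(ltW e0)// transformM_ge0.
have g2 z : 0 <= (e^-1)%:E * ((fine (transform mu z) - fine (transform nu z)) ^+ 2)%R%:E.
  by rewrite mule_ge0 ?lee_fin// sqr_ge0.
rewrite -[X in _ + X]ge0_integralD// -ge0_integralD//; last 4 first.
- by move=> z _; exact: transformM_ge0.
- exact: measurable_transformM.
- by move=> z _; rewrite adde_ge0.
- exact: emeasurable_funD.
apply: ae_ge0_le_integral => //.
- by move=> z _; exact: transformM_ge0.
- exact: measurable_transformM.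
- by move=> z _; rewrite adde_ge0 ?transformM_ge0// adde_ge0.
- by apply: emeasurable_funD; [exact: measurable_transformM|exact: emeasurable_funD].
have := transform_ae_fin fth; have := transform_ae_fin fmu; have := transform_ae_fin fnu.
apply: filterS3 => z fn fm ft _.
rewrite -(fineK fm) -(fineK fn) -(fineK ft) /= -!EFinM -!EFinD lee_fin.
set a := fine (transform mu z); set b := fine (transform nu z); set c := fine (transform th z).
have -> : (b * c + (e * (c * c) + e^-1 * (a - b) ^+ 2) =
    a * c + e^-1 * ((e * c - (a - b) / 2) ^+ 2 + 3 / 4 * (a - b) ^+ 2))%R.
  by field; rewrite gt_eqF.
by rewrite lerDl mulr_ge0// addr_ge0 ?sqr_ge0// mulr_ge0 ?sqr_ge0.
Qed.

(** Pointwise a^2 <= (1 + e) b^2 + (1 + 1/e)(a - b)^2. With e = 1 it bounds the energies of a Cauchy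
    sequence, with small e it compares the energy of a limit with those of the sequence. *)
Lemma energy_self_diff mu nu (e : R) : (0 < e)%R ->
  finite_self_energy mu -> finite_self_energy nu ->
  energy mu mu <= (1 + e)%R%:E * energy nu nu + (1 + e^-1)%R%:E * sqdiff mu nu.
Proof.
move=> e0 fmu fnu; have [smu emu] := fmu; have [snu enu] := fnu.
have e1 : (0 <= e^-1)%R by rewrite invr_ge0 ltW.
rewrite !energyE// /sqdiff.
have ge1 z : 0 <= ((fine (transform mu z) - fine (transform nu z)) ^+ 2)%R%:E by rewrite lee_fin sqr_ge0.
rewrite -!ge0_integralZl ?lee_fin ?addr_ge0 ?(ltW e0)//; do ?[exact: measurable_transformM
  | exact: measurable_sqdiff_integrand | by move=> z _; exact: transformM_ge0].
have m1 : measurable_fun setT (fun z => (1 + e)%:E * (transform nu z * transform nu z)).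
  by apply: measurable_funeM; exact: measurable_transformM.
have m2 : measurable_fun setT (fun z => (1 + e^-1)%:E * ((fine (transform mu z) - fine (transform nu z)) ^+ 2)%R%:E).
  by apply: measurable_funeM; exact: measurable_sqdiff_integrand.
have g1 z : 0 <= (1 + e)%:E * (transform nu z * transform nu z).
  by rewrite mule_ge0 ?lee_fin ?addr_ge0 ?(ltW e0)// transformM_ge0.
have g2 z : 0 <= (1 + e^-1)%:E * ((fine (transform mu z) - fine (transform nu z)) ^+ 2)%R%:E.
  by rewrite mule_ge0 ?lee_fin ?addr_ge0// sqr_ge0.
rewrite -ge0_integralD//.
apply: ae_ge0_le_integral => //.
- by move=> z _; exact: transformM_ge0.
- exact: measurable_transformM.
- by move=> z _; rewrite adde_ge0.
- exact: emeasurable_funD.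
have := transform_ae_fin fmu; have := transform_ae_fin fnu.
apply: filterS2 => z fn fm _.
rewrite -(fineK fm) -(fineK fn) /= -!EFinM -!EFinD lee_fin.
set a := fine (transform mu z); set b := fine (transform nu z).
have -> : ((1 + e) * (b * b) + (1 + e^-1) * (a - b) ^+ 2 =
    a * a + e^-1 * (e * b - (a - b)) ^+ 2)%R.
  by field; rewrite gt_eqF.
by rewrite lerDl mulr_ge0// sqr_ge0.
Qed.

End energy_calculus.

(** * Scaling, averaging and restricting measures *)

Section measure_constructions.
Context d (T : measurableType d) (R : realType).
Implicit Types mu nu rho : {measure set T -> \bar R}.
Local Open Scope ereal_scope.

Lemma scaled_measure mu (c : R) : (0 <= c)%R ->
  exists rho, (forall B, rho B = c%:E * mu B) /\
    forall D f, measurable D -> measurable_fun D f -> (forall x, D x -> 0 <= f x) ->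
      \int[rho]_(x in D) f x = c%:E * \int[mu]_(x in D) f x.
Proof.
move=> c0; exists (mscale (NngNum c0) mu); split=> // D f mD mf f0.
by rewrite ge0_integral_mscale.
Qed.

Lemma average_measure mu nu :
  exists rho, (forall B, rho B = (2^-1)%:E * (mu B + nu B)) /\
    forall D f, measurable D -> measurable_fun D f -> (forall x, D x -> 0 <= f x) ->
      \int[rho]_(x in D) f x =
        (2^-1)%:E * (\int[mu]_(x in D) f x + \int[nu]_(x in D) f x).
Proof.
have c0 : (0 <= 2^-1 :> R)%R by [].
have [rho [h1 h2]] := scaled_measure (measure_add mu nu) c0.
exists rho; split=> [B|D f mD mf f0]; first by rewrite h1; congr (_ * _); exact: measure_addE.
by rewrite h2// ge0_integral_measure_add.
Qed.

Lemma restricted_measure mu (B : set T) : measurable B ->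
  exists rho, (forall C, rho C = mu (C `&` B)) /\
    forall f, measurable_fun setT f -> (forall x, 0 <= f x) ->
      \int[rho]_x f x = \int[mu]_(x in B) f x.
Proof.
move=> mB; exists (mrestr mu mB); split=> // f mf f0.
rewrite -(setUv B) ge0_integral_setU//=.
- rewrite [X in _ + X](_ : _ = 0) ?adde0; last first.
    rewrite (@eq_measure_integral _ _ _ _ mzero) ?integral_measure_zero// => A mA AB.
    by rewrite /= /mrestr /mzero; move/disjoints_subset: AB => ->; exact: measure0.
  by apply: eq_measure_integral => A mA AB; rewrite /= /mrestr; congr (mu _); exact: setIidl.
- exact: measurableC.
- by rewrite setUv.
- by rewrite disj_set2E setICr.
Qed.

End measure_constructions.

(** * Balls and Radon measures *)

Section radon_facts.
Variables (R : realType) (n : nat) (alpha : R).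
Local Notation Rn := 'rV[R]_n.
Local Notation X := (borelRn R n).
Local Notation posmeas := {measure set X -> \bar R}.
Implicit Types mu nu : posmeas.

Definition cball (r : R) : set Rn := [set x | `|x| <= r].

Lemma closed_cball r : closed (cball r).
Proof.
have -> : cball r = (fun x : Rn => `|x|) @^-1` [set t | t <= r] by [].
by apply: closed_comp; [move=> x _; exact: norm_continuous|exact: closed_le].
Qed.

Lemma compact_cball r : compact (cball r).
Proof.
apply: bounded_closed_compact; last exact: closed_cball.
exists r; split; first exact: num_real.
by move=> s rs x /= xr; rewrite (le_trans xr)// ltW.
Qed.

Lemma measurable_cball r : measurable (cball r : set X).
Proof. by apply: closed_borel; exact: closed_cball. Qed.

Lemma bigcup_cball : \bigcup_k cball k%:R = setT.
Proof.
apply/seteqP; split=> // x _; exists (Num.truncn `|x|).+1 => //=.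
by rewrite /cball/= ltW// truncnS_gt.
Qed.

Lemma pos_radon_sigma_finite mu : pos_radon alpha mu -> sigma_finite setT mu.
Proof.
move=> [cmu _]; exists (fun k => cball k%:R); first by rewrite -bigcup_cball.
by move=> k; split; [exact: measurable_cball|exact/cmu/compact_cball].
Qed.

Lemma continuous_enorm : continuous (@enorm R n).
Proof.
move=> x; apply: (@continuous_comp Rn R R (fun x : Rn => \sum_(i < n) x ord0 i ^+ 2) Num.sqrt).
  have hs : continuous (fun y : Rn => \sum_(i < n) y ord0 i ^+ 2).
    apply: continuous_big => [|i _ y]; first exact: add_continuous.
    exact: (cvgM (@coord_continuous R 1 n ord0 i y) (@coord_continuous R 1 n ord0 i y)).
  exact: hs.
exact: sqrt_continuous.
Qed.

Lemma measurable_enorm : measurable_fun setT (@enorm R n : X -> R).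
Proof. by apply: continuous_borel_measurable; exact: continuous_enorm. Qed.

Lemma norm_le_enorm (x : Rn) : `|x| <= enorm x.
Proof.
rewrite [leLHS]/Num.norm/= mx_normrE; apply: bigmax_le; first exact: sqrtr_ge0.
move=> [i j] _ /=; rewrite ord1 -sqrtr_sqr; apply: ler_wsqrtr.
by rewrite (bigD1 j)//= lerDl sumr_ge0// => k _; exact: sqr_ge0.
Qed.

Hypothesis alpha_lt_n : alpha < n%:R.

Lemma powR_le1 (r : R) : 1 <= r -> r `^ (alpha - n%:R) <= 1.
Proof.
move=> r1; rewrite -[leRHS](powRr0 r).
by apply: ler_powR => //; rewrite subr_le0 ltW.
Qed.

(** The growth condition at infinity is automatic for finite measures, as |y|^(alpha - n) <= 1 where
    |y| > 1. *)
Lemma pos_radon_finite mu : (mu setT < +oo)%E -> pos_radon alpha mu.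
Proof.
move=> mufin; split=> [K cK|].
  by apply: le_lt_trans mufin; rewrite le_measure ?inE//; exact: compact_borel.
pose D : set X := [set y : X | 1 < enorm (y : Rn)].
have mD : measurable D.
  rewrite -[X in measurable X]setTI (_ : D = (@enorm R n : X -> R) @^-1` `]1, +oo[%classic).
    exact: measurable_enorm.
  by apply/seteqP; split=> y /=; rewrite in_itv/= andbT.
apply: (@le_lt_trans _ _ (\int[mu]_(y in D) (cst 1%E) y)%E).
  apply: ge0_le_integral => //.
  - by move=> y _; rewrite lee_fin powR_ge0.
  - apply/measurable_EFinP; apply: measurable_funTS.
    exact: (measurableT_comp (measurable_powR _) measurable_enorm).
  - by move=> y /= /ltW y1; rewrite lee_fin powR_le1.
rewrite integral_cst// mul1e; apply: le_lt_trans mufin.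
by rewrite le_measure ?inE.
Qed.

End radon_facts.

(** * Measures of finite energy carried by a set *)

Section carried_measures.
Variables (R : realType) (n : nat) (alpha : R).
Local Notation Rn := 'rV[R]_n.
Local Notation X := (borelRn R n).
Local Notation posmeas := {measure set X -> \bar R}.
Context d (Z : measurableType d) (M : {sigma_finite_measure set Z -> \bar R}).
Variable H : Rn -> Z -> R.
Hypotheses
  (mH : measurable_fun setT (fun p : X * Z => H p.1 p.2))
  (H0 : forall x z, 0 <= H x z)
  (HE : forall x y, (\int[M]_z (H x z * H y z)%:E = riesz_kernel alpha x y)%E)
  (alpha_lt_n : alpha < n%:R).
Implicit Types (mu nu th rho : posmeas) (A : set Rn).
Local Notation energy := (energy alpha).
Local Notation sqdiff := (sqdiff M H).
Local Open Scope ereal_scope.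

Lemma Eplus_finite_self_energy mu : Eplus alpha mu -> finite_self_energy alpha mu.
Proof. by move=> [pmu emu]; split=> //; exact: pos_radon_sigma_finite pmu. Qed.

Lemma Eplus1_finite_self_energy A mu : Eplus1_on alpha A mu -> finite_self_energy alpha mu.
Proof. by move=> [[emu _] _]; exact: Eplus_finite_self_energy. Qed.

Lemma energy_average mu nu rho : sigma_finite setT mu -> sigma_finite setT nu ->
  sigma_finite setT rho ->
  (forall D f, measurable D -> measurable_fun D f -> (forall x, D x -> 0 <= f x) ->
      \int[rho]_(x in D) f x =
        (2^-1)%:E * (\int[mu]_(x in D) f x + \int[nu]_(x in D) f x)) ->
  forall th, sigma_finite setT th ->
  energy rho th = (2^-1)%:E * (energy mu th + energy nu th).
Proof.
move=> smu snu srho hrho th sth; rewrite /energy hrho//.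
- exact: (measurable_potential mH H0 HE sth).
- by move=> x _; exact: potential_ge0.
Qed.

(** [rho] is the midpoint of [mu] and [nu]; it is null on the intersection of their two exceptional
    sets, which still covers the complement of [A]. The last clause is the parallelogram
    identity. *)
Lemma Eplus1_average A mu nu : Eplus1_on alpha A mu -> Eplus1_on alpha A nu ->
  exists rho, [/\ Eplus1_on alpha A rho,
    (forall D f, measurable D -> measurable_fun D f -> (forall x, D x -> 0 <= f x) ->
      \int[rho]_(x in D) f x =
        (2^-1)%:E * (\int[mu]_(x in D) f x + \int[nu]_(x in D) f x)),
    (forall th, sigma_finite setT th ->
      energy rho th = (2^-1)%:E * (energy mu th + energy nu th)) &
    4%:E * energy rho rho + sqdiff mu nu = 2%:E * (energy mu mu + energy nu nu)].
Proof.
move=> Amu Anu.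
have fmu := Eplus1_finite_self_energy Amu; have fnu := Eplus1_finite_self_energy Anu.
have [rho [rhoE rhoI]] := average_measure mu nu.
have [[[pmu emu] [N1 [mN1 N10 AN1]]] mu1] := Amu.
have [[[pnu enu] [N2 [mN2 N20 AN2]]] nu1] := Anu.
have rho1 : rho setT = 1.
  rewrite rhoE mu1 nu1 (_ : 1 + 1 = 2%:E :> \bar R)//.
  by rewrite -EFinM mulVf.
have srho : sigma_finite setT rho by exact: sigma_finite_mass1.
have ravg := energy_average fmu.1 fnu.1 srho rhoI.
have E4 : 4%:E * energy rho rho = energy mu mu + energy nu nu + 2%:E * energy mu nu.
  rewrite (ravg rho srho) (energyC mH H0 HE fmu.1 srho) (energyC mH H0 HE fnu.1 srho).
  rewrite (ravg mu fmu.1) (ravg nu fnu.1).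
  rewrite (energyC mH H0 HE fnu.1 fmu.1).
  have := energy_fin_num mH H0 HE fmu fmu; have := energy_fin_num mH H0 HE fnu fnu.
  have := energy_fin_num mH H0 HE fmu fnu.
  case: (energy mu mu) => [a| |]//; case: (energy nu nu) => [b| |]//; case: (energy mu nu) => [c| |]// _ _ _.
  rewrite -?EFinD -?EFinM -?EFinD -?EFinM -?EFinD; congr EFin; by field.
exists rho; split=> //.
- split=> //; split; first split.
  + by apply: pos_radon_finite => //; rewrite rho1 ltry.
  + have := E4; have := energy_fin_num mH H0 HE fmu fmu; have := energy_fin_num mH H0 HE fnu fnu.
    have := energy_fin_num mH H0 HE fmu fnu.
    case: (energy mu mu) => [a| |]//; case: (energy nu nu) => [b| |]//; case: (energy mu nu) => [c| |]// _ _ _.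
    have := energy_ge0 alpha rho rho; case: (energy rho rho) => [r| |]//; first by rewrite ltry.
    by rewrite gt0_muley// lte_fin.
  + exists (N1 `&` N2); split; first exact: measurableI.
      apply/eqP; rewrite eq_le measure_ge0 andbT rhoE.
      have -> : mu (N1 `&` N2) = 0.
        by apply/eqP; rewrite eq_le measure_ge0 andbT -N10 le_measure ?inE//; exact: measurableI.
      have -> : nu (N1 `&` N2) = 0.
        by apply/eqP; rewrite eq_le measure_ge0 andbT -N20 le_measure ?inE//; exact: measurableI.
      by rewrite adde0 mule0.
    by move=> x Ax; split; [exact: AN1|exact: AN2].
- rewrite E4 -addeA [X in _ + X]addeC addeA.
  have h := energy_sqdiff mH H0 HE fmu fnu; rewrite -/(sqdiff mu nu) in h.
  have := h; have := energy_fin_num mH H0 HE fmu fmu; have := energy_fin_num mH H0 HE fnu fnu.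
  have := energy_fin_num mH H0 HE fmu fnu; have := sqdiff_ge0 M H mu nu; rewrite -/(sqdiff mu nu).
  case: (energy mu mu) => [a| |]//; case: (energy nu nu) => [b| |]//; case: (energy mu nu) => [c| |]//.
  case: (sqdiff mu nu) => [s| |]// _ _ _ _.
  rewrite -!EFinM -!EFinD => -[E]; congr EFin.
  by lra.
Qed.

(** [rho] is [mu] conditioned on [B]. The kernel is nonnegative, so restricting either argument
    lowers the energy, and normalizing both contributes the factor [m ^+ 2]. *)
Lemma restrict_normalize A mu (B : set X) (m : R) : measurable B ->
  Eplus_on alpha A mu -> (0 < m)%R -> mu B = m%:E ->
  exists rho, [/\ Eplus1_on alpha (A `&` B) rho,
    (forall f, measurable_fun setT f -> (forall x, 0 <= f x) ->
       \int[rho]_x f x = (m^-1)%:E * \int[mu]_(x in B) f x) &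
    (m ^+ 2)%:E * energy rho rho <= energy mu mu].
Proof.
move=> mB [[pmu emu] [N [mN N0 AN]]] m0 muB.
have smu := pos_radon_sigma_finite pmu.
have [r1 [r1E r1I]] := restricted_measure mu mB.
have m1 : (0 <= m^-1)%R by rewrite invr_ge0 ltW.
have [rho [rhoE rhoI]] := scaled_measure r1 m1.
have rho1 : rho setT = 1.
  by rewrite rhoE r1E setTI muB -EFinM mulVf// gt_eqF.
have srho : sigma_finite setT rho by exact: sigma_finite_mass1.
have rI f : measurable_fun setT f -> (forall x, 0 <= f x) ->
       \int[rho]_x f x = (m^-1)%:E * \int[mu]_(x in B) f x.
  by move=> mf f0; rewrite rhoI// r1I.
have le th : sigma_finite setT th -> energy rho th <= (m^-1)%:E * energy mu th.
  move=> sth; rewrite /energy rI.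
  - apply: lee_wpmul2l; first by rewrite lee_fin.
    apply: ge0_subset_integral => //; first exact: (measurable_potential mH H0 HE sth).
    by move=> x _; exact: potential_ge0.
  - exact: (measurable_potential mH H0 HE sth).
  - by move=> x; exact: potential_ge0.
have E2 : (m ^+ 2)%:E * energy rho rho <= energy mu mu.
  have h1 := le rho srho; have h2 := le mu smu.
  rewrite (energyC mH H0 HE smu srho) in h1.
  have h3 : energy rho rho <= (m^-1)%:E * ((m^-1)%:E * energy mu mu).
    by apply: le_trans h1 _; apply: lee_wpmul2l => //; rewrite lee_fin.
  apply: le_trans (lee_wpmul2l _ h3) _; first by rewrite lee_fin sqr_ge0.
  by rewrite !muleA -!EFinM expr2 mulfK ?gt_eqF// mulfV ?gt_eqF// mul1e.
exists rho; split=> //.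
split=> //; split; first split.
- by apply: pos_radon_finite => //; rewrite rho1 ltry.
- have := E2; have := energy_ge0 alpha rho rho; case: (energy rho rho) => [r| |]//; first by rewrite ltry.
  by rewrite gt0_muley ?lte_fin ?exprn_gt0// => _ /le_lt_trans /(_ emu).
- exists (N `|` ~` B); split; first by apply: measurableU => //; exact: measurableC.
    rewrite rhoE r1E setIUl setICl setU0.
    apply/eqP; rewrite eq_le; apply/andP; split; last by rewrite mule_ge0 ?lee_fin.
    rewrite (_ : mu _ = 0) ?mule0//.
    by apply/eqP; rewrite eq_le measure_ge0 andbT -N0 le_measure ?inE//; exact: measurableI.
  move=> x /not_andP [nA|nB]; [left; exact: AN|by right].
Qed.

End carried_measures.

(** * Tightness *)

Lemma integral_null_set d (T : measurableType d) (R : realType)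
    (mu : {measure set T -> \bar R}) (D : set T) (f : T -> \bar R) :
  measurable D -> mu D = 0%E -> (\int[mu]_(x in D) f x = 0)%E.
Proof.
move=> mD D0; rewrite (@eq_measure_integral _ _ _ _ mzero) ?integral_measure_zero// => A mA AD.
have : (mu A <= mu D)%E by rewrite le_measure ?inE.
by rewrite D0 => h; apply/eqP; rewrite eq_le measure_ge0 andbT.
Qed.

Section tightness.
Variables (R : realType) (n : nat) (alpha : R).
Local Notation Rn := 'rV[R]_n.
Local Notation X := (borelRn R n).
Local Notation posmeas := {measure set X -> \bar R}.
Context d (Z : measurableType d) (M : {sigma_finite_measure set Z -> \bar R}).
Variable H : Rn -> Z -> R.
Hypotheses
  (mH : measurable_fun setT (fun p : X * Z => H p.1 p.2))
  (H0 : forall x z, 0 <= H x z)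
  (HE : forall x y, (\int[M]_z (H x z * H y z)%:E = riesz_kernel alpha x y)%E)
  (alpha_lt_n : alpha < n%:R).
Implicit Types (mu nu th rho : posmeas) (A : set Rn).
Local Notation energy := (energy alpha).
Local Notation sqdiff := (sqdiff M H).
Local Notation cb := (@cball R n).
Local Open Scope ereal_scope.

Lemma measurable_riesz_kernel (x : Rn) :
  measurable_fun setT (riesz_kernel alpha x : X -> \bar R).
Proof.
have -> : (riesz_kernel alpha x : X -> \bar R) = fun y => \int[M]_z (H x z * H y z)%:E.
  by apply/funext => y; rewrite HE.
apply: (@measurable_integral2 _ _ X Z R M _ (fun p => (H x p.2 * H p.1 p.2)%:E)).
- exact: (@sigma_finiteT _ _ _ M).
- have mf : measurable_fun setT (fun p : X * Z => (x : X, p.2)).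
    by apply: measurable_fun_pair => //; exact: measurable_cst.
  by apply/measurable_EFinP; apply: measurable_funM => //; exact: (measurableT_comp mH mf).
- by move=> p; rewrite lee_fin mulr_ge0.
Qed.

Lemma inner_capacity_lty_ge A : inner_capacity alpha A < +oo ->
  exists2 w : R, (0 < w)%R & forall mu, Eplus1_on alpha A mu -> w%:E <= energy mu mu.
Proof.
rewrite /inner_capacity; set I := ereal_inf _ => hI.
have I0 : 0 <= I by apply: le_ereal_inf_tmp => _ [mu _ <-]; exact: energy_ge0.
have lb mu : Eplus1_on alpha A mu -> I <= energy mu mu.
  by move=> Amu; apply: ereal_inf_lbound; exists mu.
move: I0 hI lb; case: I => [r| |]// r0 hI lb.
- exists r; last exact: lb.
  rewrite lt_neqAle eq_sym; apply/andP; split; last by rewrite -lee_fin.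
  by apply/eqP => E; move: hI; rewrite E inve0 ltxx.
- exists 1%R => // mu /lb; rewrite leye_eq => /eqP ->; exact: leey.
Qed.

Lemma powR_npos_le (a b p : R) : (0 < a)%R -> (a <= b)%R -> (p <= 0)%R ->
  (b `^ p <= a `^ p)%R.
Proof.
move=> a0 ab p0; rewrite -(opprK p) !(powRN _ (- p)) lef_pV2 ?posrE ?powR_gt0//.
  by apply: ge0_ler_powR; rewrite ?nnegrE ?oppr_ge0 ?(ltW a0)// (le_trans _ ab)// ltW.
by rewrite (lt_le_trans a0).
Qed.

Lemma riesz_kernel_far (S e : R) : (0 < e)%R -> exists2 r : R, (S <= r)%R &
  forall x y : Rn, (`|x| <= S)%R -> (r < `|y|)%R -> riesz_kernel alpha x y <= e%:E.
Proof.
move=> e0; have p0 : (alpha - n%:R < 0)%R by rewrite subr_lt0.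
(* The distance at which the kernel equals [e]. *)
pose t := (e `^ ((alpha - n%:R)^-1))%R.
have t0 : (0 < t)%R by exact: powR_gt0.
exists (S + t)%R => [|x y xS yr]; first by rewrite lerDl ltW.
have xy : (t <= `|x - y|)%R.
  by rewrite distrC; have := lerB_dist y x; lra.
have ne : x != y.
  by apply/eqP => E; move: xy; rewrite E subrr normr0 leNgt t0.
rewrite /riesz_kernel (negPf ne) lee_fin.
have -> : e = (t `^ (alpha - n%:R))%R.
  by rewrite /t -powRrM mulVf ?lt_eqF// powRr1// ltW.
apply: powR_npos_le => //; last exact: ltW.
by apply: le_trans xy _; exact: norm_le_enorm.
Qed.

Lemma integral_tail mu (f : X -> \bar R) (e : R) : (0 < e)%R -> measurable_fun setT f ->
  (forall x, 0 <= f x) -> \int[mu]_x f x < +oo ->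
  exists k : nat, \int[mu]_(x in ~` cb k%:R) f x <= e%:E.
Proof.
move=> e0 mf f0 fin.
have split k : \int[mu]_x f x = \int[mu]_(x in cb k%:R) f x + \int[mu]_(x in ~` cb k%:R) f x.
  rewrite -ge0_integral_setU//.
  - by rewrite setUv.
  - exact: measurable_cball.
  - by apply: measurableC; exact: measurable_cball.
  - by rewrite setUv.
  - by rewrite disj_set2E setICr.
have fin_num D : measurable D -> \int[mu]_(x in D) f x \is a fin_num.
  move=> mD; rewrite ge0_fin_numE; last exact: integral_ge0.
  by apply: le_lt_trans fin; apply: ge0_subset_integral.
have : \int[mu]_(x in cb k%:R) f x @[k --> \oo] --> \int[mu]_(x in \bigcup_k cb k%:R) f x.
  apply: ge0_nondecreasing_set_cvg_integral => //.
  - by move=> i j ij; apply/subsetPset => x /= xi; rewrite /cball/= (le_trans xi)// ler_nat.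
  - by move=> k; exact: measurable_cball.
  - by move=> k; exact: measurable_funTS.
rewrite bigcup_cball => cv.
have F := fin_num setT measurableT.
move: cv; rewrite -(fineK F) => /fine_cvgP[_ /cvgrPdist_le /(_ e e0)].
case=> N _ /(_ N (leqnn N)) /= hN; exists N.
have mB := @measurable_cball R n N%:R.
have := split N; have := fin_num _ mB; have := fin_num _ (measurableC mB).
move: F hN; case: (\int[mu]_x f x) => [a| |]// _.
case: (\int[mu]_(x in cb N%:R) f x) => [b| |]//.
case: (\int[mu]_(x in ~` cb N%:R) f x) => [c| |]// /= h _ _ [E].
by rewrite lee_fin; move: h; rewrite E ler_norml => /andP[_]; lra.
Qed.

(** [mu] is cut at a large ball. The inner part sees [nu] only at distances where the kernel is
    small; the outer part has small energy, because the potential of [mu] is [mu]-integrable, and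
    Young's inequality against the bounded energy of [nu] controls the rest. *)
Lemma energy_far mu (L e : R) : (0 <= L)%R -> (0 < e)%R ->
  finite_self_energy alpha mu -> mu setT = 1 ->
  exists r : R, forall nu, sigma_finite setT nu -> nu setT = 1 ->
    nu (cb r) = 0 -> energy nu nu <= L%:E -> energy mu nu <= e%:E.
Proof.
move=> L0 e0 [smu emu] mu1.
have mpot th : sigma_finite setT th -> measurable_fun setT (potential alpha th : X -> \bar R).
  by move=> sth; exact: (measurable_potential mH H0 HE sth).
(* Both terms of Young's inequality, [t^-1] times the energy of the outer part and [t] times that of
   [nu], are then at most [e / 2]; [L + 1] avoids a zero denominator. *)
pose t := (e / 2 / (L + 1))%R.
have t0 : (0 < t)%R by rewrite divr_gt0 ?divr_gt0// ltr_wpDl.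
have te0 : (0 < t * (e / 2))%R by rewrite mulr_gt0// divr_gt0.
have [k tailk] := integral_tail te0 (mpot _ smu) (potential_ge0 alpha mu) emu.
have e20 : (0 < e / 2)%R by rewrite divr_gt0.
have [r kr hr] := riesz_kernel_far k%:R e20.
exists r => nu snu nu1 nur nuL.
have mB := @measurable_cball R n k%:R; have mBC := measurableC mB.
have [rho [rhoE rhoI]] := restricted_measure mu mBC.
have srho : sigma_finite setT rho.
  apply: fin_num_fun_sigma_finite; first by rewrite measure0 ltry.
  move=> C mC; rewrite rhoE ge0_fin_numE//.
  by rewrite (@le_lt_trans _ _ (mu setT)) ?mu1 ?ltry// -mu1 le_measure ?inE//; exact: measurableI.
have rho_le th : sigma_finite setT th -> energy rho th <= energy mu th.
  move=> sth; rewrite /Defs.energy rhoI//; [|exact: mpot|by move=> x; exact: potential_ge0].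
  by apply: ge0_subset_integral => //; [exact: mpot|by move=> x _; exact: potential_ge0].
have -> : energy mu nu = \int[mu]_(x in cb k%:R) potential alpha nu x + energy rho nu.
  rewrite {2}/Defs.energy rhoI; [|exact: mpot|by move=> x; exact: potential_ge0].
  rewrite -ge0_integral_setU//.
  - by rewrite setUv.
  - by rewrite setUv; exact: mpot.
  - by move=> x _; exact: potential_ge0.
  - by rewrite disj_set2E setICr.
rewrite (splitr e) EFinD; apply: leeD.
  apply: (@le_trans _ _ (\int[mu]_(x in cb k%:R) (cst (e / 2)%:E) x)).
    apply: ge0_le_integral => //.
    - by move=> x _; exact: potential_ge0.
    - by apply: measurable_funTS; exact: mpot.
    - move=> x /= xk; rewrite /potential.
      have mr := @measurable_cball R n r; have mrC := measurableC mr.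
      have mk := measurable_riesz_kernel x.
      rewrite -(setUv (cb r)) ge0_integral_setU//.
      + rewrite integral_null_set// add0e.
        apply: (@le_trans _ _ (\int[nu]_(y in ~` cb r) (cst (e / 2)%:E) y)).
          apply: ge0_le_integral => //.
          * by move=> y _; exact: riesz_kernel_ge0.
          * exact: measurable_funTS.
          * by move=> y /negP; rewrite -ltNge => yr; exact: hr.
        rewrite integral_cst// -[leRHS]mule1; apply: lee_wpmul2l; first by rewrite lee_fin ltW.
        by rewrite -nu1 le_measure ?inE.
      + by rewrite setUv.
      + by move=> y _; exact: riesz_kernel_ge0.
      + by rewrite disj_set2E setICr.
  rewrite integral_cst// -[leRHS]mule1; apply: lee_wpmul2l; first by rewrite lee_fin ltW.
  by rewrite -mu1 le_measure ?inE.
have ti0 : (0 < t^-1)%R by rewrite invr_gt0.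
have := energy_young mH H0 HE ti0 srho snu; rewrite invrK.
have h1 : energy rho rho <= (t * (e / 2))%:E.
  apply: le_trans tailk; rewrite {1}/Defs.energy rhoI; [|exact: mpot|by move=> x; exact: potential_ge0].
  apply: ge0_le_integral => //.
  - by move=> x _; exact: potential_ge0.
  - by apply: measurable_funTS; exact: mpot.
  - by apply: measurable_funTS; exact: mpot.
  - move=> x _; rewrite /potential; apply: ge0_le_measure_integral => //.
    + by move=> C mC; rewrite rhoE le_measure ?inE//; exact: measurableI.
    + by move=> y; exact: riesz_kernel_ge0.
    + exact: measurable_riesz_kernel.
move=> /le_trans h2.
have h3 : (t^-1)%:E * energy rho rho <= (e / 2)%:E.
  apply: (@le_trans _ _ ((t^-1)%:E * (t * (e / 2))%:E)).
    by apply: lee_wpmul2l => //; rewrite lee_fin ltW.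
  by rewrite -EFinM mulKf// gt_eqF.
have h4 : t%:E * energy nu nu <= (e / 2)%:E.
  apply: (@le_trans _ _ (t%:E * L%:E)).
    by apply: lee_wpmul2l => //; rewrite lee_fin ltW.
  rewrite -EFinM lee_fin /t mulrAC ler_pdivrMr; last by rewrite ltr_wpDl.
  by apply: ler_wpM2l; [exact: ltW|rewrite lerDl].
have h5 : 2%:E * energy rho nu <= e%:E.
  by apply: h2; rewrite (splitr e) EFinD; exact: leeD.
by rewrite mulrC EFinM lee_pdivlMl.
Qed.

(* If the infima over the complements of balls stayed bounded, they would almost
   reach their supremum [W]; an almost minimizer [mu] outside [cb r0] and one
   [nu] much further away have an average of energy at least [W - w / 8], which
   contradicts the smallness of their mutual energy. *)
Lemma energy_tail A (L : R) : inner_capacity alpha A < +oo ->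
  exists r : R, forall mu, Eplus1_on alpha (A `&` ~` cb r) mu -> L%:E <= energy mu mu.
Proof.
move=> /inner_capacity_lty_ge[w w0 hw].
apply: contrapT => nr.
have ex (r : R) : exists mu, Eplus1_on alpha (A `&` ~` cb r) mu /\ energy mu mu < L%:E.
  apply: contrapT => nmu; apply: nr; exists r => mu Amu.
  by rewrite leNgt; apply/negP => h; apply: nmu; exists mu.
have sub A' A'' mu : A' `<=` A'' -> Eplus1_on alpha A' mu -> Eplus1_on alpha A'' mu.
  move=> AA [[emu [N [mN N0 AN]]] mu1]; split=> //; split=> //.
  by exists N; split=> // x nA; apply: AN => /AA.
pose E r : set R := [set fine (energy mu mu) | mu in Eplus1_on alpha (A `&` ~` cb r)].
have lbE r x : E r x -> (w <= x)%R.
  move=> [mu Amu <-]; rewrite -lee_fin fineK; first by apply: hw; exact: sub Amu.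
  by apply: (energy_fin_num mH H0 HE); exact: (Eplus1_finite_self_energy Amu).
pose v r := inf (E r).
have E_inf r : has_inf (E r).
  split; last by exists w => x; exact: lbE.
  by have [mu [Amu _]] := ex r; exists (fine (energy mu mu)); exists mu.
have v_lb r mu : Eplus1_on alpha (A `&` ~` cb r) mu -> (v r)%:E <= energy mu mu.
  move=> Amu; rewrite -[leRHS]fineK; last first.
    by apply: (energy_fin_num mH H0 HE); exact: (Eplus1_finite_self_energy Amu).
  by rewrite lee_fin; apply: ge_inf; [have [] := E_inf r|exists mu].
have v_adh r (e : R) : (0 < e)%R -> exists mu,
    Eplus1_on alpha (A `&` ~` cb r) mu /\ energy mu mu < (v r + e)%:E.
  move=> e0; have [_ [mu Amu <-] h] := inf_adherent e0 (E_inf r).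
  exists mu; split=> //; rewrite -[ltLHS]fineK ?lte_fin//.
  by apply: (energy_fin_num mH H0 HE); exact: (Eplus1_finite_self_energy Amu).
have vL r : (v r < L)%R.
  have [mu [Amu muL]] := ex r.
  by rewrite -lte_fin; apply: le_lt_trans muL; exact: v_lb.
have L0 : (0 <= L)%R.
  have [mu [Amu muL]] := ex 0%R; rewrite -lee_fin ltW//.
  by apply: le_lt_trans muL; exact: energy_ge0.
have Vsup : has_sup (range v).
  by split; [exists (v 0%R); exists 0%R|exists L => _ [r _ <-]; rewrite ltW].
pose W := sup (range v).
have vW r : (v r <= W)%R by apply: ub_le_sup; [have [] := Vsup|exists r].
have e0 : (0 < w / 8)%R by rewrite divr_gt0.
have [_ [r0 _ <-] r0W] := sup_adherent e0 Vsup.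
have [mu [Amu muv]] := v_adh r0 _ e0.
have w20 : (0 < w / 2)%R by rewrite divr_gt0.
have fmu := Eplus1_finite_self_energy Amu.
have L10 : (0 <= L + w / 8)%R by rewrite addr_ge0// ltW.
have [r hr] := energy_far L10 w20 fmu Amu.2.
pose r1 := Num.max r0 r.
have [nu [Anu nuv]] := v_adh r1 _ e0.
have fnu := Eplus1_finite_self_energy Anu.
have Anu0 : Eplus1_on alpha (A `&` ~` cb r0) nu.
  apply: sub Anu => x [Ax nx]; split=> // xr; apply: nx.
  by rewrite /cball/= (le_trans xr)// le_max lexx.
have nur : nu (cb r) = 0.
  have [[_ [N [mN N0 AN]]] _] := Anu.
  apply/eqP; rewrite eq_le measure_ge0 andbT -N0 le_measure ?inE//; first exact: measurable_cball.
  move=> x xr; apply: AN => -[_ nx]; apply: nx.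
  by rewrite /cball/= (le_trans xr)// le_max lexx orbT.
have munu := hr nu fnu.1 Anu.2 nur.
have {}munu : energy mu nu <= (w / 2)%:E.
  by apply: munu; rewrite ltW// (lt_trans nuv)// lte_fin ltrD2r vL.
have [rho [Arho _ _ par]] := Eplus1_average mH H0 HE alpha_lt_n Amu Anu0.
have h0 := v_lb _ _ Arho.
have frho := Eplus1_finite_self_energy Arho.
have AAmu : Eplus1_on alpha A mu by apply: sub Amu => x [].
have AAnu : Eplus1_on alpha A nu by apply: sub Anu => x [].
have h1 := hw _ AAmu; have h2 := hw _ AAnu.
have h3 := energy_sqdiff mH H0 HE fmu fnu.
have vr1 := vW r1; have vr0 := vW r0.
move: par h0 h1 h2 h3 muv nuv munu.
have := energy_fin_num mH H0 HE fmu fmu; have := energy_fin_num mH H0 HE fnu fnu.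
have := energy_fin_num mH H0 HE fmu fnu; have := energy_fin_num mH H0 HE frho frho.
have := sqdiff_ge0 M H mu nu; rewrite -/(sqdiff mu nu).
case: (energy mu mu) => [a| |]//; case: (energy nu nu) => [b| |]//; case: (energy mu nu) => [c| |]//.
case: (energy rho rho) => [q| |]//; case: (sqdiff mu nu) => [s| |]// _ _ _ _ _.
rewrite -!EFinM -!EFinD => -[p1] + + + [p2].
(* Both energies are below W + w/8, the mutual energy is at most w/2 and the midpoint has energy
   above W - w/8; expanding the midpoint energy gives W < 7w/8. But [mu] has energy at least w and
   below W + w/8, so W > 7w/8. *)
rewrite !lee_fin !lte_fin; move: r0W; rewrite -/W; lra.
Qed.

(** More than [e] of mass outside the ball, once normalized, would have energy at most B/e^2, below
    the level (B + 1)/e^2 guaranteed there. *)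
Theorem Eplus1_tight A (mu_ : nat -> posmeas) (B : R) : inner_capacity alpha A < +oo ->
  (forall k, Eplus1_on alpha A (mu_ k)) -> (forall k, energy (mu_ k) (mu_ k) <= B%:E) ->
  forall e : R, (0 < e)%R -> exists2 K : set Rn, compact K &
     forall k, mu_ k (~` K) <= e%:E.
Proof.
move=> capA Amu muB e e0.
have [r hr] := energy_tail ((B + 1) / e ^+ 2) capA.
exists (cb r); first exact: compact_cball.
move=> k; rewrite leNgt; apply/negP => ek.
have mC : measurable (~` cb r : set X) by apply: measurableC; exact: measurable_cball.
have [Ak mu1] := Amu k.
have mk1 : mu_ k (~` cb r) <= 1 by rewrite -mu1 le_measure ?inE.
have [m mE] : exists m : R, mu_ k (~` cb r) = m%:E.
  exists (fine (mu_ k (~` cb r))); rewrite fineK// ge0_fin_numE//.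
  by rewrite (le_lt_trans mk1)// ltry.
have em : (e < m)%R by rewrite -lte_fin -mE.
have [rho [Arho _ hrho]] := restrict_normalize mH H0 HE alpha_lt_n mC Ak (lt_trans e0 em) mE.
have h1 := hr _ Arho.
have : ((m ^+ 2)%:E * ((B + 1) / e ^+ 2)%:E <= B%:E).
  apply: le_trans (muB k); apply: le_trans hrho; apply: lee_wpmul2l => //.
  by rewrite lee_fin sqr_ge0.
have B0 : (0 <= B)%R by rewrite -lee_fin (le_trans _ (muB k))// energy_ge0.
rewrite -EFinM lee_fin leNgt => /negP; apply.
rewrite (@lt_le_trans _ _ (B + 1)%R)// ?ltrDl//.
rewrite mulrCA ler_peMr//; first by rewrite addr_ge0.
by rewrite ler_pdivlMr ?mul1r ?exprn_gt0// lerXn2r// ?nnegrE ltW// (lt_trans e0).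
Qed.

End tightness.

(** * Strong limits *)

Section jordan_difference.
Context d (T : measurableType d) (R : realType).
Local Open Scope ereal_scope.

Section finite_packing.
Variable mu : {measure set T -> \bar R}.
Hypothesis fmu : mu setT < +oo.

Let mu' : set T -> \bar R := mu.
HB.instance Definition _ := Measure.on mu'.
Let fin' : fin_num_fun mu'.
Proof.
move=> B mB; rewrite ge0_fin_numE//; apply: le_lt_trans fmu.
by rewrite le_measure ?inE.
Qed.
HB.instance Definition _ := Measure_isFinite.Build _ _ _ mu' fin'.

Lemma finite_packing :
  exists nu : {finite_measure set T -> \bar R}, forall B, nu B = mu B.
Proof. by exists mu'. Qed.

End finite_packing.

(** The Hahn decomposition of the charge [mu - nu]. The bounds by [mu] and [nu] let the two parts
    inherit finite mass and finite energy. *)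
Lemma jordan_difference (mu nu : {measure set T -> \bar R}) :
  mu setT < +oo -> nu setT < +oo ->
  exists (p q : {measure set T -> \bar R}) (P : set T),
    [/\ measurable P, p (~` P) = 0, q P = 0,
      (forall B, measurable B -> p B <= mu B /\ q B <= nu B) &
      forall B, measurable B -> p B + nu B = mu B + q B].
Proof.
move=> /finite_packing[m mE] /finite_packing[k kE].
pose c := cadd (charge_of_finite_measure m) (copp (charge_of_finite_measure k)).
have [P [N PN]] := Hahn_decomposition c.
have [[mP posP] [mN negN] PNT PN0] := PN.
have mfin B : measurable B -> mu B \is a fin_num by move=> mB; rewrite -mE fin_num_measure.
have kfin B : measurable B -> nu B \is a fin_num by move=> mB; rewrite -kE fin_num_measure.
have cE B : c B = mu B - nu B by rewrite -mE -kE.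
pose p : {measure set T -> \bar R} := jordan_pos PN.
pose q : {measure set T -> \bar R} := jordan_neg PN.
have pE B : measurable B -> p B = mu (B `&` P) - nu (B `&` P).
  by move=> mB; rewrite /p/= jordan_posE cjordan_posE /crestr0 mem_set//; exact: cE.
have qE B : measurable B -> q B = nu (B `&` N) - mu (B `&` N).
  move=> mB; rewrite /q/= jordan_negE cjordan_negE /crestr0 mem_set//.
  rewrite (_ : crestr _ _ _ = mu (B `&` N) - nu (B `&` N)); last exact: cE.
  by rewrite fin_num_oppeB ?kfin ?mfin// 1?addeC//; exact: measurableI.
have le (la : {measure set T -> \bar R}) B C : measurable B -> measurable C -> la (B `&` C) <= la B.
  by move=> mB mC; rewrite le_measure ?inE//; exact: measurableI.
have split (la : {measure set T -> \bar R}) B : measurable B -> la B = la (B `&` P) + la (B `&` N).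
  move=> mB; rewrite -measureU//; [|exact: measurableI|exact: measurableI|].
    by rewrite -setIUr PNT setIT.
  by rewrite setIACA PN0 setI0.
exists p, q, P; split=> //.
- rewrite pE; last exact: measurableC.
  by rewrite setICl !measure0 sube0.
- by rewrite qE// PN0 !measure0 sube0.
- move=> B mB; rewrite pE// qE//; split.
    by apply: le_trans (le mu B P mB mP); rewrite leeBlDr ?kfin ?leeDl//; exact: measurableI.
  by apply: le_trans (le nu B N mB mN); rewrite leeBlDr ?mfin ?leeDl//; exact: measurableI.
- move=> B mB; rewrite pE// qE// (split mu B mB) (split nu B mB).
  have := mfin _ (measurableI _ _ mB mP); have := mfin _ (measurableI _ _ mB mN).
  have := kfin _ (measurableI _ _ mB mP); have := kfin _ (measurableI _ _ mB mN).
  case: (mu (B `&` P)) => [a| |]//; case: (mu (B `&` N)) => [b| |]//.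
  case: (nu (B `&` P)) => [a'| |]//; case: (nu (B `&` N)) => [b'| |]// _ _ _ _.
  by rewrite -!EFinB -!EFinD -?EFinD; congr EFin; ring.
Qed.

Lemma fatou_bound (mu : {measure set T -> \bar R}) (f_ : nat -> T -> \bar R)
    (f : T -> \bar R) (c : \bar R) :
  (forall k, measurable_fun setT (f_ k)) -> measurable_fun setT f ->
  (forall k x, 0 <= f_ k x) -> (forall x, 0 <= f x) ->
  {ae mu, forall x, f_ ^~ x @ \oo --> f x} ->
  (forall k, \int[mu]_x f_ k x <= c) -> \int[mu]_x f x <= c.
Proof.
move=> mf_ mf f_0 f0 cvf hc.
have -> : \int[mu]_x f x = \int[mu]_x limn_einf (f_^~ x).
  apply: ge0_ae_eq_integral => //.
  - apply: (emeasurable_fun_cvg (fun k x => einfs (f_^~ x) k)).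
      by move=> k; exact: measurable_fun_einfs.
    by move=> x _; rewrite limn_einf_lim; exact: is_cvg_einfs.
  - by move=> x _; rewrite limn_einf_lim; apply: lime_ge => //; [exact: is_cvg_einfs|];
      apply: nearW => k; apply: le_ereal_inf_tmp => _ [i _ <-].
  apply: filterS cvf => x cx _.
  by rewrite is_cvg_limn_einfE; [exact/esym/cvg_lim|apply/cvg_ex; exists (f x)].
apply: (le_trans (fatou mu measurableT mf_ _)) => //.
rewrite limn_einf_lim; apply: lime_le; first exact: is_cvg_einfs.
apply: nearW => k; apply: le_trans (hc k).
by apply: ereal_inf_lbound; exists k => //=.
Qed.

End jordan_difference.

(** * Strong completeness *)

Section completeness.
Variables (R : realType) (n : nat) (alpha : R).
Local Notation Rn := 'rV[R]_n.
Local Notation X := (borelRn R n).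
Local Notation posmeas := {measure set X -> \bar R}.
Context d (Z : measurableType d) (M : {sigma_finite_measure set Z -> \bar R}).
Variable H : Rn -> Z -> R.
Hypotheses
  (cH : forall z, continuous (H^~ z))
  (mH : measurable_fun setT (fun p : X * Z => H p.1 p.2))
  (bH : forall z, exists C, forall x, 0 <= H x z <= C)
  (HE : forall x y, (\int[M]_z (H x z * H y z)%:E = riesz_kernel alpha x y)%E)
  (alpha_lt_n : alpha < n%:R).
Implicit Types (mu nu th rho : posmeas) (A : set Rn).
Local Notation energy := (energy alpha).
Local Notation sqdiff := (sqdiff M H).
Local Notation transform := (transform H).
Local Open Scope ereal_scope.

Let H0 x z : (0 <= H x z)%R.
Proof. by have [C /(_ x)/andP[]] := bH z. Qed.

Lemma transform_fin_num mu z : mu setT < +oo -> transform mu z \is a fin_num.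
Proof.
move=> mufin; rewrite ge0_fin_numE; last by apply: transform_ge0.
have [C hC] := bH z.
apply: (@le_lt_trans _ _ (\int[mu]_x (cst C%:E) x)).
  apply: ge0_le_integral => //.
  - by move=> x _; rewrite lee_fin.
  - exact: (measurable_H1 mH).
  - by move=> x _; rewrite lee_fin; have /andP[] := hC x.
rewrite integral_cst// lte_mul_pinfty// lee_fin.
by have /andP[h1 h2] := hC 0%R; exact: le_trans h2.
Qed.

Lemma energyE_fine mu nu : mu setT < +oo -> nu setT < +oo ->
  sigma_finite setT mu -> sigma_finite setT nu ->
  energy mu nu = \int[M]_z (fine (transform mu z) * fine (transform nu z))%R%:E.
Proof.
move=> fmu fnu smu snu; rewrite (energyE mH H0 HE smu snu).
by apply: eq_integral => z _; rewrite EFinM !fineK// transform_fin_num.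
Qed.

(** The bridge between the norm of signed measures and [sqdiff]: passing from [mu], [nu] to the
    Jordan parts does not change the difference of the transforms, and all four transforms are
    finite. *)
Lemma signed_difference mu nu : mu setT < +oo -> nu setT < +oo ->
  energy mu mu < +oo -> energy nu nu < +oo ->
  exists s : signed_radon n alpha,
    is_difference s mu nu /\ senergy s s = sqdiff mu nu.
Proof.
move=> fmu fnu emu enu.
have [p [q [P [mP pP qP le pq]]]] := jordan_difference fmu fnu.
have fp : p setT < +oo by apply: le_lt_trans fmu; have [] := le setT measurableT.
have fq : q setT < +oo by apply: le_lt_trans fnu; have [] := le setT measurableT.
have rp := pos_radon_finite alpha_lt_n fp; have rq := pos_radon_finite alpha_lt_n fq.
exists (SignedRadon rp rq (ex_intro2 _ _ P mP (conj pP qP))); split; first exact: pq.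
have sp := pos_radon_sigma_finite rp; have sq := pos_radon_sigma_finite rq.
have smu := pos_radon_sigma_finite (pos_radon_finite alpha_lt_n fmu).
have snu := pos_radon_sigma_finite (pos_radon_finite alpha_lt_n fnu).
have le_energy (la la' : posmeas) : sigma_finite setT la -> sigma_finite setT la' ->
    (forall B, measurable B -> la B <= la' B) -> energy la la <= energy la' la'.
  move=> sla sla' h; rewrite (energyE mH H0 HE sla sla) (energyE mH H0 HE sla' sla').
  apply: ge0_le_integral => //.
  - by move=> z _; exact: transformM_ge0.
  - exact: (measurable_transformM mH H0).
  - exact: (measurable_transformM mH H0).
  - move=> z _; have h1 : transform la z <= transform la' z.
      apply: ge0_le_measure_integral => //; last exact: (measurable_H1 mH).
      by move=> x; rewrite lee_fin.
    by apply: lee_pmul => //; exact: transform_ge0.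
have ep : energy p p < +oo.
  by apply: le_lt_trans emu; apply: le_energy => // B /le[].
have eq' : energy q q < +oo.
  by apply: le_lt_trans enu; apply: le_energy => // B /le[].
have fsp : finite_self_energy alpha p by [].
have fsq : finite_self_energy alpha q by [].
have := energy_sqdiff mH H0 HE fsp fsq.
rewrite /senergy /senergy_pos /senergy_neg /= => ->.
rewrite (energyC mH H0 HE sq sp).
have -> : energy p q + energy p q = 2%:E * energy p q.
  by rewrite -mule2n mule_natl.
rewrite addeK; last first.
  by rewrite fin_numM// (energy_fin_num mH H0 HE).
apply: eq_integral => z _; congr ((_ ^+ 2)%R%:E).
have E : transform p z + transform nu z = transform mu z + transform q z.
  rewrite -!ge0_integral_measure_add//; do ?[by move=> x _; rewrite lee_fin|exact: (measurable_H1 mH)].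
  apply: eq_measure_integral => B mB _.
  rewrite [LHS](measure_addE p nu) [RHS](measure_addE mu q); exact: pq.
move: E; have := transform_fin_num z fp; have := transform_fin_num z fq.
have := transform_fin_num z fmu; have := transform_fin_num z fnu.
case: (transform p z) => [a| |]//; case: (transform q z) => [b| |]//.
case: (transform mu z) => [a'| |]//; case: (transform nu z) => [b'| |]// _ _ _ _.
by rewrite -!EFinD => -[E] /=; lra.
Qed.

(** Here strong closedness of the class enters: [A] need not be closed, so weak convergence could
    not show that the limit is carried by it. *)
Lemma Eplus_on_strong_limit A mu (mu_ : nat -> posmeas) :
  Eplus_strongly_closed alpha A -> mu setT = 1 -> energy mu mu < +oo ->
  (forall k, Eplus1_on alpha A (mu_ k)) ->
  (forall e : R, (0 < e)%R -> exists k, sqdiff mu (mu_ k) < e%:E) ->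
  Eplus_on alpha A mu.
Proof.
move=> closedA mu1 emu Amu_ cvg.
have mufin : mu setT < +oo by rewrite mu1 ltry.
apply: closedA; first by split=> //; exact: pos_radon_finite.
move=> e e0; have e20 : (0 < e ^+ 2)%R by rewrite exprn_gt0.
have [k hk] := cvg _ e20.
have [[Ek Ak] muk1] := Amu_ k.
have [|s [ds es]] := signed_difference mufin _ emu Ek.2; first by rewrite muk1 ltry.
exists (mu_ k), s; split=> //.
rewrite /energy_norm es -[ltRHS](@ger0_norm _ e) ?(ltW e0)// -sqrtr_sqr ltr_sqrt//.
have := sqdiff_ge0 M H mu (mu_ k); rewrite -/(sqdiff mu (mu_ k)); move: hk.
by case: (sqdiff mu (mu_ k)) => [r| |]//=; rewrite lte_fin.
Qed.

(* The test functions [H(., z)] and [C - H(., z)] are both nonnegative and continuous. *)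
Lemma transform_weak_limit mu (mu_ : nat -> posmeas) z (u : R) :
  mu setT = 1 -> (forall k, mu_ k setT = 1) ->
  (forall g : Rn -> \bar R, (forall x, 0 <= g x) -> lsc g ->
    forall c N, (forall k, (N <= k)%N -> \int[mu_ k]_x g x <= c) ->
      \int[mu]_x g x <= c) ->
  fine (transform (mu_ k) z) @[k --> \oo] --> u -> fine (transform mu z) = u.
Proof.
move=> mu1 mu_1 lim cu.
have [C hC] := bH z.
have fmu : transform mu z \is a fin_num by apply: transform_fin_num; rewrite mu1 ltry.
have fmu_ k : transform (mu_ k) z \is a fin_num by apply: transform_fin_num; rewrite mu_1 ltry.
have l1 : lsc (fun x => (H x z)%:E).
  move=> a; have -> : [set x | a%:E < (H x z)%:E] = (H^~ z) @^-1` [set t | (a < t)%R].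
    by apply/seteqP; split=> x /=; rewrite lte_fin.
  by apply: open_comp; [move=> x _; exact: cH|exact: open_gt].
have l2 : lsc (fun x => (C - H x z)%R%:E).
  move=> a; have -> : [set x | a%:E < (C - H x z)%:E] = (H^~ z) @^-1` [set t | (t < C - a)%R].
    by apply/seteqP; split=> x /=; rewrite lte_fin; lra.
  by apply: open_comp; [move=> x _; exact: cH|exact: open_lt].
have cint (la : posmeas) : la setT = 1 -> transform la z \is a fin_num ->
    \int[la]_x (C - H x z)%:E = (C - fine (transform la z))%:E.
  move=> la1 fla; under eq_integral do rewrite EFinB.
  rewrite integralB//.
  - by rewrite integral_cst// la1 mule1 EFinB fineK.
  - apply/integrableP; split; first exact: measurable_cst.
    by rewrite /= integral_cst// la1 mule1 ltry.
  - apply/integrableP; split; first exact: (measurable_H1 mH).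
    under eq_integral do rewrite gee0_abs ?lee_fin//.
    by have := fla; rewrite ge0_fin_numE// transform_ge0.
apply/eqP; rewrite eq_le; apply/andP; split.
  apply/ler_addgt0Pr => e e0.
  rewrite -lee_fin fineK//.
  have /cvgrPdist_le /(_ e e0)[N _ hN] := cu.
  apply: (lim _ _ l1 _ N) => [x|k Nk]; first by rewrite lee_fin.
  rewrite -/(transform (mu_ k) z) -(fineK (fmu_ k)) lee_fin.
  by have := hN k Nk; rewrite /= ler_norml => /andP[]; lra.
apply/ler_addgt0Pr => e e0.
have /cvgrPdist_le /(_ e e0)[N _ hN] := cu.
have : \int[mu]_x (C - H x z)%:E <= (C - (u - e))%:E.
  apply: (lim _ _ l2 _ N) => [x|k Nk]; first by rewrite lee_fin subr_ge0; have /andP[] := hC x.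
  rewrite cint// lee_fin.
  by have := hN k Nk; rewrite /= ler_norml => /andP[]; lra.
by rewrite cint// lee_fin; lra.
Qed.

(** Since |b| <= 2^k b^2 + 2^(-k), the increments are absolutely summable. *)
Lemma summable_sq_increments_cvg (a : nat -> R) :
  \sum_(k <oo) (2 ^+ k * (a k.+1 - a k) ^+ 2)%R%:E < +oo ->
  exists u : R, a @ \oo --> u.
Proof.
move=> fin.
have h0 k : 0 <= (2 ^+ k * (a k.+1 - a k) ^+ 2)%R%:E.
  by rewrite lee_fin mulr_ge0 ?sqr_ge0// exprn_ge0.
have c1 : cvgn (series (fun k => 2 ^+ k * (a k.+1 - a k) ^+ 2)%R).
  apply: nondecreasing_is_cvgn.
    by apply: nondecreasing_series => k _ _; rewrite -lee_fin.
  exists (fine (\sum_(k <oo) (2 ^+ k * (a k.+1 - a k) ^+ 2)%R%:E)) => _ [k _ <-].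
  rewrite -lee_fin fineK; last by rewrite ge0_fin_numE// nneseries_ge0.
  rewrite seriesEnat/= -sumEFin.
  by apply: nneseries_lim_ge => *.
have c2 : cvgn (series (geometric 1 (2^-1) : nat -> R)).
  by apply: is_cvg_geometric_series; rewrite ger0_norm// invf_lt1// ltr1n.
have c3 : cvgn [normed series (fun k => a k.+1 - a k)%R].
  apply: (@series_le_cvg _ _ (fun k => 2 ^+ k * (a k.+1 - a k) ^+ 2 + geometric 1 (2^-1) k)%R).
  - by move=> k; exact: normr_ge0.
  - by move=> k; apply: addr_ge0; [rewrite -lee_fin; exact: h0|rewrite geometric_ge0// invr_ge0].
  - move=> k /=; set b := (a k.+1 - a k)%R;
    have t0 : (0 < 2 ^+ k :> R)%R by rewrite exprn_gt0.
    rewrite exprVn mul1r -(real_normK (num_real b)).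
    set t := (2 ^+ k)%R; have -> : (t * `|b| ^+ 2 + t^-1 = `|b| + t * ((`|b| - t^-1 / 2) ^+ 2 + 3 / 4 * t^-1 ^+ 2))%R.
      by field; rewrite gt_eqF.
    by rewrite lerDl mulr_ge0 ?(ltW t0)// addr_ge0 ?sqr_ge0// mulr_ge0 ?sqr_ge0.
  - have -> : series (fun k => 2 ^+ k * (a k.+1 - a k) ^+ 2 + geometric 1 (2^-1) k)%R =
        (series (fun k => 2 ^+ k * (a k.+1 - a k) ^+ 2) + series (geometric 1 (2^-1)))%R.
      by rewrite -seriesD.
    exact: is_cvgD.
have /cvg_ex[l cl] := normed_cvg c3.
exists (a 0%N + l)%R.
have E : (fun k => a 0%N + series (fun k => a k.+1 - a k) k)%R = a.
  by apply/funext => k; rewrite [RHS]eq_sum_telescope.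
by rewrite -[X in X @ _ --> _]E; apply: cvgD => //; exact: cvg_cst.
Qed.

(** As in the proof that L^2 is complete: the rate 4^(-k) leaves the squared increments of the
    transforms summable with weights 2^k, so the transforms converge almost everywhere, and
    boundedness and continuity of the features identify the limit with the transform of the weak
    limit. Fatou's lemma then gives both bounds. *)
Theorem strong_limit (mu_ : nat -> posmeas) (B : R) :
  (forall k, mu_ k setT = 1) -> (forall k, energy (mu_ k) (mu_ k) <= B%:E) ->
  (forall e : R, (0 < e)%R -> exists2 K : set Rn, compact K &
     forall k, mu_ k (~` K) <= e%:E) ->
  (forall k l, (k <= l)%N -> sqdiff (mu_ k) (mu_ l) <= ((4 ^+ k)^-1)%:E) ->
  exists mu, [/\ mu setT = 1, energy mu mu <= B%:E,
    (forall k, sqdiff mu (mu_ k) <= ((4 ^+ k)^-1)%:E) &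
    forall g : Rn -> \bar R, (forall x, 0 <= g x) -> lsc g ->
      forall c N, (forall k, (N <= k)%N -> \int[mu_ k]_x g x <= c) ->
      \int[mu]_x g x <= c].
Proof.
move=> mu_1 mu_B tight cauchy.
have [mu mu1 lim] := tight_seq_limit mu_1 tight.
have fmu z : transform mu z \is a fin_num by apply: transform_fin_num; rewrite mu1 ltry.
have fmu_ k z : transform (mu_ k) z \is a fin_num by apply: transform_fin_num; rewrite mu_1 ltry.
have smu := sigma_finite_mass1 mu1; have smu_ k := sigma_finite_mass1 (mu_1 k).
pose a k z := fine (transform (mu_ k) z); pose b z := fine (transform mu z).
have ma k : measurable_fun setT (a k).
  by apply: measurableT_comp => //; exact: (measurable_transform mH H0).
have mb : measurable_fun setT b.
  by apply: measurableT_comp => //; exact: (measurable_transform mH H0).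
have ae_cvg : {ae M, forall z, a ^~ z @ \oo --> b z}.
  pose inc k z := (2 ^+ k * (a k.+1 z - a k z) ^+ 2)%R%:E.
  have inc0 k z : 0 <= inc k z by rewrite lee_fin mulr_ge0 ?sqr_ge0// exprn_ge0.
  have minc k : measurable_fun setT (inc k).
    apply/measurable_EFinP; apply: measurable_funM => //.
    by apply: measurable_funX; exact: measurable_funB.
  have fin : \int[M]_z (\sum_(k <oo) inc k z) < +oo.
    rewrite integral_nneseries//.
    apply: (@le_lt_trans _ _ (\sum_(k <oo) (geometric 1 (2^-1) k : R)%:E)).
      apply: lee_nneseries => [k _ _|k _]; first exact: integral_ge0.
      rewrite /inc; under eq_integral do rewrite EFinM.
      rewrite ge0_integralZl//; last 2 first.
      - by apply/measurable_EFinP; apply: measurable_funX; exact: measurable_funB.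
      - by move=> z _; rewrite lee_fin sqr_ge0.
      have h := cauchy k k.+1 (leqnSn k); rewrite sqdiffC in h.
      apply: (@le_trans _ _ ((2 ^+ k)%:E * ((4 ^+ k)^-1)%:E)).
        by apply: lee_wpmul2l => //; rewrite lee_fin exprn_ge0.
      rewrite -EFinM lee_fin /= mul1r exprVn.
      have -> : (4 = 2 * 2 :> R)%R by rewrite -natrM.
      by rewrite exprMn invfM mulrA mulfV ?mul1r// expf_neq0.
    have cg : series (geometric 1 (2^-1) : nat -> R) @ \oo --> (1 * (1 - 2^-1)^-1 : R)%R.
      by apply: cvg_geometric_series; rewrite ger0_norm// invf_lt1// ltr1n.
    have -> : \sum_(k <oo) (geometric 1 (2^-1) k : R)%:E = (1 * (1 - 2^-1)^-1 : R)%:E.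
      apply/cvg_lim => //.
      have -> : (fun N => \sum_(0 <= k < N) (geometric 1 (2^-1) k : R)%:E) =
          EFin \o series (geometric 1 (2^-1) : nat -> R).
        by apply/funext => N; rewrite /= /series /= sumEFin.
      by apply: cvg_EFin cg; exact: nearW.
    by rewrite ltry.
  have : {ae M, forall z, \sum_(k <oo) inc k z \is a fin_num}.
    have : M.-integrable setT (fun z => \sum_(k <oo) inc k z).
      apply/integrableP; split.
        by apply: ge0_emeasurable_sum => // k _; exact: minc.
      rewrite (eq_integral (fun z => \sum_(k <oo) inc k z))// => z _.
      by rewrite gee0_abs// nneseries_ge0.
    by move=> /(integrable_ae measurableT); apply: filterS => z /(_ I).
  apply: filterS => z; rewrite ge0_fin_numE; last by apply: nneseries_ge0.
  move=> /summable_sq_increments_cvg[u au].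
  by rewrite /b (transform_weak_limit mu1 mu_1 lim au).
exists mu; split=> //.
- rewrite (energyE_fine _ _ smu smu) ?mu1 ?ltry//.
  apply: (@fatou_bound _ _ _ _ (fun k z => (a k z * a k z)%R%:E)).
  + by move=> k; apply/measurable_EFinP; exact: measurable_funM.
  + by apply/measurable_EFinP; exact: measurable_funM.
  + by move=> k z; rewrite lee_fin -expr2 sqr_ge0.
  + by move=> z; rewrite lee_fin -expr2 sqr_ge0.
  + apply: filterS ae_cvg => z cz; apply: cvg_EFin; first exact: nearW.
    exact: cvgM.
  + by move=> k; have := mu_B k; rewrite (energyE_fine _ _ (smu_ k) (smu_ k)) ?mu_1 ?ltry.
- move=> k.
  (* The sequence is shifted to start at [k], where the Cauchy bound against [mu_ k] begins to
     hold. *)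
  apply: (@fatou_bound _ _ _ _ (fun l z => ((a (l + k)%N z - a k z) ^+ 2)%R%:E)).
  + by move=> l; apply/measurable_EFinP; apply: measurable_funX; exact: measurable_funB.
  + apply/measurable_EFinP; apply: measurable_funX; exact: (measurable_funB mb (ma k)).
  + by move=> l z; rewrite lee_fin sqr_ge0.
  + by move=> z; rewrite lee_fin sqr_ge0.
  + apply: filterS ae_cvg => z cz; apply: cvg_EFin; first exact: nearW.
    have cz' : (a (l + k)%N z - a k z)%R @[l --> \oo] --> (b z - a k z)%R.
      by apply: cvgB; [rewrite (cvg_shiftn k (a ^~ z))|exact: cvg_cst].
    by under eq_fun do rewrite expr2; rewrite expr2; exact: cvgM.
  + by move=> l; have := cauchy k (l + k)%N (leq_addl _ _); rewrite sqdiffC.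
Qed.

End completeness.

(** * Minimization *)

Section minimization.
Variables (R : realType) (n : nat) (alpha : R).
Local Notation Rn := 'rV[R]_n.
Local Notation X := (borelRn R n).
Local Notation posmeas := {measure set X -> \bar R}.
Context d (Z : measurableType d) (M : {sigma_finite_measure set Z -> \bar R}).
Variable H : Rn -> Z -> R.
Hypotheses
  (cH : forall z, continuous (H^~ z))
  (mH : measurable_fun setT (fun p : X * Z => H p.1 p.2))
  (bH : forall z, exists C, forall x, 0 <= H x z <= C)
  (HE : forall x y, (\int[M]_z (H x z * H y z)%:E = riesz_kernel alpha x y)%E)
  (separating : forall mu nu : posmeas, mu setT = 1%E -> nu setT = 1%E ->
    sqdiff M H mu nu = 0%E -> forall B, measurable B -> mu B = nu B)
  (alpha_lt_n : alpha < n%:R).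
Variables (A : set Rn) (thp thn : posmeas) (g : Rn -> \bar R).
Hypotheses (closedA : Eplus_strongly_closed alpha A)
  (capA : (inner_capacity alpha A < +oo)%E)
  (fthp : finite_self_energy alpha thp) (fthn : finite_self_energy alpha thn)
  (g0 : forall x, (0 <= g x)%E) (lg : lsc g).
Implicit Types (mu nu th rho : posmeas).
Local Notation energy := (energy alpha).
Local Notation sqdiff := (sqdiff M H).

Let H0 x z : 0 <= H x z.
Proof. by have [C /(_ x)/andP[]] := bH z. Qed.

Definition admissible mu := Eplus1_on alpha A mu /\ (\int[mu]_x g x < +oo)%E.

(** The integral of the field up to an additive constant: [g] will be [psi] plus the potential of
    [omega], shifted to be nonnegative, and [thp], [thn] the two parts of [theta]. *)
Definition linear_energy mu : R :=
  fine (\int[mu]_x g x)%E + fine (energy mu thp) - fine (energy mu thn).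

Definition weighted_energy mu : R := fine (energy mu mu) + 2 * linear_energy mu.

Local Notation J := weighted_energy.

Let mg : measurable_fun setT (g : X -> \bar R).
Proof. exact: lsc_measurable. Qed.

Lemma admissible_fin mu : admissible mu ->
  [/\ finite_self_energy alpha mu, energy mu mu \is a fin_num,
      energy mu thp \is a fin_num, energy mu thn \is a fin_num &
      (\int[mu]_x g x)%E \is a fin_num].
Proof.
move=> [Amu gmu]; have fmu := Eplus1_finite_self_energy Amu.
have fin th : finite_self_energy alpha th -> energy mu th \is a fin_num.
  exact: (energy_fin_num mH H0 HE fmu).
split; [exact: fmu|exact: (fin mu fmu)|exact: (fin thp fthp)|exact: (fin thn fthn)|].
by rewrite ge0_fin_numE//; apply: integral_ge0.
Qed.

(** Young's inequality absorbs the only negative term, twice the mutual energy with [thn], into the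
    energy of [mu]. *)
Lemma weighted_energy_lb mu : admissible mu -> - fine (energy thn thn) <= J mu.
Proof.
move=> amu; have [fmu f1 f2 f3 f4] := admissible_fin amu.
have := energy_young mH H0 HE ltr01 fmu.1 fthn.1.
have := energy_ge0 alpha mu thp; have : (0 <= \int[mu]_x g x)%E by apply: integral_ge0.
have := energy_fin_num mH H0 HE fthn fthn; move: f1 f2 f3 f4; rewrite /J /linear_energy.
case: (energy mu mu) => [a| |]//; case: (energy mu thp) => [b| |]//; case: (energy mu thn) => [c| |]//.
case: (integral _ _ _) => [i| |]//; case: (energy thn thn) => [t| |]// _ _ _ _ _.
by rewrite invr1 -!EFinM -EFinD !lee_fin /=; lra.
Qed.

(** The linear part is affine at the midpoint and cancels, so the parallelogram identity passes from
    the energy to [J]. *)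
Lemma weighted_energy_average mu nu : admissible mu -> admissible nu ->
  exists2 rho, admissible rho &
    sqdiff mu nu = (2 * J mu + 2 * J nu - 4 * J rho)%:E.
Proof.
move=> amu anu; have [fmu f1 f2 f3 f4] := admissible_fin amu.
have [fnu k1 k2 k3 k4] := admissible_fin anu.
have [rho [Arho Irho Erho par]] := Eplus1_average mH H0 HE alpha_lt_n amu.1 anu.1.
have gE : (\int[rho]_x g x = (2^-1)%:E * (\int[mu]_x g x + \int[nu]_x g x))%E.
  by apply: Irho.
have arho : admissible rho.
  split=> //; rewrite gE; move: f4 k4.
  case: (integral mu _ _) => [a| |]//; case: (integral nu _ _) => [b| |]// _ _.
  by rewrite -EFinD -EFinM ltry.
exists rho => //; have [frho r1 r2 r3 r4] := admissible_fin arho.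
move: par (Erho _ fthp.1) (Erho _ fthn.1) gE (sqdiff_ge0 M H mu nu).
rewrite /J /linear_energy -/(sqdiff mu nu).
move: f1 f2 f3 f4 k1 k2 k3 k4 r1 r2 r3 r4.
case: (energy mu mu) => [a1| |]//; case: (energy mu thp) => [a2| |]//; case: (energy mu thn) => [a3| |]//.
case: (integral mu _ _) => [a4| |]//.
case: (energy nu nu) => [b1| |]//; case: (energy nu thp) => [b2| |]//; case: (energy nu thn) => [b3| |]//.
case: (integral nu _ _) => [b4| |]//.
case: (energy rho rho) => [c1| |]//; case: (energy rho thp) => [c2| |]//; case: (energy rho thn) => [c3| |]//.
case: (integral rho _ _) => [c4| |]//.
case: (sqdiff mu nu) => [s| |]// _ _ _ _ _ _ _ _ _ _ _ _.
rewrite -?EFinD -?EFinM -?EFinD => -[E1] [E2] [E3] [E4] _ /=; congr EFin.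
rewrite E2 E3 E4; lra.
Qed.

Lemma sqdiff_le_excess mu nu m : admissible mu -> admissible nu ->
  (forall rho, admissible rho -> m <= J rho) ->
  (sqdiff mu nu <= (2 * (J mu - m) + 2 * (J nu - m))%:E)%E.
Proof.
move=> amu anu hm; have [rho arho ->] := weighted_energy_average amu anu.
by rewrite lee_fin; have := hm _ arho; lra.
Qed.

(** The inequality for [J (mu_ k)] is solved for the integral of [g], and every energy of [mu_ k] is
    exchanged for that of [mu]. With e = 2^(-k) against a squared distance 4^(-k), each exchange
    costs O(2^(-k)). *)
Lemma linear_energy_limit mu (mu_ : nat -> posmeas) (B m : R) :
  Eplus1_on alpha A mu -> (forall k, admissible (mu_ k)) ->
  (forall k, (energy (mu_ k) (mu_ k) <= B%:E)%E) ->
  (forall k, (sqdiff mu (mu_ k) <= ((4 ^+ k)^-1)%:E)%E) ->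
  (forall k, J (mu_ k) <= m + (2 ^+ k)^-1) ->
  exists K : R, forall k, (\int[mu_ k]_x g x <=
    ((m - fine (energy mu mu)) / 2 - fine (energy mu thp) + fine (energy mu thn)
     + (2 ^+ k)^-1 * K)%:E)%E.
Proof.
move=> Amu amu_ muB sq Jm.
have fmu := Eplus1_finite_self_energy Amu.
pose Tp := fine (energy thp thp); pose Tn := fine (energy thn thn).
(* In units of 2^(-k), the summands pay for the excess of [J], for the change of the self-energy,
   and for the changes of the mutual energies with [thp] and with [thn]. *)
exists (1 + (B + 2) / 2 + (Tp + 1) + (Tn + 1)) => k.
have [fk f1 f2 f3 f4] := admissible_fin (amu_ k).
set t := (2 ^+ k : R)^-1.
have t0 : 0 < t by rewrite invr_gt0 exprn_gt0.
have t1 : t <= 1 by rewrite invf_le1 ?exprn_gt0// exprn_ege1// ler1n.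
have tE : (4 ^+ k)^-1 = t ^+ 2 :> R.
  by rewrite /t exprVn -exprM mulnC exprM; congr ((_ ^+ k)^-1); rewrite expr2 -natrM.
have e1 := energy_diff mH H0 HE t0 fmu fk fthp.
have e2 := energy_diff mH H0 HE t0 fk fmu fthn.
have e3 := energy_self_diff mH H0 HE t0 fmu fk.
have hs := sq k; rewrite tE in hs.
have s0 := sqdiff_ge0 M H mu (mu_ k).
have hJ := Jm k; have hB := muB k.
have j1 := energy_fin_num mH H0 HE fmu fmu.
have j2 := energy_fin_num mH H0 HE fmu fthp.
have j3 := energy_fin_num mH H0 HE fmu fthn.
have j4 := energy_fin_num mH H0 HE fthp fthp.
have j5 := energy_fin_num mH H0 HE fthn fthn.
rewrite -/t in hJ.
rewrite (sqdiffC M H (mu_ k) mu) in e2.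
have i0 := energy_ge0 alpha (mu_ k) (mu_ k).
move: f1 f2 f3 f4 j1 j2 j3 j4 j5 e1 e2 e3 hs s0 hJ hB i0; rewrite /J /linear_energy /Tp /Tn.
case: (energy mu mu) => [a1| |]//; case: (energy mu thp) => [a2| |]//; case: (energy mu thn) => [a3| |]//.
case: (energy (mu_ k) (mu_ k)) => [b1| |]//; case: (energy (mu_ k) thp) => [b2| |]//; case: (energy (mu_ k) thn) => [b3| |]//.
case: (integral (mu_ k) _ _) => [b4| |]//.
case: (energy thp thp) => [c1| |]//; case: (energy thn thn) => [c2| |]//.
case: (sqdiff mu (mu_ k)) => [s| |]// _ _ _ _ _ _ _ _ _.
rewrite -?EFinM -?EFinD -?EFinM -?EFinD !lee_fin /= => e1 e2 e3 hs s0 hJ hB i0.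
have h1 : t^-1 * s <= t.
  by rewrite mulrC ler_pdivrMr// -expr2.
have h2 : (1 + t) * b1 <= b1 + t * B by rewrite mulrDl mul1r lerD2l ler_pM2l.
have h3 : (1 + t^-1) * s <= t + t.
  rewrite mulrDl mul1r lerD//; apply: le_trans hs _.
  by rewrite expr2 ler_piMl// ltW.
lra.
Qed.

Theorem weighted_energy_minimizer : (exists mu, admissible mu) ->
  exists la, [/\ admissible la, forall mu, admissible mu -> J la <= J mu &
    forall mu, admissible mu -> J mu <= J la ->
      forall B, measurable B -> mu B = la B].
Proof.
move=> [mu0 amu0].
pose S := [set J mu | mu in admissible]; pose m := inf S.
have hS : has_inf S.
  split; first by exists (J mu0), mu0.
  by exists (- fine (energy thn thn)) => _ [mu amu <-]; exact: weighted_energy_lb.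
have hm mu : admissible mu -> m <= J mu.
  by move=> amu; apply: ge_inf; [exact: hS.2|exists mu].
(* Twice the excess of each of two members is at most [4 * eps k], so the squared distances meet the
   rate 4^(-k). *)
pose eps k : R := (4 ^+ k)^-1 / 4.
have eps0 k : 0 < eps k by rewrite divr_gt0// invr_gt0 exprn_gt0.
have /choice[mu_ hmu_] k : exists mu, admissible mu /\ J mu < m + eps k.
  have [_ [mu amu <-] h] := inf_adherent (eps0 k) hS.
  by exists mu; split.
have amu_ k : admissible (mu_ k) by have [] := hmu_ k.
have Amu_ k : Eplus1_on alpha A (mu_ k) by have [] := amu_ k.
have cauchy k l : (k <= l)%N -> (sqdiff (mu_ k) (mu_ l) <= ((4 ^+ k)^-1)%:E)%E.
  move=> kl; apply: le_trans (sqdiff_le_excess (amu_ k) (amu_ l) hm) _.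
  rewrite lee_fin.
  have epskl : eps l <= eps k.
    by rewrite ler_pM2r ?invr_gt0// lef_pV2 ?posrE ?exprn_gt0// ler_weXn2l// ler1n.
  have [_ h1] := hmu_ k; have [_ h2] := hmu_ l.
  have -> : (4 ^+ k)^-1 = 4 * eps k by rewrite /eps mulrC divfK.
  lra.
(* From [energy_self_diff] with e = 1 against [mu_ 0], whose squared distance to every member is at
   most 1. *)
pose B := 2 * fine (energy (mu_ 0%N) (mu_ 0%N)) + 2.
have muB k : (energy (mu_ k) (mu_ k) <= B%:E)%E.
  have [f0 fe0 _ _ _] := admissible_fin (amu_ 0%N); have [fk _ _ _ _] := admissible_fin (amu_ k).
  have h := energy_self_diff mH H0 HE ltr01 fk f0.
  apply: le_trans h _; rewrite sqdiffC.
  apply: (@le_trans _ _ ((1 + 1)%R%:E * energy (mu_ 0%N) (mu_ 0%N) + (1 + 1^-1)%R%:E * 1%:E)%E).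
    apply: leeD => //; apply: lee_wpmul2l; first by rewrite lee_fin addr_ge0.
    by have := cauchy 0%N k (leq0n k); rewrite expr0 invr1.
  rewrite -(fineK fe0) -!EFinM -EFinD lee_fin /B invr1; lra.
have tight := Eplus1_tight mH H0 HE alpha_lt_n capA Amu_ muB.
have mu1_ k : mu_ k setT = 1%E by have [] := Amu_ k.
have [mu [mu1 muBB sq lim]] := strong_limit cH mH bH HE mu1_ muB tight cauchy.
have Amu : Eplus1_on alpha A mu.
  split=> //; apply: (Eplus_on_strong_limit mH bH HE alpha_lt_n closedA mu1 _ Amu_).
    by apply: le_lt_trans muBB _; rewrite ltry.
  move=> e e0.
  have [k _ hk] : \forall k \near \oo, (4 ^+ k : R)^-1 < e.
    have c4 : (4^-1 : R) ^+ k @[k --> \oo] --> (0 : R).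
      by apply: cvg_expr; rewrite ger0_norm// invf_lt1// ltr1n.
    have /cvgrPdist_lt /(_ e e0) := c4; apply: filterS => k /=.
    by rewrite sub0r normrN exprVn ger0_norm// invr_ge0 exprn_ge0.
  exists k; apply: le_lt_trans (sq k) _; rewrite lte_fin; exact: (hk k (leqnn k)).
have Jm k : J (mu_ k) <= m + (2 ^+ k)^-1.
  have [_ h] := hmu_ k; apply: (le_trans (ltW h)); rewrite lerD2l.
  apply: (@le_trans _ _ (4 ^+ k)^-1).
    by rewrite ler_pdivrMr// ler_peMr ?invr_ge0 ?exprn_ge0// ler1n.
  by rewrite lef_pV2 ?posrE ?exprn_gt0// lerXn2r ?nnegrE// ler_nat.
have [K hK] := linear_energy_limit Amu amu_ muB sq Jm.
(* [c] is the value of the integral of [g] at which [J mu] equals [m]. *)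
set c := (m - fine (energy mu mu)) / 2 - fine (energy mu thp) + fine (energy mu thn) in hK.
have gc : (\int[mu]_x g x <= c%:E)%E.
  apply/lee_addgt0Pr => e e0.
  have [N _ hN] : \forall k \near \oo, (2 ^+ k : R)^-1 * K <= e.
    have c2 : (2^-1 : R) ^+ k * K @[k --> \oo] --> 0 * K.
      by apply: cvgMl; apply: cvg_expr; rewrite ger0_norm// invf_lt1// ltr1n.
    move: c2; rewrite mul0r => /cvgrPdist_le /(_ e e0); apply: filterS => k /=.
    by rewrite sub0r normrN exprVn; exact/le_trans/ler_norm.
  apply: (lim g g0 lg _ N) => k Nk; apply: le_trans (hK k) _.
  by rewrite -EFinD lee_fin lerD2l; exact: hN.
have amu : admissible mu.
  by split=> //; apply: le_lt_trans gc _; rewrite ltry.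
have Jmu : J mu <= m.
  have [_ _ _ _ f4] := admissible_fin amu.
  move: gc; rewrite -(fineK f4) lee_fin /c /J /linear_energy; lra.
exists mu; split=> //.
  by move=> nu /hm; exact: le_trans.
move=> nu anu Jnu; apply: separating => //; first by have [[]] := anu.
apply/eqP; rewrite eq_le sqdiff_ge0 andbT.
apply: le_trans (sqdiff_le_excess anu amu hm) _.
rewrite lee_fin; lra.
Qed.

End minimization.

(** * External fields *)

Section field.
Variables (R : realType) (n : nat) (alpha : R).
Local Notation Rn := 'rV[R]_n.
Local Notation X := (borelRn R n).
Local Notation posmeas := {measure set X -> \bar R}.
Context d (Z : measurableType d) (M : {sigma_finite_measure set Z -> \bar R}).
Variable H : Rn -> Z -> R.
Hypotheses
  (mH : measurable_fun setT (fun p : X * Z => H p.1 p.2))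
  (H0 : forall x z, 0 <= H x z)
  (HE : forall x y, (\int[M]_z (H x z * H y z)%:E = riesz_kernel alpha x y)%E)
  (alpha_lt_n : alpha < n%:R).
Variables (A : set Rn) (psi : Rn -> \bar R) (v : Rn -> R) (cp cv : R)
  (thp thn : posmeas).
Local Notation F := (closure A).
Hypotheses
  (lpsi : forall x a, F x -> (a%:E < psi x)%E ->
    \forall y \near x, F y -> (a%:E < psi y)%E)
  (psi_ge : forall x, F x -> ((- cp)%:E <= psi x)%E)
  (lv : forall x e, F x -> 0 < e -> \forall y \near x, F y -> v x - e < v y)
  (v_ge : forall x, F x -> - cv <= v x)
  (mv : measurable_fun setT (v : X -> R))
  (fthp : finite_self_energy alpha thp) (fthn : finite_self_energy alpha thn).
Implicit Types (mu nu th rho : posmeas).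
Local Notation energy := (energy alpha).
Local Open Scope ereal_scope.

(* The value [+oo] off [closure A] makes this function lower semicontinuous on
   the whole space, and the constant [cp + cv] makes it nonnegative. *)
Definition shifted_field (x : Rn) : \bar R :=
  if pselect (F x) then psi x + (v x + (cp + cv))%:E else +oo.

Local Notation g := shifted_field.

Lemma shifted_fieldE x : F x -> g x = psi x + (v x + (cp + cv))%:E.
Proof. by rewrite /g; case: pselect. Qed.

Lemma shifted_field_out x : ~ F x -> g x = +oo.
Proof. by rewrite /g; case: pselect. Qed.

Lemma shifted_field_ge0 x : 0 <= g x.
Proof.
have [Fx|/shifted_field_out->] := pselect (F x); last by rewrite leey.
rewrite shifted_fieldE//.
apply: (@le_trans _ _ ((- cp)%:E + (v x + (cp + cv))%:E)); last exact: leeD2r (psi_ge Fx).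
by rewrite -EFinD lee_fin; have := v_ge Fx; lra.
Qed.

Lemma shifted_field_lsc : lsc g.
Proof.
move=> a; rewrite openE => x /=.
have [Fx|nFx] := pselect (F x); last first.
  move=> _; have : nbhs x (~` F).
    by apply: open_nbhs_nbhs; split=> //; apply: closed_openC; exact: closed_closure.
  by apply: filterS => y nFy /=; rewrite shifted_field_out ?ltry.
rewrite shifted_fieldE// => ax.
(* The margin above [a] is shared between [psi] and [v]; where [psi x] is infinite, any finite [b]
   is available. *)
have [b [e [e0 bx abe]]] : exists b e : R, [/\ (0 < e)%R, b%:E < psi x &
    (a <= b + (v x - e) + (cp + cv))%R].
  have := psi_ge Fx; move: ax; case: (psi x) => [r| |]//= ax _.
    move: ax; rewrite -EFinD lte_fin => ax.
    pose t := (r + (v x + (cp + cv)) - a)%R; have t0 : (0 < t)%R by rewrite /t; lra.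
    exists (r - t / 2)%R, (t / 2)%R; rewrite divr_gt0// lte_fin; split=> //; first by lra.
    by rewrite /t; lra.
  exists (a + 1 - v x - (cp + cv))%R, 1%R; rewrite ltr01 ltry; split=> //; lra.
have h1 := lpsi Fx bx; have h2 := lv Fx e0.
move: h1 h2; apply: filterS2 => y h1 h2 /=.
have [Fy|/shifted_field_out->] := pselect (F y); last by rewrite ltry.
rewrite shifted_fieldE//.
apply: (@lt_trans _ _ (b%:E + (v y + (cp + cv))%:E)).
  by rewrite -EFinD lte_fin; have := h2 Fy; lra.
by rewrite lteD2rE// h1.
Qed.

Let mF : measurable (F : set X).
Proof. by apply: closed_borel; exact: closed_closure. Qed.

Let mg : measurable_fun setT (g : X -> \bar R).
Proof. by apply: lsc_measurable; exact: shifted_field_lsc. Qed.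

Lemma measurable_psi : measurable_fun (F : set X) (psi : X -> \bar R).
Proof.
apply: (@eq_measurable_fun _ _ _ _ _ (fun x : X => g x - (v x + (cp + cv))%:E)).
  move=> x /set_mem Fx; rewrite shifted_fieldE//.
  by rewrite addeK.
apply: (@measurable_funS _ _ _ _ setT) => //.
apply: emeasurable_funB => //; apply/measurable_EFinP.
by apply: measurable_funD => //; exact: measurable_cst.
Qed.

Lemma Eplus_on_closure_null mu : Eplus_on alpha A mu -> mu (~` F) = 0.
Proof.
move=> [_ [N [mN N0 AN]]]; apply/eqP; rewrite eq_le measure_ge0 andbT -N0.
rewrite le_measure ?inE//; first exact: measurableC.
by move=> x nFx; apply: AN => Ax; apply: nFx; exact: subset_closure.
Qed.

Lemma integral_closure mu f : Eplus_on alpha A mu -> measurable_fun setT f ->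
  (forall x, 0 <= f x) -> \int[mu]_(x in F) f x = \int[mu]_x f x.
Proof.
move=> /Eplus_on_closure_null mu0 mf f0.
rewrite -[in RHS](setUv F) ge0_integral_setU//.
- by rewrite (integral_null_set _ (measurableC mF) mu0) adde0.
- exact: measurableC.
- by rewrite setUv.
- exact/disj_setPCl.
Qed.

Lemma potential_integrable mu th : Eplus1_on alpha A mu -> finite_self_energy alpha th ->
  mu.-integrable F (potential alpha th) /\
  \int[mu]_(x in F) potential alpha th x = energy mu th.
Proof.
move=> Amu fth; have fmu := Eplus1_finite_self_energy Amu.
have mp := measurable_potential mH H0 HE fth.1.
have E : \int[mu]_(x in F) potential alpha th x = energy mu th.
  by apply: integral_closure => //; [exact: Amu.1|move=> x; exact: potential_ge0].
split=> //; apply/integrableP; split; first exact: (measurable_funS measurableT).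
under eq_integral do rewrite gee0_abs ?potential_ge0//.
by rewrite E (energy_lty mH H0 HE).
Qed.

Variable f : Rn -> \bar R.
Hypothesis fE : forall x, F x ->
  f x = psi x + (potential alpha thp x - potential alpha thn x) + (v x)%:E.

Let mf : measurable_fun (F : set X) (f : X -> \bar R).
Proof.
apply: (@eq_measurable_fun _ _ _ _ _
  (fun x : X => psi x + (potential alpha thp x - potential alpha thn x) + (v x)%:E)).
  by move=> x /set_mem Fx; rewrite fE.
apply: emeasurable_funD.
  apply: emeasurable_funD; first exact: measurable_psi.
  apply: (@measurable_funS _ _ _ _ setT) => //.
  by apply: emeasurable_funB; [exact: (measurable_potential mH H0 HE fthp.1)
                              |exact: (measurable_potential mH H0 HE fthn.1)].
by apply: (@measurable_funS _ _ _ _ setT) => //; exact/measurable_EFinP.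
Qed.

Lemma integrable_cst mu (c : R) : Eplus1_on alpha A mu ->
  mu.-integrable F (cst c%:E) /\ \int[mu]_(x in F) c%:E = c%:E.
Proof.
move=> [Amu mu1].
have F1 : mu F = 1.
  have := integral_closure Amu (@measurable_cst _ _ X (\bar R) setT 1) (fun=> lee01).
  by rewrite !integral_cst// !mul1e mu1.
split; last by rewrite integral_cst// F1 mule1.
apply/integrableP; split; first exact: measurable_cst.
by under eq_integral do rewrite abse_EFin; rewrite integral_cst// F1 mule1 ltry.
Qed.

(** Both potentials are integrable, hence finite off a null set; there the sum defining [f] contains
    no oo - oo and may be rearranged. *)
Lemma ae_field mu : Eplus1_on alpha A mu ->
  {ae mu, forall x, F x ->
    [/\ potential alpha thp x \is a fin_num, potential alpha thn x \is a fin_num &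
      f x = g x - (cp + cv)%:E + (potential alpha thp x - potential alpha thn x)]}.
Proof.
move=> Amu.
have [/(integrable_ae mF) ip _] := potential_integrable Amu fthp.
have [/(integrable_ae mF) im _] := potential_integrable Amu fthn.
move: ip im; apply: filterS2 => x /= ip im Fx; have pf := ip Fx; have nf := im Fx; split=> //.
rewrite fE// shifted_fieldE//; have := psi_ge Fx; move: pf nf.
case: (potential alpha thp x) => [a| |]//; case: (potential alpha thn x) => [b| |]// _ _.
case: (psi x) => [c| |]// _.
by rewrite -?EFinB -?EFinD; congr EFin; ring.
Qed.

Lemma field_integrable mu : Eplus1_on alpha A mu -> \int[mu]_x g x < +oo ->
  mu.-integrable F f /\ \int[mu]_(x in F) f x =
    (linear_energy alpha thp thn g mu - (cp + cv))%:E.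
Proof.
move=> Amu gfin.
have [ip Ep] := potential_integrable Amu fthp; have [im Em] := potential_integrable Amu fthn.
have [ic Ec] := integrable_cst (cp + cv) Amu.
have Eg : \int[mu]_(x in F) g x = \int[mu]_x g x.
  by apply: integral_closure => //; [exact: Amu.1|exact: shifted_field_ge0].
have ig : mu.-integrable F g.
  apply/integrableP; split; first exact: (measurable_funS measurableT).
  by under eq_integral do rewrite gee0_abs ?shifted_field_ge0//; rewrite Eg.
pose h x := g x - (cp + cv)%:E + (potential alpha thp x - potential alpha thn x).
have ih1 := integrableB mF ig ic.
have ih2 := integrableB mF ip im.
have ih : mu.-integrable F h by exact: (integrableD mF ih1 ih2).
have fh : ae_eq mu F f h.
  by have := ae_field Amu; apply: (@filterS _ _ (ae_filter_ringOfSetsType mu)) => x hx /hx[].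
have fi : mu.-integrable F f.
  apply/integrableP; split; first exact: mf.
  have /integrableP[mh] := ih.
  rewrite (@ge0_ae_eq_integral _ X R mu F (fun x : X => `|f x|) (fun x : X => `|h x|))//.
  - exact: measurableT_comp.
  - exact: measurableT_comp.
  - by have := fh; apply: (@filterS _ _ (ae_filter_ringOfSetsType mu)) => x hx /hx ->.
split=> //.
have -> : \int[mu]_(x in F) f x = \int[mu]_(x in F) h x.
  by apply: ae_eq_integral => //; have /integrableP[] := ih.
rewrite (integralD mF ih1 ih2) (integralB mF ig ic) (integralB mF ip im) Ep Em Ec Eg.
rewrite /linear_energy.
have := energy_fin_num mH H0 HE (Eplus1_finite_self_energy Amu) fthp.
have := energy_fin_num mH H0 HE (Eplus1_finite_self_energy Amu) fthn.
have : 0 <= \int[mu]_x g x by apply: integral_ge0 => x _; exact: shifted_field_ge0.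
move: gfin; case: (integral _ _ _) => [a| |]//; case: (energy mu thp) => [b| |]//.
case: (energy mu thn) => [c| |]// _ _ _ _ /=.
by rewrite -?EFinB -?EFinD; congr EFin; ring.
Qed.

(** [g] is recovered almost everywhere from [f] by adding integrable functions, so the class with
    [f] integrable is exactly the admissible class. *)
Lemma field_integrable_shifted mu : Eplus1_on alpha A mu -> mu.-integrable F f ->
  \int[mu]_x g x < +oo.
Proof.
move=> Amu fi.
have [ip Ep] := potential_integrable Amu fthp; have [im Em] := potential_integrable Amu fthn.
have [ic Ec] := integrable_cst (cp + cv) Amu.
have ih : mu.-integrable F (fun x => f x + cst (cp + cv)%:E x - (potential alpha thp x - potential alpha thn x)).
  apply: integrableB => //; first exact: integrableD.
  exact: integrableB.
rewrite -integral_closure//; [|exact: Amu.1|exact: shifted_field_ge0].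
have /integrableP[mh] := ih; apply: le_lt_trans.
apply: ae_ge0_le_integral => //.
- by move=> x _; exact: shifted_field_ge0.
- exact: (measurable_funS measurableT).
- exact: measurableT_comp.
- have := ae_field Amu; apply: (@filterS _ _ (ae_filter_ringOfSetsType mu)) => x hx /[dup] Fx /hx[pf nf ->]; have := shifted_field_ge0 x; move: pf nf.
  case: (potential alpha thp x) => [a| |]//; case: (potential alpha thn x) => [b| |]// _ _.
  case: (g x) => [c| |]//= _.
  rewrite -?EFinB -?EFinD -?EFinB -?EFinD lee_fin.
  by apply: le_trans (ler_norm _); rewrite le_eqVlt; apply/orP; left; apply/eqP; ring.
Qed.

Lemma Eplus1_field_admissible mu :
  Eplus1_field alpha A f mu <-> admissible alpha A g mu.
Proof.
split=> [[[_ fi] Amu]|[Amu gfin]].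
  by split=> //; exact: field_integrable_shifted.
by split=> //; split; [exact: Amu.1|have [] := field_integrable Amu gfin].
Qed.

Lemma gauss_functional_weighted mu : admissible alpha A g mu ->
  gauss_functional alpha A f mu =
    (weighted_energy alpha thp thn g mu - 2 * (cp + cv))%:E.
Proof.
move=> [Amu gfin]; rewrite /gauss_functional (field_integrable Amu gfin).2.
have := energy_fin_num mH H0 HE (Eplus1_finite_self_energy Amu) (Eplus1_finite_self_energy Amu).
rewrite /weighted_energy; case: (energy mu mu) => [a| |]// _ /=.
by rewrite -EFinM -EFinD; congr EFin; ring.
Qed.

(** A measure carried by the points where [psi] is finite need not integrate [psi]. As its mass is
    exhausted by the sublevel sets of [g], one of them has positive mass, and the measure
    conditioned on it is admissible. *)
Lemma admissible_nonempty :
  0 < inner_capacity alpha [set x | A x /\ psi x < +oo] ->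
  exists mu, admissible alpha A g mu.
Proof.
move=> cap.
have [mu [Amu mu1]] : exists mu, Eplus1_on alpha [set x | A x /\ psi x < +oo] mu.
  apply: contrapT => nmu; move: cap; rewrite /inner_capacity.
  rewrite (_ : [set _ | _ in _] = set0) ?ereal_inf0 ?invey ?ltxx//.
  by apply/seteqP; split=> // e [mu Amu _]; apply: nmu; exists mu.
pose B k : set X := [set x | g x <= k%:R%:E].
have mB k : measurable (B k).
  rewrite -[X in measurable X]setTI; exact: emeasurable_fun_infty_c.
have [k Bk] : exists k, 0 < mu (B k).
  apply: contrapT => nk.
  have B0 k : mu (B k) = 0.
    apply/eqP; rewrite eq_le measure_ge0 andbT leNgt; apply/negP => h; apply: nk; by exists k.
  have [_ [N [mN N0 AN]]] := Amu.
  have : mu setT <= 0.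
    have -> : [set: X] = (\bigcup_k B k) `|` N.
      apply/seteqP; split=> // x _.
      have [Nx|nNx] := pselect (N x); [by right|left].
      have [Ax px] : A x /\ psi x < +oo by apply: contrapT => h; exact/nNx/AN.
      have gx : g x < +oo.
        by rewrite shifted_fieldE; [rewrite lte_add_pinfty// ltry|exact: subset_closure].
      exists (Num.truncn (fine (g x))).+1 => //=; rewrite /B/=.
      have gf : g x \is a fin_num by rewrite ge0_fin_numE// shifted_field_ge0.
      by rewrite -(fineK gf) lee_fin; apply/ltW/truncnS_gt.
    have U0 : mu (\bigcup_k B k) = 0.
      apply: measure_negligible; first exact: bigcup_measurable.
      by apply: negligible_bigcup => k; exists (B k); split.
    have : mu (\bigcup_k B k `|` N) <= mu (\bigcup_k B k) + mu N.
      by apply: measureU2 => //; exact: bigcup_measurable.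
    by rewrite U0 N0 adde0.
  by rewrite mu1 lee_fin ler10.
have Bfin : mu (B k) \is a fin_num.
  rewrite ge0_fin_numE//; apply: (@le_lt_trans _ _ (mu setT)); last by rewrite mu1 ltry.
  by rewrite le_measure ?inE.
have m0 : (0 < fine (mu (B k)))%R by rewrite fine_gt0// Bk ltey_eq Bfin.
have [rho [Arho rhoI _]] := restrict_normalize mH H0 HE alpha_lt_n (mB k) Amu m0 (esym (fineK Bfin)).
exists rho; split.
  have [[E [N [mN N0 AN]]] rho1] := Arho; split=> //; split=> //.
  by exists N; split=> // x nA; apply: AN => -[[Ax _] _]; exact: nA.
rewrite rhoI//; last exact: shifted_field_ge0.
apply: lte_mul_pinfty; rewrite ?lee_fin ?invr_ge0 ?(ltW m0)//.
apply: (@le_lt_trans _ _ (\int[mu]_(x in B k) (cst k%:R%:E) x)).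
  apply: ge0_le_integral => //.
  - by move=> x _; exact: shifted_field_ge0.
  - exact: (measurable_funS measurableT).
rewrite integral_cst// lte_mul_pinfty ?lee_fin//.
by rewrite -ge0_fin_numE.
Qed.

End field.

(** * The potential of [omega] away from its support *)

Section far_potential.
Variables (R : realType) (n : nat) (alpha : R).
Local Notation Rn := 'rV[R]_n.
Local Notation X := (borelRn R n).
Local Notation posmeas := {measure set X -> \bar R}.
Context d (Z : measurableType d) (M : {sigma_finite_measure set Z -> \bar R}).
Variable H : Rn -> Z -> R.
Hypotheses
  (mH : measurable_fun setT (fun p : X * Z => H p.1 p.2))
  (H0 : forall x z, 0 <= H x z)
  (HE : forall x y, (\int[M]_z (H x z * H y z)%:E = riesz_kernel alpha x y)%E)
  (alpha_lt_n : alpha < n%:R).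
Variables (om : posmeas) (S F : set Rn) (r : R).
Hypotheses (omfin : (om setT < +oo)%E) (mS : measurable (S : set X))
  (omS : om (~` S) = 0%E) (r0 : 0 < r)
  (far : forall x y, F x -> S y -> r <= enorm (x - y)).
Local Open Scope ereal_scope.

Let p0 : (alpha - n%:R <= 0)%R.
Proof. by rewrite subr_le0 ltW. Qed.

Lemma riesz_kernel_separated x y : F x -> S y ->
  riesz_kernel alpha x y = (enorm (x - y) `^ (alpha - n%:R))%:E.
Proof.
move=> Fx Sy; rewrite /riesz_kernel; case: eqP => // E.
have := far Fx Sy; rewrite E subrr /enorm big1 ?sqrtr0; last first.
  by move=> i _; rewrite mxE expr0n.
by rewrite leNgt r0.
Qed.

Lemma riesz_kernel_separated_le x y : F x -> S y ->
  riesz_kernel alpha x y <= (r `^ (alpha - n%:R))%:E.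
Proof.
by move=> Fx Sy; rewrite riesz_kernel_separated// lee_fin powR_npos_le// far.
Qed.

Lemma potential_carrier x : potential alpha om x = \int[om]_(y in S) riesz_kernel alpha x y.
Proof.
rewrite /potential -(setUv (S : set X)) ge0_integral_setU//.
- by rewrite (integral_null_set _ (measurableC mS) omS) adde0.
- exact: measurableC.
- by rewrite setUv; exact: (measurable_riesz_kernel mH H0 HE).
- by move=> y _; exact: riesz_kernel_ge0.
- exact/disj_setPCl.
Qed.

Let mk x : measurable_fun (S : set X) (riesz_kernel alpha x : X -> \bar R).
Proof. by apply: measurable_funS (measurable_riesz_kernel mH H0 HE x). Qed.

Lemma potential_far_le x : F x ->
  potential alpha om x <= (r `^ (alpha - n%:R) * fine (om setT))%:E.
Proof.
move=> Fx; rewrite potential_carrier.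
apply: (@le_trans _ _ (\int[om]_(y in S) (cst (r `^ (alpha - n%:R))%:E) y)).
  apply: ge0_le_integral => //.
  - by move=> y _; exact: riesz_kernel_ge0.
  - by move=> y Sy; exact: riesz_kernel_separated_le.
rewrite integral_cst// EFinM fineK ?ge0_fin_numE//.
apply: lee_wpmul2l; first by rewrite lee_fin powR_ge0.
by rewrite le_measure ?inE.
Qed.

Lemma potential_far_fin_num x : F x -> potential alpha om x \is a fin_num.
Proof.
move=> Fx; rewrite ge0_fin_numE ?potential_ge0//.
by apply: le_lt_trans (potential_far_le Fx) _; rewrite ltry.
Qed.

Lemma powR_continuous_pos (p t : R) : (0 < t)%R -> {for t, continuous (fun s => s `^ p)%R}.
Proof.
move=> t0; apply: (@cvg_trans _ (expR (p * ln s) @[s --> t])).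
  apply: near_eq_cvg; near=> s; rewrite /powR gt_eqF//.
  by near: s; exact: lt_nbhsr.
rewrite /powR gt_eqF//.
apply: (@continuous_comp _ _ _ (fun s => p * ln s)%R expR); last exact: continuous_expR.
by apply: cvgMr; exact: continuous_ln.
Unshelve. all: by end_near. Qed.

(** Dominated convergence along a sequence of counterexamples: at distance at least [r] the kernel
    is continuous and bounded by a constant, integrable because the measure is finite. *)
Lemma potential_far_continuous x (e : R) : F x -> (0 < e)%R ->
  \forall y \near x, F y ->
    (`|fine (potential alpha om y) - fine (potential alpha om x)| < e)%R.
Proof.
move=> Fx e0; apply: contrapT => nh.
have /choice[u hu] k : exists y, ball x (k.+1%:R^-1 : R) y /\ F y /\
    (e <= `|fine (potential alpha om y) - fine (potential alpha om x)|)%R.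
  apply: contrapT => ne; apply: nh; apply/nbhs_ballP; exists (k.+1%:R^-1)%R => /=; first by rewrite invr_gt0.
  by move=> y xy Fy; rewrite ltNge; apply/negP => h; apply: ne; exists y.
have ux : u @ \oo --> x.
  apply/cvg_ballP => t t0.
  have : (harmonic : nat -> R) @ \oo --> (0 : R)%R by exact: cvg_harmonic.
  move=> /cvgrPdist_lt/(_ t t0); apply: filterS => k /=.
  rewrite sub0r normrN ger0_norm ?invr_ge0// => kt.
  by have [h _] := hu k; exact: le_ball (ltW kt) _ h.
have cu : potential alpha om (u k) @[k --> \oo] --> potential alpha om x.
  rewrite potential_carrier; under eq_fun do rewrite potential_carrier.
  apply: (@dominated_cvg _ X R om S mS (fun k => riesz_kernel alpha (u k))
    (riesz_kernel alpha x) (cst (r `^ (alpha - n%:R))%:E)) => //.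
  - move=> y Sy; rewrite riesz_kernel_separated//.
    under eq_fun => k do rewrite (riesz_kernel_separated (hu k).2.1 Sy).
    apply: cvg_EFin; first exact: nearW.
    have xy0 : (0 < enorm (x - y))%R by apply: lt_le_trans r0 _; exact: far.
    have cuy : enorm (u k - y) @[k --> \oo] --> enorm (x - y).
      have cd : (u k - y)%R @[k --> \oo] --> (x - y)%R by apply: cvgB => //; exact: cvg_cst.
      apply: (@continuous_cvg _ _ _ _ _ _ (@enorm R n) _ _ cd); exact: continuous_enorm.
    by apply: (@continuous_cvg _ _ _ _ _ _ (fun s => s `^ (alpha - n%:R))%R _ _ cuy); exact: powR_continuous_pos.
  - apply/integrableP; split; first exact: measurable_cst.
    rewrite /= integral_cst// lte_mul_pinfty ?lee_fin//.
    by apply: le_lt_trans omfin; rewrite le_measure ?inE.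
  - move=> k y Sy; rewrite gee0_abs ?riesz_kernel_ge0//.
    exact: (riesz_kernel_separated_le (hu k).2.1 Sy).
rewrite -(fineK (potential_far_fin_num Fx)) in cu.
have cf : fine (potential alpha om (u k)) @[k --> \oo] --> fine (potential alpha om x).
  exact: fine_cvg cu.
move: cf => /cvgrPdist_lt /(_ e e0)[N _ /(_ N (leqnn N))].
by rewrite /= distrC ltNge; case: (hu N) => _ [_ ->].
Qed.

End far_potential.

(** * Consequences of the hypotheses on the data *)

Section data.
Variables (R : realType) (n : nat) (alpha : R).
Local Notation Rn := 'rV[R]_n.
Local Notation X := (borelRn R n).
Implicit Types (s : signed_radon n alpha) (S A F : set Rn).

Lemma support_signed_open_null s (x : Rn) : ~ support_signed s x ->
  exists V : set Rn, [/\ open V, V x, pos_part s V = 0%E & neg_part s V = 0%E].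
Proof.
move=> /existsNP[V] /not_implyP[oV] /not_implyP[Vx] /negP; rewrite -leNgt => V0.
have p0 := measure_ge0 (pos_part s) V; have n0 := measure_ge0 (neg_part s) V.
exists V; split=> //; apply/eqP; rewrite eq_le ?p0 ?n0 andbT; apply: le_trans V0.
  by rewrite leeDl.
by rewrite leeDr.
Qed.

Lemma closed_support_signed s : closed (support_signed s).
Proof.
rewrite -openC openE => x /= /support_signed_open_null[V [oV Vx p0 n0]].
rewrite /interior; apply: filterS (open_nbhs_nbhs (conj oV Vx)) => y Vy /(_ V oV Vy).
by rewrite /abs_signed p0 n0 adde0 ltxx.
Qed.

(** Every point off the support lies in a rational box that is null for both parts, and these boxes
    are countable; [pickle] numbers them so that the union runs over the naturals. *)
Lemma support_signed_null s :
  pos_part s (~` support_signed s) = 0%E /\ neg_part s (~` support_signed s) = 0%E.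
Proof.
have mb (p : 'rV[rat]_n * 'rV[rat]_n) : measurable (rational_box p : set X).
  by apply: open_borel; exact: open_open_box.
pose null_box (p : 'rV[rat]_n * 'rV[rat]_n) :=
  pos_part s (rational_box p) = 0%E /\ neg_part s (rational_box p) = 0%E.
pose N k : set X := [set x | exists p : 'rV[rat]_n * 'rV[rat]_n,
  [/\ pickle p = k, null_box p & rational_box p x]].
have sub : ~` support_signed s `<=` \bigcup_k N k.
  move=> x /support_signed_open_null[V [oV Vx p0 n0]].
  have [p [px pV]] := open_rational_box oV Vx.
  have mV : measurable (V : set X) by exact: open_borel.
  exists (pickle p) => //; exists p; split=> //.
  have le0 (m : {measure set X -> \bar R}) : m V = 0%E -> m (rational_box p) = 0%E.
    move=> mV0; apply/eqP; rewrite eq_le measure_ge0 andbT -mV0.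
    by rewrite le_measure ?inE.
  by split; exact: le0.
have mS : measurable (~` support_signed s : set X).
  by apply: measurableC; apply: closed_borel; exact: closed_support_signed.
have null (m : {measure set X -> \bar R}) :
    (forall p, null_box p -> m (rational_box p) = 0%E) ->
    m (~` support_signed s) = 0%E.
  move=> h; apply: measure_negligible => //.
  apply: (@negligibleS _ X R m (\bigcup_k N k) _ sub); apply: negligible_bigcup => k.
  have [[p [pk p0]]|np] := pselect (exists p, pickle p = k /\ null_box p).
    exists (rational_box p); split=> // [|x [q [qk _ qx]]]; first exact: h.
    by rewrite (_ : p = q)//; apply: (pcan_inj pickleK); rewrite pk qk.
  by exists set0; split=> // x [q [qk q0 _]]; exfalso; apply: np; exists q.
by split; apply: null => p [].
Qed.

(** The bound passes to the closure by continuity of the distance. An infinite distance, as for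
    [omega = 0], is replaced by 1. *)
Lemma set_dist_gt0 S A : (0 < set_dist S A)%E ->
  exists2 r : R, 0 < r & forall x y, closure A x -> S y -> r <= enorm (x - y).
Proof.
move=> D0.
have [r r0 rD] : exists2 r : R, 0 < r & (r%:E <= set_dist S A)%E.
  by move: D0; case: (set_dist S A) => [t| |]// ; [exists t|exists 1; rewrite ?leey].
exists r => // x y Ax Sy.
have cl : closed [set x : Rn | r <= enorm (x - y)].
  have -> : [set x : Rn | r <= enorm (x - y)] = (fun x => enorm (x - y)) @^-1` [set t | r <= t] by [].
  apply: closed_comp; last exact: closed_ge.
  move=> z _; apply: (@continuous_comp Rn Rn R (fun x => x - y) (@enorm R n)).
    exact: (cvgB cvg_id (cvg_cst y)).
  exact: continuous_enorm.
suff sub : A `<=` [set x : Rn | r <= enorm (x - y)].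
  by have := closure_subset sub Ax; rewrite -(iffLR (closure_id _) cl).
move=> z Az /=; rewrite -lee_fin; apply: le_trans rD _; apply: ereal_inf_lbound.
exists y => //; exists z => //; congr EFin; rewrite /enorm; congr Num.sqrt.
by apply: eq_bigr => i _; rewrite !mxE -sqrrN opprB.
Qed.

Lemma subspace_lsc_near F (psi : Rn -> \bar R) (x : Rn) (a : R) :
  lower_semicontinuous (psi : subspace F -> \bar R) -> F x -> (a%:E < psi x)%E ->
  \forall y \near x, F y -> (a%:E < psi y)%E.
Proof.
move=> lpsi Fx /lpsi[V nV h].
have : within F (nbhs x) V by rewrite nbhs_subspace_in.
by apply: filterS => y Vy; exact: h.
Qed.

(** On a compact [F], points with [psi] below [- k] would cluster at a point of [F] near which [psi]
    is bounded below; otherwise [psi] is nonnegative by definition of the class. *)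
Lemma lsc_class_lower_bound F (psi : Rn -> \bar R) : lsc_class F psi ->
  exists c : R, forall x, F x -> ((- c)%:E <= psi x)%E.
Proof.
move=> [lpsi psi_gt psi0]; have [cF|ncF] := pselect (compact F); last first.
  by exists 0; rewrite oppr0; exact: psi0.
apply: contrapT => nb.
have /choice[u hu] (k : nat) : exists x, F x /\ (psi x < (- k%:R)%:E)%E.
  apply: contrapT => h; apply: nb; exists k%:R => x Fx.
  by rewrite leNgt; apply/negP => xk; apply: h; exists x.
have [|x [Fx clx]] := cF (u @ \oo) _; first by exists 0%N => // k _; have [] := hu k.
have [a ax] : exists a : R, (a%:E < psi x)%E.
  have := psi_gt x Fx; case: (psi x) => [t| |]// _; last by exists 0; rewrite ltry.
  by exists (t - 1); rewrite lte_fin; lra.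
have near_x := subspace_lsc_near lpsi Fx ax.
have uN : (u @ \oo) [set u k | k in [set k | (Num.truncn `|a|).+1 <= k]%N].
  by exists (Num.truncn `|a|).+1 => // k hk; exists k.
have [_ [[k /= hk <-] h]] := clx _ _ uN near_x.
have [Fk pk] := hu k.
have := lt_trans (h Fk) pk; rewrite lte_fin ltNge => /negP; apply.
rewrite lerNl; apply: le_trans (ler_norm _) _; rewrite normrN.
by apply: le_trans (ltW (truncnS_gt _)) _; rewrite ler_nat.
Qed.

End data.

(** In the extended reals a difference is finite only when both terms are, so infinite energies of
    the parts cannot cancel. *)
Lemma finite_energy_parts (R : realType) (n : nat) (alpha : R) (s : signed_radon n alpha) :
  finite_energy s -> finite_self_energy alpha (pos_part s) /\
    finite_self_energy alpha (neg_part s).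
Proof.
move=> [_ fin].
have sp := pos_radon_sigma_finite (pos_part_radon s).
have sn := pos_radon_sigma_finite (neg_part_radon s).
suff : (senergy_pos s s < +oo)%E.
  have := energy_ge0 alpha (pos_part s) (pos_part s); have := energy_ge0 alpha (neg_part s) (neg_part s).
  rewrite /senergy_pos /finite_self_energy.
  by case: (energy alpha (pos_part s) _) => [a| |]//; case: (energy alpha (neg_part s) _) => [b| |]//;
    rewrite !ltry.
move: fin; rewrite /senergy; case: (senergy_pos s s) => [a| |]//; first by rewrite ltry.
by case: (senergy_neg s s).
Qed.

Lemma near_difference_lower (T : topologicalType) (R : realFieldType) (F : set T)
    (P Q : T -> R) (x : T) :
  (forall e, 0 < e -> \forall y \near x, F y -> `|P y - P x| < e) ->
  (forall e, 0 < e -> \forall y \near x, F y -> `|Q y - Q x| < e) ->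
  forall e, 0 < e -> \forall y \near x, F y -> P x - Q x - e < P y - Q y.
Proof.
move=> cP cQ e e0; have e20 : 0 < e / 2 by rewrite divr_gt0.
move: (cP _ e20) (cQ _ e20); apply: filterS2 => y hp hn Fy.
by move: (hp Fy) (hn Fy); rewrite !ltr_norml => /andP[? _] /andP[_ ?]; lra.
Qed.

Theorem theorem2p1 (R : realType) (n : nat) (alpha : R)
    (n_ge2 : (2 <= n)%N) (alpha_gt0 : 0 < alpha) (alpha_lt_n : alpha < n%:R)
    (A : set 'rV[R]_n) (psi : 'rV[R]_n -> \bar R)
    (theta omega : signed_radon n alpha)
    (A_closed : Eplus_strongly_closed alpha A)
    (psi_Phi : lsc_class (closure A) psi)
    (theta_E : finite_energy theta)
    (omega_bounded : bounded_signed omega)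
    (omega_far : (0 < set_dist (support_signed omega) A)%E)
    (psi_finite : (0 < inner_capacity alpha [set x | A x /\ (psi x < +oo)%E])%E)
    (cap_finite : (inner_capacity alpha A < +oo)%E) :
  let f := external_field psi theta omega in
  exists lambda : {measure set borelRn R n -> \bar R},
    [/\ Eplus1_field alpha A f lambda,
        gauss_functional alpha A f lambda = gauss_inf alpha A f &
        forall lambda' : {measure set borelRn R n -> \bar R},
          Eplus1_field alpha A f lambda' ->
          gauss_functional alpha A f lambda' = gauss_inf alpha A f ->
          same_measure lambda' lambda].
Proof.
move=> f.
have [d [Z [M [H [cH mH bH HE sep]]]]] := riesz_features alpha_lt_n.
have H0 x z : 0 <= H x z by have [C /(_ x)/andP[]] := bH z.
have [fthp fthn] := finite_energy_parts theta_E.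
have [r r0 far] := set_dist_gt0 omega_far.
have [omp0 omn0] := support_signed_null omega.
have mS : measurable (support_signed omega : set (borelRn R n)).
  by apply: closed_borel; exact: closed_support_signed.
have [ompfin omnfin] : (pos_part omega setT < +oo)%E /\ (neg_part omega setT < +oo)%E.
  by split; apply: le_lt_trans omega_bounded; [rewrite leeDl|rewrite leeDr].
have pfin := potential_far_fin_num mH H0 HE alpha_lt_n ompfin mS omp0 r0 far.
have nfin := potential_far_fin_num mH H0 HE alpha_lt_n omnfin mS omn0 r0 far.
have pcont := potential_far_continuous mH H0 HE alpha_lt_n ompfin mS omp0 r0 far.
have ncont := potential_far_continuous mH H0 HE alpha_lt_n omnfin mS omn0 r0 far.
have nle := potential_far_le mH H0 HE alpha_lt_n omnfin mS omn0 r0 far.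
pose v x := fine (potential alpha (pos_part omega) x) - fine (potential alpha (neg_part omega) x).
have lv (x : 'rV[R]_n) (e : R) : closure A x -> 0 < e -> \forall y \near x, closure A y -> v x - e < v y.
  by move=> Fx; apply: near_difference_lower => t t0; [exact: pcont|exact: ncont].
have mv : measurable_fun setT (v : borelRn R n -> R).
  have mfine (m : {measure set borelRn R n -> \bar R}) : pos_radon alpha m ->
      measurable_fun setT (fun x : borelRn R n => fine (potential alpha m x)).
    move=> /pos_radon_sigma_finite sm.
    by apply: measurableT_comp => //; exact: (measurable_potential mH H0 HE sm).
  exact: (measurable_funB (mfine _ (pos_part_radon omega)) (mfine _ (neg_part_radon omega))).
(* An upper bound on [closure A] for the potential of the negative part of [omega]. *)
pose cv := r `^ (alpha - n%:R) * fine (neg_part omega setT).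
have v_ge x : closure A x -> - cv <= v x.
  move=> Fx; rewrite -[leLHS]add0r lerB//; first by apply: fine_ge0; exact: potential_ge0.
  by rewrite -lee_fin fineK ?nfin// nle.
have [cp psi_ge] := lsc_class_lower_bound psi_Phi.
have lpsi (x : 'rV[R]_n) (a : R) : closure A x -> (a%:E < psi x)%E ->
    \forall y \near x, closure A y -> (a%:E < psi y)%E.
  by have [h _ _] := psi_Phi; exact: subspace_lsc_near.
have fE x : closure A x -> f x = (psi x + (potential alpha (pos_part theta) x -
    potential alpha (neg_part theta) x) + (v x)%:E)%E.
  move=> Fx; rewrite /f /external_field /spotential; congr (_ + _)%E.
  by rewrite EFinB !fineK ?pfin ?nfin.
pose g := shifted_field A psi v cp cv.
have g0 x : (0 <= g x)%E by exact: shifted_field_ge0.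
have lg : lsc g by exact: shifted_field_lsc.
have adm mu : Eplus1_field alpha A f mu <-> admissible alpha A g mu.
  exact: (Eplus1_field_admissible mH H0 HE lpsi psi_ge lv v_ge mv fthp fthn fE).
have gauss mu : admissible alpha A g mu -> gauss_functional alpha A f mu =
    (weighted_energy alpha (pos_part theta) (neg_part theta) g mu - 2 * (cp + cv))%:E.
  exact: (gauss_functional_weighted mH H0 HE lpsi psi_ge lv v_ge mv fthp fthn fE).
have nonempty : exists mu, admissible alpha A g mu.
  exact: (admissible_nonempty mH H0 HE alpha_lt_n lpsi psi_ge lv v_ge psi_finite).
have [la [ala min uniq]] := weighted_energy_minimizer cH mH bH HE sep alpha_lt_n
  A_closed cap_finite fthp fthn g0 lg nonempty.
have la_min : gauss_functional alpha A f la = gauss_inf alpha A f.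
  apply/eqP; rewrite eq_le; apply/andP; split.
    apply: le_ereal_inf_tmp => _ [mu /adm amu <-].
    by rewrite !gauss// lee_fin lerD2r min.
  by apply: ereal_inf_lbound; exists la => //; exact/adm.
exists la; split=> //; first exact/adm.
move=> mu /adm amu; rewrite -la_min !gauss// => -[E] B mB.
by apply: uniq => //; rewrite (addIr _ E).
Qed.
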